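(* Let $\mu>0$, $\sigma^2>0$ and $c\in(0,\infty)$, and let $p=p(n)$ be positive integers with $p\to\infty$ and $p/n\to c$ as $n\to\infty$. For each $n$ let $X=(X_{ij})_{1\le i\le p,\,1\le j\le n}$ be a matrix whose entries are i.i.d. real normal random variables with mean $\mu$ and variance $\sigma^2$, let $W=\frac1n XX^T$, and let $\lambda_1(W)$ be the largest eigenvalue of $W$. Then $\lambda_1(W)$ is asymptotically normal with expectation $p\mu^2+(1+c)\sigma^2$ and variance $4c\mu^2\sigma^2$, that is, $$\lambda_1(W)-p\mu^2-(1+c)\sigma^2\ \longrightarrow\ N(0,4c\mu^2\sigma^2)\quad\text{in distribution as } n\to\infty.$$ The approximation is of order $\sqrt p/n$ in the following sense: there exist constants $C_2,C_3,K>0$, not depending on $n$, $p$, $x$, such that for all sufficiently large $n$ and all $x>0$, $$\mathbb{P}\left(\left|\lambda_1^{(1)}-\lambda_1(W)+\frac{p\sigma^2}{n}\right|>\frac{C_2\sqrt p\,x}{n}\right)<\frac{C_3}{x^2}+\frac{K}{p}.$$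
   Context: $W_i=\sum_{j=1}^p W_{ij}$ denotes the sum of the entries in the $i$-th row of $W=(W_{ij})_{1\le i,j\le p}$, and $\lambda_1^{(1)}=\frac1p\sum_{i=1}^p W_i$. $N(0,s^2)$ denotes the normal distribution with mean $0$ and variance $s^2$. *)

(* Defs.v *)
From HB Require Import structures.
From mathcomp Require Import all_boot all_order all_algebra.
From mathcomp Require Import all_classical all_reals all_analysis.
Set Implicit Arguments.
Unset Strict Implicit.
Unset Printing Implicit Defensive.
Import Order.TTheory GRing.Theory Num.Theory.
Import numFieldNormedType.Exports.
Local Open Scope classical_set_scope.
Local Open Scope ring_scope.

(* The supremum is a maximum as soon as A has an eigenvalue in R (e.g. if A is
   symmetric of positive size), since the set of eigenvalues is finite; see
   lambda_maxE. *)
Definition lambda_max (R : realType) (p : nat) (A : 'M[R]_p) : R :=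
  sup [set a : R | eigenvalue A a].

Lemma lambda_maxE (R : realType) (p : nat) (A : 'M[R]_p) (a : R) :
  eigenvalue A a -> (forall b, eigenvalue A b -> b <= a) -> lambda_max A = a.
Proof.
move=> Aa ub_a; apply/eqP; rewrite eq_le; apply/andP; split.
  by apply: ge_sup; [exists a | move=> b; exact: ub_a].
by apply: ub_le_sup => //; exists a => b; exact: ub_a.
Qed.

Section random_matrix.
Context {R : realType}.

Definition sample_mx (T : Type) (p n : nat) (X : 'I_p -> 'I_n -> T -> R)
    (w : T) : 'M[R]_(p, n) :=
  \matrix_(i, j) X i j w.

Definition cov_mx (p n : nat) (X : 'M[R]_(p, n)) : 'M[R]_p :=
  n%:R^-1 *: (X *m X^T).

Definition row_sum (p : nat) (W : 'M[R]_p) (i : 'I_p) : R := \sum_j W i j.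

Definition lambda11 (p : nat) (W : 'M[R]_p) : R :=
  p%:R^-1 * \sum_i row_sum W i.

End random_matrix.

Section random_variables.
Context {d : measure_display} {T : measurableType d} {R : realType}
  (P : probability T R).

Definition mutually_independent (I : finType) (X : I -> {RV P >-> R}) : Prop :=
  forall (J : {set I}) (B : I -> set R), (forall i, measurable (B i)) ->
    P (\bigcap_(i in [set` J]) X i @^-1` B i) =
    (\prod_(i in J) P (X i @^-1` B i))%E.

(* The second parameter of normal_prob is the standard deviation. The laws are
   compared on measurable sets only, the values of a measure elsewhere being
   irrelevant. *)
Definition has_normal_law (X : {RV P >-> R}) (m s : R) : Prop :=
  forall A : set R, measurable A -> distribution P X A = normal_prob m s A.

Definition iid_normal (p n : nat) (X : 'I_p -> 'I_n -> {RV P >-> R})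
    (m s : R) : Prop :=
  mutually_independent (fun ij : 'I_p * 'I_n => X ij.1 ij.2) /\
  forall i j, has_normal_law (X i j) m s.

End random_variables.

(* The Y n may live on different probability spaces; their being random
   variables (measurability) is part of the notion. *)
Definition cvg_in_distribution {R : realType} (d : nat -> measure_display)
    (T : forall n, measurableType (d n)) (P : forall n, probability (T n) R)
    (Y : forall n, T n -> R)
    (nu : probability (measurableTypeR R) R) : Prop :=
  (forall n, measurable_fun setT (Y n)) /\
  forall x : R,
    {for x, continuous (fun t : R => nu [set` `]-oo, t]])} ->
    P n [set w | Y n w <= x] @[n --> \oo] --> nu [set` `]-oo, x]].

(* Main.v *)
Require Import Defs.
From HB Require Import structures.
From mathcomp Require Import all_boot all_order all_algebra.
From mathcomp Require Import all_classical all_reals all_analysis.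
From mathcomp Require Import measurable_realfun ring lra.
Set Implicit Arguments.
Unset Strict Implicit.
Unset Printing Implicit Defensive.
Import Order.TTheory GRing.Theory Num.Theory.
Import numFieldNormedType.Exports.
Local Open Scope classical_set_scope.
Local Open Scope ring_scope.

(** Write X = mu + Y with Y centered, and let u be the unit vector proportional
    to (1, ..., 1). Split W along u and its orthogonal complement: the corner
    entry a = <u W, u> is lambda_1^(1), of order p; the off-diagonal part is
    b = u W - a u; the block on the complement only sees the noise, because
    X^T v = Y^T v when v is orthogonal to u. If delta bounds the quadratic form
    of that block, then
      a + |b|^2 / a <= lambda_1(W) <= a + |b|^2 / (a - delta)
    ([lambda_max_lower], [lambda_max_upper]). As |b|^2 is of order p, the two
    sides differ by |b|^2 delta / (a (a - delta)), which is O(1 / sqrt p), the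
    announced precision, as soon as delta = O(sqrt p). This is far weaker than
    the true size O(1) of the noise block, and the Frobenius norm of Y Y^T / n
    is a good enough delta: its square has mean and variance O(p)
    ([gram_energy_variance]).

    The main part of b is mu sqrt p times the vector of the row means of Y
    ([residual_bound]), so |b|^2 / a is close to the sum of the squares of the
    row means, which has mean p sigma^2 / n and standard deviation of order
    sqrt p / n; the rest of b has bounded mean square. Every estimate is
    Chebyshev's inequality for a polynomial in the entries of Y: the events that
    involve x cost O(1 / x^2), the others O(1 / p) ([lambda_max_tail]).

    For the limit law, a = p mu^2 + 2 mu N + V, where N is the sum of the
    entries of Y divided by n and V is the mean of the squares of the column
    sums divided by sqrt p. The variable 2 mu N is exactly normal, with variance
    4 mu^2 sigma^2 p / n, and V tends to sigma^2 in mean square. Together with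
    lambda_1(W) - a - p sigma^2 / n -> 0 in probability this leaves a normal
    variable plus a remainder that tends to 0 in probability.

    Independence of the entries enters through one principle: functions of
    disjoint sets of entries are independent ([depends_on_indep]). The functions
    of a given set of entries with finite moments of all orders form a ring
    ([block]), so expectations of polynomials in disjoint sets of entries
    factor ([mean_indep]). *)

(** * Rayleigh quotients and the largest eigenvalue *)

Lemma continuous_sum_fun {R : realType} {V : topologicalType} (I : Type)
    (s : seq I) (f : I -> V -> R) :
  (forall i, continuous (f i)) -> continuous (fun v => \sum_(i <- s) f i v).
Proof.
move=> cf v; elim: s => [|i s IH].
  by under eq_fun do rewrite big_nil; exact: cst_continuous.
by under eq_fun do rewrite big_cons; apply: continuousD; [exact: cf|exact: IH].
Qed.

Section rayleigh.
Context {R : realType} {p : nat}.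
Implicit Types (A : 'M[R]_p) (u v w : 'rV[R]_p).

Definition bil A u v : R := (u *m A *m v^T) 0 0.
Definition sqn v : R := \sum_i v 0 i ^+ 2.

Lemma bilE A u v : bil A u v = \sum_i \sum_j u 0 i * A i j * v 0 j.
Proof.
rewrite /bil mxE exchange_big/=; apply: eq_bigr => j _.
by rewrite !mxE mulr_suml; apply: eq_bigr => i _.
Qed.

Lemma sqn_bil v : sqn v = bil 1%:M v v.
Proof. by rewrite /bil mulmx1 mxE; apply: eq_bigr => i _; rewrite mxE. Qed.

Lemma bilDl A u v w : bil A (u + v) w = bil A u w + bil A v w.
Proof. by rewrite /bil !mulmxDl mxE. Qed.

Lemma bilDr A u v w : bil A u (v + w) = bil A u v + bil A u w.
Proof. by rewrite /bil linearD/= mulmxDr mxE. Qed.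

Lemma bilZl A k u v : bil A (k *: u) v = k * bil A u v.
Proof. by rewrite /bil -!scalemxAl mxE. Qed.

Lemma bilZr A k u v : bil A u (k *: v) = k * bil A u v.
Proof. by rewrite /bil linearZ/= -scalemxAr mxE. Qed.

Lemma bilB A (B : 'M[R]_p) u v : bil (A - B) u v = bil A u v - bil B u v.
Proof. by rewrite /bil mulmxBr mulmxBl !mxE. Qed.

Lemma bilC A u v : A^T = A -> bil A u v = bil A v u.
Proof.
move=> As; rewrite /bil -[LHS]/(_ 0 0) -[in LHS](trmxK (u *m A *m v^T)) mxE.
by rewrite !trmx_mul trmxK As mulmxA.
Qed.

Lemma sqn_ge0 v : 0 <= sqn v.
Proof. by apply: sumr_ge0 => i _; exact: sqr_ge0. Qed.

Lemma sqn_eq0 v : sqn v = 0 -> v = 0.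
Proof.
move=> /eqP; rewrite psumr_eq0; last by move=> i _; exact: sqr_ge0.
move=> /allP v0; apply/rowP => i; rewrite mxE; apply/eqP.
by rewrite -sqrf_eq0; apply: v0; rewrite mem_index_enum.
Qed.

Lemma sqnZ k v : sqn (k *: v) = k ^+ 2 * sqn v.
Proof. by rewrite !sqn_bil bilZl bilZr mulrA expr2. Qed.

(** The quadratic function of k, form (v - k w) with w = v A, is nonnegative and
    vanishes at k = 0 with derivative - 2 |w|^2 there. *)
Lemma psd_kernel A v : A^T = A -> (forall u, 0 <= bil A u u) ->
  bil A v v = 0 -> v *m A = 0.
Proof.
move=> As Ap v0; apply: sqn_eq0; set w := v *m A.
have wE : sqn w = bil A v w.
  by rewrite /bil mxE; apply: eq_bigr => i _; rewrite [X in _ = _ * X]mxE expr2.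
(* a value of k small enough for the linear term to win over the quadratic one *)
have := Ap (v - (bil A w w + 1)^-1 * sqn w *: w).
set k := _ * sqn w; rewrite -scaleNr !bilDl !bilDr !bilZl !bilZr v0 add0r.
rewrite (bilC w v As) -wE => h.
have q1 : 0 < bil A w w + 1 by rewrite ltr_pwDr.
have kE : k * (bil A w w + 1) = sqn w.
  by rewrite /k mulrAC mulVf ?mul1r// gt_eqF.
have kq : 0 <= k by rewrite mulr_ge0 ?sqn_ge0// invr_ge0 ltW.
have h2 : - k * (k * (bil A w w + 2)) >= 0.
  by apply: le_trans h _; rewrite -kE le_eqVlt; apply/orP; left; apply/eqP; ring.
have q2 : 0 < bil A w w + 2 by rewrite ltr_pwDr.
have k0 : k = 0.
  apply/eqP; rewrite -sqrf_eq0 eq_le sqr_ge0 andbT -(pmulr_lle0 _ q2).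
  by rewrite -oppr_ge0 -mulNr expr2 -mulNr -mulrA.
by rewrite -kE k0 mul0r.
Qed.

Lemma sqn_continuous : continuous (sqn : 'rV[R]_p -> R).
Proof.
apply: continuous_sum_fun => i v.
under eq_fun do rewrite expr2.
have cc : {for v, continuous (fun u : 'rV[R]_p => u 0 i)}.
  exact: coord_continuous.
exact: (continuousM cc cc).
Qed.

Lemma bil_continuous A : continuous (fun v => bil A v v).
Proof.
under eq_fun do rewrite bilE.
apply: continuous_sum_fun => i.
apply: continuous_sum_fun => j v.
have cc k : {for v, continuous (fun u : 'rV[R]_p => u 0 k)}.
  exact: coord_continuous.
have ca : {for v, continuous (fun=> A i j : R)} by exact: cst_continuous.
exact: (continuousM (continuousM (cc i) ca) (cc j)).
Qed.

(** By compactness the form is maximal on the unit sphere at some u; if m is the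
    maximum then m - A is nonnegative with u isotropic, so u is in its kernel. *)
Lemma rayleigh_max A : A^T = A -> (0 < p)%N ->
  exists2 m, eigenvalue A m & forall v, bil A v v <= m * sqn v.
Proof.
move=> As p0; pose S := [set v : 'rV[R]_p | sqn v = 1].
have S0 : S !=set0.
  exists (delta_mx 0 (Ordinal p0)) => /=; rewrite /S/= /sqn.
  rewrite (bigD1 (Ordinal p0))//= big1 ?addr0 ?mxE ?eqxx ?expr1n// => i ip.
  by rewrite mxE (negPf ip) andbF expr0n.
have cS : compact S.
  apply: (@subclosed_compact _ _
    [set v : 'rV[R]_p | forall i, v ord0 i \in `[(-1 : R), 1]]).
  - have -> : S = sqn @^-1` [set 1] by [].
    by apply: closed_comp; [move=> v _; exact: sqn_continuous|exact: closed_eq].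
  - apply: (@rV_compact _ _ (fun=> `[(-1 : R), 1]%classic)) => _.
    exact: segment_compact.
  - move=> v Sv i; rewrite in_itv/= -ler_norml -(@ler_pXn2r _ 2)// ?nnegrE//.
    rewrite real_normK ?num_real// expr1n -Sv /sqn (bigD1 i)//= ord1.
    by rewrite lerDl sumr_ge0// => j _; exact: sqr_ge0.
have [u] := EVT_max_rV S0 cS (continuous_subspaceT (bil_continuous (A := A))).
rewrite inE => Su um; pose m := bil A u u.
have mP v : bil A v v <= m * sqn v.
  have [/sqn_eq0 ->|v0] := eqVneq (sqn v) 0.
    rewrite -[X in bil _ X](scale0r 0) -[X in sqn X](scale0r 0).
    by rewrite bilZl sqnZ expr2 !mul0r mulr0.
  have vp : 0 < sqn v by rewrite lt_neqAle eq_sym v0 sqn_ge0.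
  have := um ((Num.sqrt (sqn v))^-1 *: v).
  rewrite inE /S/= sqnZ exprVn sqr_sqrtr ?sqn_ge0// mulVf// => /(_ erefl).
  rewrite bilZl bilZr mulrA -invfM -expr2 sqr_sqrtr ?sqn_ge0// -/m.
  by rewrite mulrC ler_pdivrMr.
exists m => //; apply/eigenvalueP; exists u; last first.
  apply/eqP => u0; move: Su; rewrite /S/= u0 -(scale0r 0) sqnZ expr2 !mul0r.
  by move/esym/eqP; rewrite oner_eq0.
have scE v w : bil m%:M v w = m * bil 1%:M v w.
  by rewrite /bil mulmx1 mul_mx_scalar -scalemxAl [LHS]mxE.
have /eqP : u *m (m%:M - A) = 0.
  apply: psd_kernel; first by rewrite linearB/= tr_scalar_mx As.
    by move=> v; rewrite bilB scE -sqn_bil subr_ge0.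
  by rewrite bilB scE -sqn_bil Su mulr1 subrr.
by rewrite mulmxBr subr_eq0 mul_mx_scalar => /eqP <-.
Qed.

Lemma eigenvalue_le A theta a : eigenvalue A a ->
  (forall v, bil A v v <= theta * sqn v) -> a <= theta.
Proof.
move=> /eigenvalueP[v vA v0] /(_ v).
rewrite {1}/bil vA -scalemxAl mxE; have -> : (v *m v^T) 0 0 = sqn v.
  by rewrite sqn_bil /bil mulmx1.
rewrite ler_pM2r// lt_neqAle sqn_ge0 andbT eq_sym.
by apply: contra_neq v0; exact: sqn_eq0.
Qed.

Lemma lambda_max_rayleigh A : A^T = A -> (0 < p)%N ->
  forall v, bil A v v <= lambda_max A * sqn v.
Proof.
move=> As p0; have [m mA mP] := rayleigh_max As p0.
by rewrite (lambda_maxE mA)// => b bA; exact: eigenvalue_le bA mP.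
Qed.

Lemma lambda_max_le A theta : A^T = A -> (0 < p)%N ->
  (forall v, bil A v v <= theta * sqn v) -> lambda_max A <= theta.
Proof.
move=> As p0 h; have [m mA mP] := rayleigh_max As p0.
rewrite (lambda_maxE mA); last by move=> b bA; exact: eigenvalue_le bA mP.
exact: eigenvalue_le mA h.
Qed.

(** Countably many test vectors suffice, which makes the largest eigenvalue of a
    random matrix measurable. *)
Lemma lambda_max_le_rat A theta : A^T = A -> (0 < p)%N ->
  (lambda_max A <= theta) <-> forall q : 'rV[rat]_p,
   bil A (map_mx ratr q) (map_mx ratr q) <= theta * sqn (map_mx ratr q).
Proof.
move=> As p0; split=> [le q|H].
  by apply: le_trans (lambda_max_rayleigh As p0 _) _; rewrite ler_wpM2r ?sqn_ge0.
apply: lambda_max_le => // v; rewrite leNgt; apply/negP => lt.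
pose g v := bil A v v - theta * sqn v.
have cg : {for v, continuous g}.
  apply: continuousB; first exact: bil_continuous.
  by apply: continuousM; [exact: cst_continuous|exact: sqn_continuous].
have gv : 0 < g v by rewrite subr_gt0.
have /nbhs_ballP[e /= e0 ve] : nbhs v [set x | 0 < g x].
  exact: (cvgr_gt (g v) cg).
have ratP (i : 'I_p) : exists q : rat, ball (v 0 i) e (ratr q).
  have /rat_in_itvoo[q] : v 0 i - e < v 0 i + e by lra.
  rewrite in_itv/= => /andP[q1 q2]; exists q.
  by rewrite /ball/= ltr_norml; apply/andP; split; lra.
have [q qP] := choice ratP.
have /ve : ball v e (map_mx (@ratr R) (\row_i q i)).
  by split => // i j; rewrite ord1 !mxE.
by rewrite /= /g subr_gt0 ltNge H.
Qed.

End rayleigh.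

(** * Second-order perturbation of the largest eigenvalue *)

Lemma cauchy_schwarz_sum {R : realType} (I : finType) (f g : I -> R) :
  (\sum_i f i * g i) ^+ 2 <= (\sum_i f i ^+ 2) * (\sum_i g i ^+ 2).
Proof.
set F := \sum_i f i ^+ 2; set G := \sum_i g i ^+ 2; set H := \sum_i _.
have sq s t : 0 <= s ^+ 2 * F - 2 * s * t * H + t ^+ 2 * G.
  have : 0 <= \sum_i (s * f i - t * g i) ^+ 2.
    by apply: sumr_ge0 => i _; exact: sqr_ge0.
  rewrite /F /G /H !mulr_sumr -sumrN -!big_split/= => /le_trans; apply.
  by rewrite le_eqVlt; apply/orP; left; apply/eqP; apply: eq_bigr => i _; ring.
have F0 : 0 <= F by apply: sumr_ge0 => i _; exact: sqr_ge0.
have G0 : 0 <= G by apply: sumr_ge0 => i _; exact: sqr_ge0.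
have [FE|Fn0] := eqVneq F 0.
  have := sq (H * (G + 1)) (H ^+ 2); rewrite FE => h.
  have {}h : (G + 2) * (H ^+ 2 * H ^+ 2) <= 0.
    rewrite -oppr_ge0; apply: le_trans h _.
    by rewrite le_eqVlt; apply/orP; left; apply/eqP; ring.
  by rewrite pmulr_rle0 ?ltr_wpDl// -expr2 in h; rewrite mul0r; move: h;
    rewrite real_exprn_even_le0 ?num_real//= => /eqP ->.
have Fp : 0 < F by rewrite lt_neqAle eq_sym Fn0.
have := sq H F; rewrite -(pmulr_rge0 _ Fp) => h.
rewrite -subr_ge0 -(pmulr_rge0 _ Fp) -(pmulr_rge0 _ Fp).
by apply: le_trans h _; rewrite le_eqVlt; apply/orP; left; apply/eqP; ring.
Qed.

Lemma sqr_sum_le {R : realType} (I : finType) (f : I -> R) :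
  (\sum_i f i) ^+ 2 <= #|I|%:R * \sum_i f i ^+ 2.
Proof.
have -> : #|I|%:R = \sum_(i : I) (1 : R) ^+ 2.
  by under eq_bigr do rewrite expr1n; rewrite sumr_const.
apply: le_trans (cauchy_schwarz_sum (fun=> 1) f).
by under [in leRHS]eq_bigr do rewrite mul1r.
Qed.

Section perturbation.
Context {R : realType} {p : nat} (A : 'M[R]_p) (u : 'rV[R]_p).
Hypothesis p_gt0 : (0 < p)%N.
Hypothesis A_sym : A^T = A.
Hypothesis u1 : sqn u = 1.

Let a := bil A u u.
Let b := u *m A - a *: u.

Let bil_uA v : bil A u v = bil 1%:M (u *m A) v.
Proof. by rewrite /bil mulmx1. Qed.

Let bil_uu : bil 1%:M u u = 1.
Proof. by rewrite -sqn_bil. Qed.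

Lemma sqn_residual : sqn b = sqn (u *m A) - a ^+ 2.
Proof.
rewrite !sqn_bil /b -scaleNr !bilDl !bilDr !bilZl !bilZr bil_uu.
by rewrite (bilC u (u *m A)) ?tr_scalar_mx// -(bil_uA u) -/a; ring.
Qed.

(** Along v = s u + y with y orthogonal to u, the cross term 2 s <b, y> is at most
    s^2 |b|^2 / (a - delta) + (a - delta) |y|^2: the difference is the square of
    the length of s b - (a - delta) y, up to a positive factor. *)
Lemma lambda_max_upper delta :
  (forall y, bil 1%:M u y = 0 -> bil A y y <= delta * sqn y) -> delta < a ->
  lambda_max A <= a + sqn b / (a - delta).
Proof.
move=> Hd da; apply: lambda_max_le => // v.
have k0 : 0 < a - delta by rewrite subr_gt0.
set k := a - delta in k0 *; set s := bil 1%:M u v; pose y := v - s *: u.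
have uy : bil 1%:M u y = 0 by rewrite bilDr -scaleNr bilZr bil_uu mulr1 subrr.
have -> : v = s *: u + y by rewrite addrC subrK.
clearbody y.
set c := bil 1%:M b y.
have AE : bil A (s *: u + y) (s *: u + y) = s ^+ 2 * a + 2 * s * c + bil A y y.
  have cE : bil A u y = c.
    by rewrite /c /b -scaleNr bilDl bilZl uy mulr0 addr0 bil_uA.
  rewrite !bilDl !bilDr !bilZl !bilZr (bilC y u A_sym) cE -/a; ring.
have sE : sqn (s *: u + y) = s ^+ 2 + sqn y.
  rewrite !sqn_bil !bilDl !bilDr !bilZl !bilZr bil_uu (bilC y) ?tr_scalar_mx//.
  by rewrite uy; ring.
have h := sqn_ge0 (s *: b - k *: y).
rewrite sqn_bil -scaleNr !bilDl !bilDr !bilZl !bilZr -!sqn_bil in h.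
rewrite (bilC y b) ?tr_scalar_mx// -/c in h.
have {}h : 0 <= s ^+ 2 * (sqn b / k) - 2 * s * c + k * sqn y.
  rewrite -(pmulr_rge0 _ k0); apply: le_trans h _.
  by rewrite le_eqVlt; apply/orP; left; apply/eqP; field; rewrite gt_eqF.
have dy := Hd _ uy; rewrite AE sE.
have aE : a = k + delta by rewrite subrK.
have bY : 0 <= sqn b / k * sqn y by rewrite mulr_ge0 ?divr_ge0 ?sqn_ge0// ltW.
clearbody k; rewrite aE; lra.
Qed.

(** For A nonnegative with largest eigenvalue l one has |u A|^2 <= l <u A, u>;
    expand the form at u A - l u. *)
Lemma lambda_max_lower : (forall v, 0 <= bil A v v) -> 0 < a ->
  a + sqn b / a <= lambda_max A.
Proof.
move=> Apos a0; set l := lambda_max A.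
have al : a <= l by have := lambda_max_rayleigh A_sym p_gt0 u; rewrite u1 mulr1.
have l0 : 0 < l by exact: lt_le_trans al.
set w := u *m A.
have Aw := lambda_max_rayleigh A_sym p_gt0 w.
have h := Apos (w - l *: u).
rewrite -scaleNr !bilDl !bilDr !bilZl !bilZr (bilC w u A_sym) bil_uA in h.
rewrite -/w -sqn_bil -/a in h.
have h2 : 0 <= l * (l * a - sqn w).
  by apply: le_trans h _; rewrite -/l in Aw; nra.
rewrite pmulr_rge0// subr_ge0 in h2.
rewrite sqn_residual -/w -(ler_pM2r a0) mulrDl divfK ?gt_eqF//.
by apply: le_trans h2; rewrite le_eqVlt; apply/orP; left; apply/eqP; ring.
Qed.

End perturbation.

(** * The sample covariance matrix of a signal plus noise *)

Section noise.
Context {R : realType} {p n : nat}.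
Implicit Types (y : 'I_p -> 'I_n -> R).

Definition row_tot y i : R := \sum_j y i j.
Definition col_tot y j : R := \sum_i y i j.
Definition grand_tot y : R := \sum_i \sum_j y i j.
Definition gram y i k : R := \sum_j y i j * y k j.
Definition cross y i : R := \sum_j y i j * col_tot y j.

(** The normalizations make row_energy, col_energy, cross_energy and mean_shift
    bounded in mean square, and gram_energy of order p, when p and n are comparable: row_energy
    is the sum of the squares of the row means, gram_energy the squared Frobenius
    norm of Y Y^T / n. *)
Definition row_energy y : R := n%:R^-2 * \sum_i row_tot y i ^+ 2.
Definition col_energy y : R := (n%:R * p%:R)^-1 * \sum_j col_tot y j ^+ 2.
Definition mean_shift y : R := n%:R^-1 * grand_tot y.
Definition cross_energy y : R := p%:R^-1 * (n%:R^-2 * \sum_i cross y i ^+ 2).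
Definition gram_energy y : R := n%:R^-2 * \sum_i \sum_k gram y i k ^+ 2.

End noise.

Section signal_plus_noise.
Context {R : realType} {p n : nat} (mu : R) (y : 'I_p -> 'I_n -> R).
Hypotheses (p_gt0 : (0 < p)%N) (n_gt0 : (0 < n)%N).

Let X : 'M[R]_(p, n) := \matrix_(i, j) (mu + y i j).
Let W := cov_mx X.
Let u : 'rV[R]_p := (Num.sqrt p%:R)^-1 *: const_mx 1.

Let pR : 0 < p%:R :> R. Proof. by rewrite ltr0n. Qed.
Let nR : 0 < n%:R :> R. Proof. by rewrite ltr0n. Qed.
Let sp2 : (Num.sqrt p%:R) ^+ 2 = p%:R :> R.
Proof. by rewrite sqr_sqrtr ?ler0n. Qed.
Let sp0 : Num.sqrt p%:R != 0 :> R.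
Proof. by rewrite gt_eqF// sqrtr_gt0. Qed.

Lemma cov_mx_sym m (Z : 'M[R]_(p, m)) : (cov_mx Z)^T = cov_mx Z.
Proof. by rewrite /cov_mx linearZ/= trmx_mul trmxK. Qed.

Lemma bil_cov_mx m (Z : 'M[R]_(p, m)) v :
  bil (cov_mx Z) v v = m%:R^-1 * sqn (v *m Z).
Proof.
rewrite /bil /cov_mx -scalemxAr -scalemxAl mxE; congr (_ * _).
by rewrite sqn_bil /bil mulmx1 trmx_mul !mulmxA.
Qed.

Lemma bil_cov_mx_ge0 m (Z : 'M[R]_(p, m)) v : 0 <= bil (cov_mx Z) v v.
Proof. by rewrite bil_cov_mx mulr_ge0 ?sqn_ge0// invr_ge0 ler0n. Qed.

Lemma lambda11E (V : 'M[R]_p) : bil V u u = lambda11 V.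
Proof.
rewrite /u bilZl bilZr mulrA -invfM -expr2 sp2 /lambda11 bilE; congr (_ * _).
by do 2!apply: eq_bigr => ? _; rewrite !mxE mul1r mulr1.
Qed.

Let sqn_u : sqn u = 1.
Proof.
rewrite /u sqnZ exprVn sp2 /sqn (eq_bigr (fun=> 1)).
  by rewrite sumr_const card_ord mulVf ?gt_eqF.
by move=> i _; rewrite mxE expr1n.
Qed.

Let col_sum_X j : \sum_i X i j = p%:R * mu + col_tot y j.
Proof.
rewrite /col_tot; under eq_bigr do rewrite mxE.
by rewrite big_split/= sumr_const card_ord mulr_natl.
Qed.

Lemma sum_col_tot : \sum_j col_tot y j = grand_tot y.
Proof. by rewrite /grand_tot exchange_big. Qed.

Lemma lambda11_decomp : lambda11 W =
  p%:R * mu ^+ 2 + 2 * mu * mean_shift y + col_energy y.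
Proof.
rewrite -lambda11E bil_cov_mx /u -scalemxAl sqnZ exprVn sp2.
have -> : sqn (const_mx 1 *m X) =
    \sum_j (p%:R * mu + col_tot y j) ^+ 2.
  apply: eq_bigr => j _; rewrite mxE -col_sum_X; congr (_ ^+ 2).
  by apply: eq_bigr => i _; rewrite mxE mul1r.
under eq_bigr do rewrite sqrrD -mulr_natl.
rewrite !big_split/= sumr_const card_ord -!mulr_sumr sum_col_tot -mulr_natl.
rewrite /mean_shift /col_energy.
field.
by rewrite !gt_eqF.
Qed.

(** On vectors orthogonal to u the mean of the data is invisible, and what remains
    is bounded by the Frobenius norm. *)
Lemma noise_bound v : bil 1%:M u v = 0 ->
  bil W v v <= Num.sqrt (gram_energy y) * sqn v.
Proof.
move=> uv; have v0 : \sum_i v 0 i = 0.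
  move/eqP: uv; rewrite /u bilZl mulf_eq0 invr_eq0 (negPf sp0)/= => /eqP.
  rewrite /bil mulmx1 mxE => vs; rewrite -[RHS]vs.
  by apply: eq_bigr => i _; rewrite !mxE mul1r.
have vX j : (v *m X) 0 j = \sum_i v 0 i * y i j.
  rewrite mxE; under eq_bigr do rewrite mxE mulrDr.
  by rewrite big_split/= -mulr_suml v0 mul0r add0r.
have sE : sqn (v *m X) =
    \sum_(ik : 'I_p * 'I_p) (v 0 ik.1 * v 0 ik.2) * gram y ik.1 ik.2.
  rewrite -(pair_bigA _ (fun i k => v 0 i * v 0 k * gram y i k))/=.
  transitivity (\sum_i \sum_k \sum_j v 0 i * v 0 k * (y i j * y k j)).
    rewrite /sqn; under eq_bigr do rewrite vX expr2 mulr_suml.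
    rewrite exchange_big/=; apply: eq_bigr => i _.
    under eq_bigr do rewrite mulr_sumr.
    by rewrite exchange_big/=; do 2!apply: eq_bigr => ? _; ring.
  by do 2!apply: eq_bigr => ? _; rewrite mulr_sumr.
rewrite bil_cov_mx.
have n2 : 0 <= (n%:R^-2 : R) by rewrite invr_ge0 exprn_ge0// ler0n.
have ge_0 : 0 <= gram_energy y.
  by rewrite mulr_ge0// sumr_ge0// => i _; rewrite sumr_ge0// => k _; rewrite sqr_ge0.
rewrite -(@ler_pXn2r _ 2)// ?nnegrE; last 2 first.
  by rewrite mulr_ge0 ?sqn_ge0// invr_ge0 ltW.
  by rewrite mulr_ge0 ?sqrtr_ge0 ?sqn_ge0.
rewrite !exprMn sqr_sqrtr// exprVn /gram_energy -mulrA ler_pM2l; last first.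
  by rewrite invr_gt0 exprn_gt0.
rewrite sE mulrC; apply: le_trans (cauchy_schwarz_sum _ _) _.
rewrite -(pair_bigA _ (fun i k => (v 0 i * v 0 k) ^+ 2))/=.
rewrite -(pair_bigA _ (fun i k => gram y i k ^+ 2))/=.
rewrite ler_wpM2r//; first by do 2!(rewrite sumr_ge0// => ? _); rewrite sqr_ge0.
rewrite expr2 {1}/sqn mulr_suml ler_sum// => i _; rewrite /sqn mulr_sumr ler_sum//.
by move=> k _; rewrite exprMn.
Qed.

Let b := u *m W - bil W u u *: u.

(** Up to a multiple of u, the vector u W is mu sqrt p times the row means plus
    the vector e with |e|^2 = cross_energy; removing the component along u costs
    the mean of the row means and the mean of e. *)
Lemma residual_bound :
  `|sqn b - p%:R * mu ^+ 2 * row_energy y| <=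
   2 * Num.sqrt (p%:R * mu ^+ 2 * row_energy y * cross_energy y)
   + 3 * cross_energy y + 2 * mu ^+ 2 * mean_shift y ^+ 2.
Proof.
pose f i := Num.sqrt p%:R * mu * (n%:R^-1 * row_tot y i).
pose e i := (Num.sqrt p%:R)^-1 * (n%:R^-1 * cross y i).
pose h i := f i + e i.
have uW i : (u *m W) 0 i = (Num.sqrt p%:R)^-1 *
    (p%:R * mu ^+ 2 + mu * mean_shift y) + h i.
  rewrite /u -scalemxAl mxE /W /cov_mx -scalemxAr mxE mulmxA mxE.
  have -> : \sum_j ((const_mx 1 : 'rV_p) *m X) 0 j * X^T j i =
     \sum_j (p%:R * mu + col_tot y j) * (mu + y i j).
    apply: eq_bigr => j _; rewrite [_^T _ _]mxE [X in _ * X]mxE; congr (_ * _).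
    by rewrite mxE -col_sum_X; apply: eq_bigr => k _; rewrite mxE mul1r.
  under eq_bigr do rewrite mulrDl !mulrDr.
  rewrite !big_split/= !sumr_const card_ord -!mulr_suml -!mulr_sumr.
  rewrite sum_col_tot -/(row_tot y i).
  have -> : \sum_j col_tot y j * y i j = cross y i.
    by apply: eq_bigr => j _; rewrite mulrC.
  rewrite /h /f /e /mean_shift -[(_ * _) *+ n]mulr_natl.
  move: sp0 sp2; set s := Num.sqrt _; clearbody s => s0 <-.
  by field; rewrite s0 gt_eqF.
pose hb := p%:R^-1 * \sum_i h i.
have bE i : b 0 i = h i - hb.
  have aE : bil W u u = (Num.sqrt p%:R)^-1 * \sum_k (u *m W) 0 k.
    rewrite /bil mxE mulr_sumr; apply: eq_bigr => k _.
    by rewrite mulrC !mxE mulr1.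
  rewrite /b mxE [X in _ + X]mxE [X in _ - X]mxE uW aE.
  under [in LHS]eq_bigr do rewrite uW.
  rewrite big_split/= sumr_const card_ord !mxE mulr1 /hb.
  rewrite -[(_ * _) *+ p]mulr_natr.
  move: sp0 sp2 pR; set s := Num.sqrt _; clearbody s => s0 sE p0.
  by rewrite -sE; field.
have sbE : sqn b = \sum_i h i ^+ 2 - p%:R * hb ^+ 2.
  rewrite /sqn; under eq_bigr do rewrite bE sqrrB -mulr_natl.
  rewrite !big_split/= sumrN sumr_const card_ord -mulr_sumr -mulr_suml.
  have -> : \sum_i h i = p%:R * hb by rewrite /hb mulVKf// gt_eqF.
  by rewrite -[(_ ^+ 2) *+ p]mulr_natr; ring.
have fE : \sum_i f i ^+ 2 = p%:R * mu ^+ 2 * row_energy y.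
  rewrite /f; under eq_bigr do rewrite !exprMn sp2.
  by rewrite -!mulr_sumr exprVn.
have eE : \sum_i e i ^+ 2 = cross_energy y.
  rewrite /e; under eq_bigr do rewrite !exprMn !exprVn sp2.
  by rewrite -!mulr_sumr.
have hE : \sum_i h i ^+ 2 =
    \sum_i f i ^+ 2 + 2 * \sum_i f i * e i + \sum_i e i ^+ 2.
  rewrite mulr_sumr -!big_split/=; apply: eq_bigr => i _; rewrite /h; ring.
have fbE : p%:R * (p%:R^-1 * \sum_i f i) ^+ 2 = mu ^+ 2 * mean_shift y ^+ 2.
  rewrite /f -!mulr_sumr.
  have -> : n%:R^-1 * (\sum_i row_tot y i) = mean_shift y by [].
  by rewrite !exprMn sp2; field; rewrite !gt_eqF.
have ebE : p%:R * (p%:R^-1 * \sum_i e i) ^+ 2 <= cross_energy y.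
  have -> : p%:R * (p%:R^-1 * \sum_i e i) ^+ 2 = p%:R^-1 * (\sum_i e i) ^+ 2.
    by field; rewrite gt_eqF.
  rewrite mulrC ler_pdivrMr// mulrC -eE.
  by have := sqr_sum_le e; rewrite card_ord.
have hb2 : p%:R * hb ^+ 2 <= 2 * (p%:R * (p%:R^-1 * \sum_i f i) ^+ 2) +
                             2 * (p%:R * (p%:R^-1 * \sum_i e i) ^+ 2).
  rewrite /hb /h big_split/= mulrDr.
  move: (p%:R^-1 * _) (p%:R^-1 * _) => F E.
  have := mulr_ge0 (ltW pR) (sqr_ge0 (F - E)); lra.
have fe : `|\sum_i f i * e i| <=
   Num.sqrt (p%:R * mu ^+ 2 * row_energy y * cross_energy y).
  rewrite -sqrtr_sqr; apply: ler_wsqrtr; rewrite -fE -eE.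
  exact: cauchy_schwarz_sum.
have hb0 : 0 <= p%:R * hb ^+ 2 by rewrite mulr_ge0 ?sqr_ge0// ltW.
have e0 : 0 <= cross_energy y.
  by rewrite -eE; apply: sumr_ge0 => i _; exact: sqr_ge0.
have m0 : 0 <= mu ^+ 2 * mean_shift y ^+ 2 by rewrite mulr_ge0 ?sqr_ge0.
rewrite sbE hE fE eE; move: fe; rewrite !ler_norml => /andP[fe1 fe2].
rewrite fbE in hb2; apply/andP; split; lra.
Qed.

Lemma lambda_max_cov_lower : 0 < lambda11 W ->
  lambda11 W + sqn b / lambda11 W <= lambda_max W.
Proof.
rewrite -lambda11E; apply: lambda_max_lower => //; first exact: cov_mx_sym.
exact: bil_cov_mx_ge0.
Qed.

Lemma lambda_max_cov_upper : Num.sqrt (gram_energy y) < lambda11 W ->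
  lambda_max W <= lambda11 W + sqn b / (lambda11 W - Num.sqrt (gram_energy y)).
Proof.
rewrite -lambda11E; apply: lambda_max_upper => //; first exact: cov_mx_sym.
exact: noise_bound.
Qed.

End signal_plus_noise.

(** * Functions of disjoint sets of independent variables *)

Section sub_sigma_algebras.
Context {d : measure_display} {T : measurableType d} {R : realType}
  (P : probability T R) {I : finType} (Y : I -> {RV P >-> R}).
Implicit Types (A B J : {set I}) (F G : T -> R).

Definition cylinders A : set (set T) :=
  [set E | exists2 C : I -> set R, (forall i, measurable (C i)) &
     E = \bigcap_(i in [set` A]) Y i @^-1` C i].

(** Measurability for the sigma-algebra generated by the variables of index in A,
    presented by the cylinders because these are stable under intersection. *)
Definition depends_on A F : Prop :=
  measurable_fun setT (F : g_sigma_algebraType (cylinders A) -> R).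

Lemma cylinders_measurable A : cylinders A `<=` measurable.
Proof.
move=> _ [C mC ->]; apply: fin_bigcap_measurable => // i _.
by rewrite -[X in measurable X]setTI; exact: measurable_funPT.
Qed.

Lemma cylinders_setI A : setI_closed (cylinders A).
Proof.
move=> _ _ [C mC ->] [C' mC' ->]; exists (fun i => C i `&` C' i).
  by move=> i; exact: measurableI.
by rewrite -bigcapI; apply: eq_bigcapr => i _; rewrite preimage_setI.
Qed.

Lemma cylindersT A : cylinders A setT.
Proof.
exists (fun=> setT) => //.
by apply/esym; rewrite -subTset => w _ i _.
Qed.

Lemma cylinders_sub A B : A \subset B -> cylinders A `<=` cylinders B.
Proof.
move=> AB _ [C mC ->]; exists (fun i => if i \in A then C i else setT).
  by move=> i; case: ifP.
apply/seteqP; split=> w h i /= iAB.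
  by case: ifP => // iA; exact: h.
by have := h i (fintype.subsetP AB _ iAB); rewrite /= iAB.
Qed.

Lemma depends_on_sub A B F : A \subset B -> depends_on A F -> depends_on B F.
Proof.
move=> AB mF _ C mC; have := mF measurableT C mC.
apply: smallest_sub; first exact: smallest_sigma_algebra.
by apply: subset_trans (cylinders_sub AB) _; exact: sub_gen_smallest.
Qed.

Lemma depends_on_measurable A F : depends_on A F -> measurable_fun setT F.
Proof.
move=> mF _ C mC; have := mF measurableT C mC.
apply: smallest_sub; first exact: sigma_algebra_measurable.
exact: cylinders_measurable.
Qed.

Lemma depends_on_var A i : i \in A -> depends_on A (Y i).
Proof.
move=> iA _ C mC; rewrite setTI; apply: sub_gen_smallest.
exists (fun j => if j == i then C else setT).
  by move=> j; case: ifP.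
apply/seteqP; split=> w /=; first by move=> h j _; case: eqP => [->|].
by move=> /(_ i iA); rewrite /= eqxx.
Qed.

Hypothesis indY : mutually_independent Y.

Lemma cylinders_indep A B E H : [disjoint A & B]%B -> cylinders A E ->
  cylinders B H -> (P (E `&` H) = P E * P H)%E.
Proof.
move=> dAB [C mC ->] [D mD ->].
rewrite (indY A mC) (indY B mD).
pose CD i := if i \in A then C i else D i.
have mCD i : measurable (CD i) by rewrite /CD; case: ifP.
have BA i : i \in B -> (i \in A) = false.
  by move=> iB; apply/negbTE; move: dAB; rewrite disjoint_sym => /disjointFr->.
have := indY (A :|: B) mCD.
rewrite (eq_bigl [predU A & B]); last by move=> i; rewrite !inE.
rewrite bigU//= => e.
rewrite (eq_bigr (fun i => P (Y i @^-1` CD i))); last by move=> i iA; rewrite /CD iA.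
rewrite [X in _ = (_ * X)%E](eq_bigr (fun i => P (Y i @^-1` CD i))); last first.
  by move=> i iB; rewrite /CD (BA _ iB).
rewrite -e; congr (P _); apply/seteqP; split=> w /=.
  move=> [h1 h2] i /=; rewrite finset.in_setU => /orP[iA|iB].
    by rewrite /CD iA; exact: h1.
  by rewrite /CD (BA _ iB); exact: h2.
move=> h; split=> i /= iX.
  by have := h i; rewrite /= /CD finset.in_setU iX => /(_ isT).
by have := h i; rewrite /= /CD finset.in_setU iX orbT (BA _ iX) => /(_ isT).
Qed.

(** Independence from a fixed event H passes from the cylinders to the generated
    sigma-algebra, as two finite measures that agree on a pi-system agree. *)
Let indep_ext A (H : set T) : measurable H ->
  (forall E, cylinders A E -> P (E `&` H) = (P E * P H)%E) ->
  forall E, <<s cylinders A >> E -> P (E `&` H) = (P E * P H)%E.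
Proof.
move=> mH h E sE.
have fH : P H \is a fin_num by exact: fin_num_measure.
have gH : 0 <= fine (P H) by exact: fine_ge0.
have scE (S : set T) : mscale (NngNum gH) P S = (P S * P H)%E.
  by rewrite /mscale/= -[in RHS](fineK fH) muleC.
have <- : mrestr P mH E = P (E `&` H) by [].
rewrite -scE; apply: (@g_sigma_algebra_measure_unique _ R T (cylinders A)
  (@cylinders_measurable A) (fun=> setT) (fun=> cylindersT A)) => //.
- by rewrite bigcup_const//; exists 0%N.
- exact: cylinders_setI.
- by move=> S cS; exact: etrans (h S cS) (esym (scE S)).
- move=> _; change (P (setT `&` H) < +oo)%E.
  by rewrite setTI -ge0_fin_numE.
Qed.

(** Two extensions from cylinders to sigma-algebras, one for each factor. *)
Lemma depends_on_indep A B F G : [disjoint A & B]%B -> depends_on A F ->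
  depends_on B G -> forall C D, measurable C -> measurable D ->
  P (F @^-1` C `&` G @^-1` D) = (P (F @^-1` C) * P (G @^-1` D))%E.
Proof.
move=> dAB mF mG C D mC mD.
have sF : <<s cylinders A >> (F @^-1` C).
  by have := mF measurableT C mC; rewrite setTI.
have sG : <<s cylinders B >> (G @^-1` D).
  by have := mG measurableT D mD; rewrite setTI.
have mFC : measurable (F @^-1` C).
  by rewrite -[X in measurable X]setTI; exact: (depends_on_measurable mF).
apply: (indep_ext _ _ sF).
  by rewrite -[X in measurable X]setTI; exact: (depends_on_measurable mG).
move=> E cE; rewrite setIC muleC; apply: (indep_ext _ _ sG).
  exact: cylinders_measurable cE.
by move=> H cH; rewrite setIC muleC; exact: cylinders_indep dAB cE cH.
Qed.

End sub_sigma_algebras.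

(** * Joint law and expectation of a product *)

Section product_law.
Context {d : measure_display} {T : measurableType d} {R : realType}
  (P : probability T R).

Definition indep_pair (F G : T -> R) : Prop :=
  forall C D : set R, measurable C -> measurable D ->
  P (F @^-1` C `&` G @^-1` D) = (P (F @^-1` C) * P (G @^-1` D))%E.

Variables F G : {RV P >-> R}.
Hypothesis indFG : indep_pair F G.

Let FG w : R * R := (F w, G w).

Let mFG : measurable_fun setT FG.
Proof. by apply: measurable_fun_pair; exact: measurable_funPT. Qed.

HB.instance Definition _ := isMeasurableFun.Build _ _ _ _ FG mFG.

Lemma joint_law (S : set (R * R)) : measurable S ->
  (distribution P F \x distribution P G)%E S = pushforward P FG S.
Proof.
by move=> mS; apply: product_measure_unique.
Qed.

Lemma ge0_integral_joint (f : measurableTypeR R * measurableTypeR R -> \bar R) :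
  measurable_fun setT f ->
  (forall z, 0 <= f z)%E ->
  (\int[P]_w f (F w, G w) =
   \int[distribution P F \x distribution P G]_z f z)%E.
Proof.
move=> mf f0; rewrite (eq_measure_integral (pushforward P FG)); last first.
  by move=> S mS _; exact: joint_law.
by rewrite ge0_integral_pushforward.
Qed.

Lemma integral_joint (f : measurableTypeR R * measurableTypeR R -> \bar R) :
  measurable_fun setT f ->
  P.-integrable setT (fun w => f (F w, G w)) ->
  (\int[P]_w f (F w, G w) =
   \int[distribution P F]_x \int[distribution P G]_y f (x, y))%E.
Proof.
move=> mf intf.
transitivity (\int[distribution P F \x distribution P G]_z f z)%E.
  rewrite (eq_measure_integral (pushforward P FG)); last first.
    by move=> S mS _; exact: joint_law.
  by rewrite integral_pushforward.
rewrite -integral12_prod_meas1//; apply/integrableP; split => //.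
move/integrableP: intf => [_]; apply: le_lt_trans.
rewrite (eq_measure_integral (pushforward P FG)); last first.
  by move=> S mS _; exact: joint_law.
by rewrite ge0_integral_pushforward//; exact: measurableT_comp.
Qed.

Lemma indep_expectationM : P.-integrable setT (EFin \o F) ->
  P.-integrable setT (EFin \o G) ->
  P.-integrable setT (EFin \o (fun w => F w * G w)) ->
  \int[P]_w (F w * G w) = (\int[P]_w F w) * (\int[P]_w G w).
Proof.
move=> iF iG iFG; rewrite /Rintegral.
have miR : measurable_fun setT (fun x : R => x%:E) by exact: EFin_measurable.
have idG : (distribution P G).-integrable setT (fun x : R => x%:E).
  exact: integrable_pushforward.
have idF : (distribution P F).-integrable setT (fun x : R => x%:E).
  exact: integrable_pushforward.
have EG : (\int[distribution P G]_y y%:E = \int[P]_w (G w)%:E)%E.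
  by rewrite integral_distribution.
have EF : (\int[distribution P F]_y y%:E = \int[P]_w (F w)%:E)%E.
  by rewrite integral_distribution.
have fG : (\int[P]_w (G w)%:E)%E \is a fin_num by exact: integrable_fin_num.
have fF : (\int[P]_w (F w)%:E)%E \is a fin_num by exact: integrable_fin_num.
rewrite -fineM//; congr fine.
rewrite (@integral_joint (fun z => (z.1 * z.2)%:E))//=; last first.
  by apply/measurable_EFinP; exact: measurable_funM.
under eq_integral.
  move=> x _; under eq_integral do rewrite EFinM.
  rewrite integralZl// EG -(fineK fG).
  over.
by rewrite integralZr// EF fineK.
Qed.

End product_law.

Section moments.
Context {d : measure_display} {T : measurableType d} {R : realType}
  (P : probability T R).
Implicit Types (F G : T -> R).

(** All powers integrable: unlike integrability of a fixed power, this is stable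
    under products, so polynomials in such variables need no further
    integrability check. *)
Definition moments F : Prop := measurable_fun setT F /\
  forall k, P.-integrable setT (fun w => (F w ^+ k)%:E).

Lemma moments_measurable F : moments F -> measurable_fun setT F.
Proof. by case. Qed.

Lemma moments_integrable F : moments F -> P.-integrable setT (EFin \o F).
Proof. by move=> [_ /(_ 1)]. Qed.

Lemma moments_cst (c : R) : moments (fun=> c).
Proof.
split=> // k; exact: (finite_measure_integrable_cst P (c ^+ k) measurableT).
Qed.

Lemma momentsM F G : moments F -> moments G -> moments (fun w => F w * G w).
Proof.
move=> [mF iF] [mG iG]; split=> [|k]; first exact: measurable_funM.
apply: (@le_integrable _ _ _ P _ measurableT _
    (fun w => ((F w ^+ (k * 2))%:E + (G w ^+ (k * 2))%:E)%E)).
- apply/measurable_EFinP/measurable_funX; exact: measurable_funM.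
- move=> w _; rewrite -EFinD/= lee_fin exprMn !exprM.
  rewrite [leRHS]ger0_norm ?addr_ge0 ?sqr_ge0// normrM.
  rewrite -(real_normK (num_real (F w ^+ k))) -(real_normK (num_real (G w ^+ k))).
  have := sqr_ge0 (`|F w ^+ k| - `|G w ^+ k|).
  have := normr_ge0 (F w ^+ k); have := normr_ge0 (G w ^+ k); nra.
- by apply: integrableD.
Qed.

Lemma momentsX F k : moments F -> moments (fun w => F w ^+ k).
Proof.
move=> [mF iF]; split=> [|l]; first exact: measurable_funX.
by under eq_fun do rewrite -exprM; exact: iF.
Qed.

Lemma momentsD F G : moments F -> moments G -> moments (fun w => F w + G w).
Proof.
move=> [mF iF] [mG iG]; split=> [|k]; first exact: measurable_funD.
apply: (@le_integrable _ _ _ P _ measurableT _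
  (fun w => ((2 ^+ k)%:E * (`|F w ^+ k|%:E + `|G w ^+ k|%:E))%E)).
- by apply/measurable_EFinP/measurable_funX; exact: measurable_funD.
- move=> w _; rewrite -EFinD -EFinM/= lee_fin.
  rewrite [leRHS]ger0_norm ?mulr_ge0 ?addr_ge0// !normrX.
  apply: (@le_trans _ _ ((2 * Num.max `|F w| `|G w|) ^+ k)).
    rewrite lerXn2r ?nnegrE ?mulr_ge0 ?le_max ?normr_ge0//.
    apply: le_trans (ler_normD _ _) _.
    by rewrite mulr2n mulrDl mul1r lerD// le_max lexx ?orbT.
  rewrite exprMn ler_pM2l ?exprn_gt0//.
  by have [_|_] := leP `|F w| `|G w|; [rewrite lerDr|rewrite lerDl]; apply: exprn_ge0.
- apply: integrableZl => //; apply: integrableD => //.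
    exact: (integrable_norm (iF k)).
  exact: (integrable_norm (iG k)).
Qed.

Lemma moments_sum (J : Type) (s : seq J) (F : J -> T -> R) :
  (forall j, moments (F j)) -> moments (fun w => \sum_(j <- s) F j w).
Proof.
move=> mF; elim: s => [|j s IH].
  by under eq_fun do rewrite big_nil; exact: moments_cst.
by under eq_fun do rewrite big_cons; exact: momentsD.
Qed.

End moments.

(** * Expectations and moments of sums of independent blocks *)

Section mean.
Context {d : measure_display} {T : measurableType d} {R : realType}
  (P : probability T R).
Implicit Types (F G : T -> R).

Definition mean F : R := \int[P]_w F w.

Lemma eq_mean F G : F =1 G -> mean F = mean G.
Proof. by move=> /funext ->. Qed.

Lemma mean_cst c : mean (fun=> c) = c.
Proof.
rewrite /mean /Rintegral integral_cst//= -[X in fine (_ * X)%E]/(P setT).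
by rewrite probability_setT mule1.
Qed.

Lemma meanD F G : moments P F -> moments P G ->
  mean (fun w => F w + G w) = mean F + mean G.
Proof. by move=> mF mG; apply: RintegralD => //; exact: moments_integrable. Qed.

Lemma meanZ c F : moments P F -> mean (fun w => c * F w) = c * mean F.
Proof. by move=> mF; apply: RintegralZl => //; exact: moments_integrable. Qed.

Lemma mean_sum (J : Type) (s : seq J) (F : J -> T -> R) :
  (forall j, moments P (F j)) ->
  mean (fun w => \sum_(j <- s) F j w) = \sum_(j <- s) mean (F j).
Proof.
move=> mF; elim: s => [|j s IH].
  by rewrite big_nil -[RHS](mean_cst 0); apply: eq_mean => w; rewrite big_nil.
rewrite big_cons -IH -meanD//; last exact: moments_sum.
by apply: eq_mean => w; rewrite big_cons.
Qed.

Lemma mean_ge0 F : (forall w, 0 <= F w) -> 0 <= mean F.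
Proof. by move=> F0; exact: Rintegral_ge0. Qed.

Lemma le_mean F G : moments P F -> moments P G -> (forall w, F w <= G w) ->
  mean F <= mean G.
Proof.
by move=> mF mG FG; apply: le_Rintegral => //; exact: moments_integrable.
Qed.

Lemma momentsZ c F : moments P F -> moments P (fun w => c * F w).
Proof. by move=> mF; apply: momentsM => //; exact: moments_cst. Qed.

Lemma momentsB F G : moments P F -> moments P G ->
  moments P (fun w => F w - G w).
Proof.
move=> mF mG; under eq_fun do rewrite -mulN1r.
by apply: momentsD => //; exact: momentsZ.
Qed.

Lemma sqr_mean_le F : moments P F -> mean F ^+ 2 <= mean (fun w => F w ^+ 2).
Proof.
move=> mF; set m := mean F.
have : 0 <= mean (fun w => (F w - m) ^+ 2) by apply: mean_ge0 => w; exact: sqr_ge0.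
rewrite (@eq_mean _ (fun w => F w ^+ 2 + (- (2 * m) * F w + m ^+ 2))); last first.
  by move=> w; ring.
have mF2 := momentsX 2 mF.
have mc := moments_cst P (m ^+ 2).
have mZ := momentsZ (- (2 * m)) mF.
rewrite meanD//; last exact: momentsD.
rewrite meanD// meanZ// mean_cst -/m; lra.
Qed.

Lemma mean_le_sqrt F b : moments P F -> 0 <= b ->
  mean (fun w => F w ^+ 2) <= b ^+ 2 -> mean F <= b.
Proof.
move=> mF b0 Fb; rewrite leNgt; apply/negP => bF.
have := sqr_mean_le mF; apply/negP; rewrite -ltNge.
by apply: le_lt_trans Fb _; rewrite ltrXn2r ?nnegrE// (le_trans b0 (ltW bF)).
Qed.

(** Cauchy-Schwarz in a form that avoids square roots: F G is at most
    (b / 2a) F^2 + (a / 2b) G^2. *)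
Lemma mean_mul_le F G a b : moments P F -> moments P G -> 0 < a -> 0 < b ->
  mean (fun w => F w ^+ 2) <= a ^+ 2 -> mean (fun w => G w ^+ 2) <= b ^+ 2 ->
  mean (fun w => F w * G w) <= a * b.
Proof.
move=> mF mG a0 b0 Fa Gb.
have mF2 := momentsX 2 mF; have mG2 := momentsX 2 mG.
apply: (@le_trans _ _ (mean (fun w => b / (2 * a) * F w ^+ 2
                                      + a / (2 * b) * G w ^+ 2))).
  apply: le_mean; first exact: momentsM.
    by apply: momentsD; exact: momentsZ.
  move=> w; rewrite -subr_ge0.
  have -> : b / (2 * a) * F w ^+ 2 + a / (2 * b) * G w ^+ 2 - F w * G w =
      (2 * a * b)^-1 * (b * F w - a * G w) ^+ 2 by field; rewrite !gt_eqF.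
  by rewrite mulr_ge0 ?sqr_ge0// invr_ge0 !mulr_ge0// ltW.
rewrite meanD ?meanZ//; try exact: momentsZ.
have -> : a * b = b / (2 * a) * a ^+ 2 + a / (2 * b) * b ^+ 2.
  by field; rewrite !gt_eqF.
by apply: lerD; apply: ler_wpM2l => //; rewrite divr_ge0 ?mulr_ge0// ltW.
Qed.

Lemma measurable_gt F t : measurable_fun setT F -> measurable [set w | t < F w].
Proof.
move=> mF; rewrite -[X in measurable X]setTI.
have -> : [set w | t < F w] = F @^-1` `]t, +oo[%classic.
  by apply/seteqP; split=> w /=; rewrite in_itv/= andbT.
exact: mF.
Qed.

Lemma markov_mean F t : moments P F -> (forall w, 0 <= F w) -> 0 < t ->
  (P [set w | (t < F w)%R] <= (mean F / t)%:E)%E.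
Proof.
move=> mF F0 t0; have mS := measurable_gt t (moments_measurable mF).
rewrite -[X in (X <= _)%E]fineK; last exact: fin_num_measure.
rewrite lee_fin ler_pdivlMr// mulrC.
have iI : P.-integrable setT (EFin \o (\1_[set w | (t < F w)%R] : T -> R)).
  exact: integrable_indic.
have -> : t * fine (P [set w | t < F w]) =
    \int[P]_w (t * \1_[set w | t < F w] w).
  by rewrite RintegralZl// /Rintegral integral_indic// setIT.
apply: le_Rintegral => //.
- exact: (integrableZl measurableT t iI).
- exact: moments_integrable.
- move=> w _; rewrite indicE; case: (boolP (w \in _)); rewrite ?mulr0// mulr1.
  by rewrite inE => /ltW.
Qed.

Lemma chebyshev_mean F t : moments P F -> 0 < t ->
  (P [set w | (t < `|F w|)%R] <= (mean (fun w => F w ^+ 2) / t ^+ 2)%:E)%E.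
Proof.
move=> mF t0; have := @markov_mean _ (t ^+ 2) (momentsX 2 mF).
rewrite exprn_gt0// => /(_ (fun w => sqr_ge0 _) isT); apply: le_trans.
rewrite le_eqVlt; apply/orP; left; apply/eqP; congr (P _).
apply/seteqP; split=> w /=; rewrite -(real_normK (num_real (F w))).
  by rewrite ltr_pXn2r ?nnegrE// ltW.
by rewrite ltr_pXn2r ?nnegrE// ltW.
Qed.

End mean.

Section independent_blocks.
Context {d : measure_display} {T : measurableType d} {R : realType}
  (P : probability T R) {I : finType} (Y : I -> {RV P >-> R}).
Implicit Types (A B : {set I}) (F G : T -> R).

Definition block A F : Prop := depends_on Y A F /\ moments P F.

Lemma block_moments A F : block A F -> moments P F.
Proof. by case. Qed.

Lemma block_sub A B F : A \subset B -> block A F -> block B F.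
Proof. by move=> AB [dF mF]; split=> //; exact: depends_on_sub AB dF. Qed.

Lemma block_cst A c : block A (fun=> c).
Proof. by split; [exact: measurable_cst|exact: moments_cst]. Qed.

Lemma blockD A F G : block A F -> block A G -> block A (fun w => F w + G w).
Proof.
by move=> [? ?] [? ?]; split; [exact: measurable_funD|exact: momentsD].
Qed.

Lemma blockM A F G : block A F -> block A G -> block A (fun w => F w * G w).
Proof.
by move=> [? ?] [? ?]; split; [exact: measurable_funM|exact: momentsM].
Qed.

Lemma blockX A F k : block A F -> block A (fun w => F w ^+ k).
Proof.
by move=> [? ?]; split; [exact: measurable_funX|exact: momentsX].
Qed.

Lemma blockB A F G : block A F -> block A G -> block A (fun w => F w - G w).
Proof.
by move=> [? ?] [? ?]; split; [exact: measurable_funB|exact: momentsB].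
Qed.

Lemma block_sum A (J : eqType) (s : seq J) (F : J -> T -> R) :
  (forall j, j \in s -> block A (F j)) ->
  block A (fun w => \sum_(j <- s) F j w).
Proof.
elim: s => [|j s IH] mF.
  by under eq_fun do rewrite big_nil; exact: block_cst.
under eq_fun do rewrite big_cons; apply: blockD.
  by apply: mF; rewrite mem_head.
by apply: IH => k ks; apply: mF; rewrite inE ks orbT.
Qed.

Hypothesis indY : mutually_independent Y.

Lemma mean_indep A B F G : [disjoint A & B]%B -> block A F -> block B G ->
  mean P (fun w => F w * G w) = mean P F * mean P G.
Proof.
move=> dAB [dF mF] [dG mG].
have mf : measurable_fun setT F by exact: moments_measurable mF.
have mg : measurable_fun setT G by exact: moments_measurable mG.
pose f : {RV P >-> R} := HB.pack F (isMeasurableFun.Build _ _ _ _ F mf).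
pose g : {RV P >-> R} := HB.pack G (isMeasurableFun.Build _ _ _ _ G mg).
apply: (@indep_expectationM _ _ _ P f g).
- exact: (depends_on_indep indY dAB dF dG).
- exact: moments_integrable mF.
- exact: moments_integrable mG.
- exact: moments_integrable (momentsM mF mG).
Qed.

Section sums.
Context {J : eqType} (A : J -> {set I}) (xi : J -> T -> R).
Hypothesis disjA : forall j k, j != k -> [disjoint A j & A k]%B.
Hypothesis blk : forall j, block (A j) (xi j).
Hypothesis mean0 : forall j, mean P (xi j) = 0.

Let U (s : seq J) : {set I} := [set x | has (fun j => x \in A j) s].

Let block_U s : block (U s) (fun w => \sum_(j <- s) xi j w).
Proof.
apply: block_sum => j js; apply: block_sub (blk j).
by apply/fintype.subsetP => x xA; rewrite inE; apply/hasP; exists j.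
Qed.

Let disj_U j s : j \notin s -> [disjoint A j & U s]%B.
Proof.
move=> js; rewrite disjoint_subset; apply/fintype.subsetP => x xA.
rewrite !inE; apply/hasPn => k ks; apply/negP => xk.
have /disjA/disjointFr : j != k by apply: contraNneq js => ->.
by move/(_ _ xA); rewrite xk.
Qed.

Lemma mean_sum0 s : mean P (fun w => \sum_(j <- s) xi j w) = 0.
Proof.
rewrite mean_sum; last by move=> j; exact: block_moments (blk j).
by rewrite big1_seq.
Qed.

Lemma mean_sqr_sum s : uniq s -> mean P (fun w => (\sum_(j <- s) xi j w) ^+ 2)
  = \sum_(j <- s) mean P (fun w => xi j w ^+ 2).
Proof.
elim: s => [_|j s IH /= /andP[js us]].
  rewrite big_nil -[RHS](mean_cst P 0); apply: eq_mean => w.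
  by rewrite big_nil expr0n.
have bx := blk j; have bS := block_U s.
set S := (fun w => _) in bS; have dj := disj_U js.
rewrite big_cons -IH//.
rewrite (@eq_mean _ _ _ _ _ (fun w => xi j w ^+ 2 + (2 * (xi j w * S w) + S w ^+ 2))).
  rewrite meanD ?meanD ?meanZ ?(mean_indep dj bx bS) ?mean0 ?mul0r ?mulr0 ?add0r//;
  by repeat (apply: momentsD || apply: momentsZ || apply: momentsM ||
     apply: momentsX || exact: block_moments bx || exact: block_moments bS).
by move=> w; rewrite big_cons /S; ring.
Qed.

Variables v m : R.
Hypothesis v2m : v ^+ 2 <= m.
Hypothesis mean2 : forall j, mean P (fun w => xi j w ^+ 2) <= v.
Hypothesis mean4 : forall j, mean P (fun w => xi j w ^+ 4) <= m.

Lemma mean_sqr_sum_le s : uniq s ->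
  mean P (fun w => (\sum_(j <- s) xi j w) ^+ 2) <= (size s)%:R * v.
Proof.
move=> us; rewrite mean_sqr_sum// -sum1_size natr_sum mulr_suml.
by apply: ler_sum => j _; rewrite mul1r.
Qed.

(** Expanding (xi + S)^4 with xi and S independent and centered, only xi^4,
    6 xi^2 S^2 and S^4 contribute; hence the quadratic growth in the number of
    terms. *)
Lemma mean_pow4_sum_le s : uniq s ->
  mean P (fun w => (\sum_(j <- s) xi j w) ^+ 4) <= 3 * m * (size s)%:R ^+ 2.
Proof.
elim: s => [_|j s IH /= /andP[js us]].
  rewrite (@eq_mean _ _ _ _ _ (fun=> 0)) ?mean_cst ?expr0n ?mulr0//.
  by move=> w; rewrite big_nil expr0n.
have bx := blk j; have bS := block_U s; have {}IH := IH us.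
have S2 := mean_sqr_sum_le us; have S1 := mean_sum0 s.
set S := (fun w => _) in bS S1.
have dj := disj_U js.
rewrite (@eq_mean _ _ _ _ _ (fun w => xi j w ^+ 4 +
   (4 * (xi j w ^+ 3 * S w) + (6 * (xi j w ^+ 2 * S w ^+ 2) +
   (4 * (xi j w * S w ^+ 3) + S w ^+ 4))))); last first.
  by move=> w; rewrite big_cons /S; ring.
have i1 := mean_indep dj (blockX 3 bx) bS.
have i2 := mean_indep dj (blockX 2 bx) (blockX 2 bS).
have i3 := mean_indep dj bx (blockX 3 bS).
rewrite mean0 mul0r in i3; rewrite S1 mulr0 in i1.
rewrite !meanD ?meanZ ?i1 ?i2 ?i3 ?mulr0 ?add0r;
  try by repeat (apply: momentsD || apply: momentsZ || apply: momentsM ||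
     apply: momentsX || exact: block_moments bx || exact: block_moments bS).
have x4 := mean4 j; have x2 := mean2 j.
have x20 : 0 <= mean P (fun w => xi j w ^+ 2).
  by apply: mean_ge0 => w; exact: sqr_ge0.
have S20 : 0 <= mean P (fun w => S w ^+ 2).
  by apply: mean_ge0 => w; exact: sqr_ge0.
have h : mean P (fun w => xi j w ^+ 2) * mean P (fun w => S w ^+ 2) <=
   (size s)%:R * m.
  apply: le_trans (ler_pM x20 S20 x2 S2) _.
  by rewrite mulrCA -expr2 ler_wpM2l.
rewrite -natr1; have m0 : 0 <= m by apply: le_trans v2m; exact: sqr_ge0.
rewrite /S in h *; move: (ler0n R (size s)) => k0; nra.
Qed.

End sums.
End independent_blocks.

(** * Densities and affine images of normal laws *)

Section density.
Context {d : measure_display} {T : measurableType d} {R : realType}.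
Variables (la nu : {measure set T -> \bar R}) (g : T -> R).
Hypotheses (mg : measurable_fun setT g) (g0 : forall x, 0 <= g x).
Hypothesis nuE : forall A, measurable A -> nu A = (\int[la]_(x in A) (g x)%:E)%E.

Import HBNNSimple.

Let mgE : measurable_fun setT (EFin \o g).
Proof. exact/measurable_EFinP. Qed.

Let integral_density_nnsfun (f : {nnsfun T >-> R}) :
  (\int[nu]_x (f x)%:E = \int[la]_x ((f x)%:E * (g x)%:E))%E.
Proof.
under [LHS]eq_integral do rewrite fimfunE -fsumEFin//.
rewrite [LHS]ge0_integral_fsum//; last 2 first.
  - by move=> r; exact/measurable_EFinP/measurableT_comp.
  - by move=> n x _; rewrite EFinM nnfun_muleindic_ge0.
under [RHS]eq_integral.
  move=> x xD; rewrite fimfunE -fsumEFin// ge0_mule_fsuml; last first.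
    by move=> r; rewrite EFinM nnfun_muleindic_ge0.
  over.
rewrite [RHS]ge0_integral_fsum//; last 2 first.
  - move=> r; apply: emeasurable_funM => //.
    by apply/measurable_EFinP/measurableT_comp.
  - move=> n x _; apply: mule_ge0; last by rewrite lee_fin.
    by rewrite EFinM nnfun_muleindic_ge0.
apply: eq_fsbigr => r rf.
under [LHS]eq_integral do rewrite EFinM.
under [RHS]eq_integral do rewrite EFinM -muleA.
have r0 : (0 <= r%:E)%E.
  by move: rf; rewrite inE => -[x _ <-]; rewrite lee_fin.
have mf : measurable (f @^-1` [set r]) by exact: measurable_sfunP.
rewrite !ge0_integralZl//=; last 3 first.
- apply: emeasurable_funM => //; apply/measurable_EFinP.
  exact: measurable_indic.
- by move=> x _; apply: mule_ge0; rewrite lee_fin.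
- by apply/measurable_EFinP; exact: measurable_indic.
congr (_ * _)%E; rewrite integral_indic// setIT nuE//.
rewrite integral_mkcond; apply: eq_integral => x _.
by rewrite patchE indicE; case: (x \in _); rewrite ?mul1e ?mul0e.
Qed.

(** The identity for indicators is the definition of the density; simple functions
    and monotone convergence do the rest. *)
Lemma ge0_integral_density (f : T -> \bar R) : measurable_fun setT f ->
  (forall x, 0 <= f x)%E ->
  (\int[nu]_x f x = \int[la]_x (f x * (g x)%:E))%E.
Proof.
move=> mf f0; pose f_ := nnsfun_approx measurableT mf.
transitivity (lim (\int[nu]_x (f_ n x)%:E @[n --> \oo])%E).
  rewrite -monotone_convergence//=.
  - apply: eq_integral => ? /[!inE] xD; apply/esym/cvg_lim => //=.
    exact: cvg_nnsfun_approx.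
  - by move=> n; exact/measurable_EFinP/measurable_funTS.
  - by move=> n ? _; rewrite lee_fin.
  - by move=> ? _ ? ? mn; rewrite lee_fin; exact/lefP/nd_nnsfun_approx.
rewrite [RHS](_ : _ = lim
    (\int[la]_x ((f_ n x)%:E * (g x)%:E) @[n --> \oo])%E); last first.
  rewrite -monotone_convergence//=.
  - apply: eq_integral => x _; apply/esym/cvg_lim => //.
    apply: cvgeZr => //; exact: cvg_nnsfun_approx.
  - move=> n; apply: emeasurable_funM => //.
    exact/measurable_EFinP/measurable_funTS.
  - by move=> n x _; rewrite mule_ge0// lee_fin.
  - move=> x _ ? ? ?; apply: lee_wpmul2r; first by rewrite lee_fin.
    by rewrite lee_fin; exact/lefP/nd_nnsfun_approx.
by apply: congr_lim; apply/funext => n /=; exact: integral_density_nnsfun.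
Qed.

End density.

Section affine.
Context {R : realType}.
Notation la := (@lebesgue_measure R).

Definition affine (a b : R) (x : measurableTypeR R) : measurableTypeR R :=
  a * x + b.

Lemma measurable_affine a b : measurable_fun setT (affine a b).
Proof. by apply: measurable_funD => //; exact: measurable_funM. Qed.

HB.instance Definition _ a b :=
  isMeasurableFun.Build _ _ _ _ (affine a b) (measurable_affine a b).

Lemma lebesgue_measure_affine (a b : R) (A : set R) : 0 < a -> measurable A ->
  (la A = a%:E * pushforward la (affine a b) A)%E.
Proof.
move=> a0 mA; have a0' : 0 <= a by exact: ltW.
apply: (lebesgue_measure_unique
  (mu := mscale (NngNum a0') (pushforward la (affine a b)))) => // _ [[u v] _ <-].
change (la `]u, v]%classic =
  a%:E * la (affine a b @^-1` `]u, v]%classic))%E.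
have -> : affine a b @^-1` `]u, v]%classic = `](u - b) / a, (v - b) / a]%classic.
  apply/seteqP; split=> x /=; rewrite !in_itv/= /affine => /andP[].
    by rewrite ltr_pdivrMr// ler_pdivlMr// => ux xv; apply/andP; split; lra.
  by rewrite ltr_pdivrMr// ler_pdivlMr// => ux xv; apply/andP; split; lra.
rewrite !lebesgue_measure_itv/= !lte_fin ltr_pM2r ?invr_gt0// ltrD2r.
case: ifP => _; last by rewrite mule0.
by rewrite -!EFinD -EFinM; congr EFin; field; rewrite gt_eqF.
Qed.

Lemma ge0_integral_affine (a b : R) (f : R -> \bar R) : 0 < a ->
  measurable_fun setT f -> (forall x, 0 <= f x)%E ->
  (\int[la]_x f x = a%:E * \int[la]_x f (affine a b x))%E.
Proof.
move=> a0 mf f0; have a0' : 0 <= a by exact: ltW.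
rewrite (eq_measure_integral (mscale (NngNum a0') (pushforward la (affine a b)))).
  by rewrite ge0_integral_mscale//= ge0_integral_pushforward.
by move=> A mA _; exact: lebesgue_measure_affine.
Qed.

Lemma normal_probE (m s : R) (A : set R) : measurable A ->
  normal_prob m s A = (\int[la]_x (\1_A x * normal_pdf m s x)%:E)%E.
Proof.
move=> mA; rewrite /normal_prob integral_mkcond; apply: eq_integral => x _.
by rewrite patchE indicE; case: (x \in A); rewrite ?mul1r ?mul0r.
Qed.

Lemma ge0_integral_normal_prob (m s : R) (f : R -> \bar R) :
  measurable_fun setT f -> (forall x, 0 <= f x)%E ->
  (\int[normal_prob m s]_x f x = \int[la]_x (f x * (normal_pdf m s x)%:E))%E.
Proof.
move=> mf f0; apply: ge0_integral_density => //.
  exact: measurable_normal_pdf.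
by move=> x; exact: normal_pdf_ge0.
Qed.

Lemma normal_pdf_affine (m s a b x : R) : 0 < a -> 0 < s ->
  normal_pdf m s x = a * normal_pdf (a * m + b) (a * s) (a * x + b).
Proof.
move=> a0 s0; rewrite !normal_pdfE ?mulf_neq0 ?gt_eqF//.
rewrite mulrA; congr (_ * _).
  rewrite /normal_peak.
  have -> : (a * s) ^+ 2 * pi *+ 2 = a ^+ 2 * (s ^+ 2 * pi *+ 2) by ring.
  rewrite sqrtrM ?sqr_ge0// sqrtr_sqr gtr0_norm//.
  by rewrite invfM mulrA mulfV ?mul1r// gt_eqF.
rewrite /normal_fun; congr expR.
have -> : a * x + b - (a * m + b) = a * (x - m) by ring.
by rewrite !exprMn; field; rewrite !gt_eqF.
Qed.

Lemma normal_prob_affine (m s a b : R) (A : set R) : 0 < a -> 0 < s ->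
  measurable A ->
  normal_prob m s (affine a b @^-1` A) = normal_prob (a * m + b) (a * s) A.
Proof.
move=> a0 s0 mA; rewrite !normal_probE//; last first.
  by rewrite -[X in measurable X]setTI; exact: measurable_affine.
rewrite [RHS](@ge0_integral_affine a b)//.
- rewrite -ge0_integralZl//=; first last.
  + by rewrite lee_fin ltW.
  + by move=> x _; rewrite lee_fin mulr_ge0// normal_pdf_ge0.
  + apply/measurable_EFinP/measurable_funM.
      apply: (@measurableT_comp _ _ _ _ _ _ (\1_A : R -> R) _ (affine a b)) => //.
      exact: measurable_affine.
    apply: (@measurableT_comp _ _ _ _ _ _
      (normal_pdf (a * m + b) (a * s)) _ (affine a b)).
      exact: measurable_normal_pdf.
    exact: measurable_affine.
  apply: eq_integral => x _; rewrite -EFinM (normal_pdf_affine m b x a0 s0).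
  by congr EFin; rewrite mulrCA; congr (_ * _); rewrite !indicE.
- apply/measurable_EFinP/measurable_funM; first exact: measurable_indic.
  exact: measurable_normal_pdf.
- by move=> x; rewrite lee_fin mulr_ge0// normal_pdf_ge0.
Qed.

End affine.

(** * Moments of the centered normal law *)

Section gaussian_moments.
Context {R : realType}.
Notation la := (@lebesgue_measure R).

Let is_deriveNgauss (y : R) : is_derive y 1 (fun y => - gauss_fun y) (2 * y * gauss_fun y).
Proof.
rewrite /gauss_fun; apply: is_derive_eq.
rewrite !scaler1 -?mulr_regl /GRing.scale/=; ring.
Qed.

Let gauss_tail (x : R) : 0 <= x ->
  (\int[la]_(y in `[x, +oo[) (2 * y * gauss_fun y)%:E = (gauss_fun x)%:E)%E.
Proof.
move=> x0; rewrite (@ge0_continuous_FTC2y _ _ (fun y => - gauss_fun y) _ 0).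
- by rewrite sub0e -EFinN opprK.
- move=> y xy; rewrite mulr_ge0 ?gauss_fun_ge0// mulr_ge0//; exact: le_trans xy.
- apply: continuous_subspaceT => y.
  apply: cvgM; last exact: continuous_gauss_fun.
  by apply: cvgM; [exact: cvg_cst|exact: cvg_id].
- by rewrite -oppr0; apply: cvgN; exact: cvg_gauss_fun.
- by move=> y _; exact: ex_derive.
- apply: cvgN; apply: cvg_at_right_filter; exact: continuous_gauss_fun.
- by move=> y _; rewrite derive1E; exact: derive_val.
Qed.

(** The second moment comes from exchanging the integrals of 2 y exp(- y^2) over
    0 <= x <= y: integrating in y first gives exp(- x^2), integrating in x first
    gives 2 y^2 exp(- y^2). *)
Let D : set (R * R) := [set z | 0 <= z.1 /\ 0 <= z.2 - z.1].

Let mD : measurable D.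
Proof.
have -> : D = (fst @^-1` `[0, +oo[%classic) `&`
    ((fun z : R * R => z.2 - z.1) @^-1` `[0, +oo[%classic).
  by apply/seteqP; split=> z /=; rewrite !in_itv/= !andbT.
apply: measurableI; rewrite -[X in measurable X]setTI.
  exact: measurable_fst.
have : measurable_fun setT (fun z : R * R => z.2 - z.1).
  by apply: measurable_funB; [exact: measurable_snd|exact: measurable_fst].
exact.
Qed.

Let k (z : R * R) : R := \1_D z * (2 * z.2 * gauss_fun z.2).

Let k_ge0 z : 0 <= k z.
Proof.
rewrite /k indicE; case: (boolP (z \in D)); rewrite ?mul0r// mul1r inE => -[z1 z2].
by rewrite mulr_ge0 ?gauss_fun_ge0// mulr_ge0//; lra.
Qed.

Let mk : measurable_fun setT (EFin \o k).
Proof.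
apply/measurable_EFinP/measurable_funM; first exact: measurable_indic.
apply: measurable_funM.
  by apply: measurable_funM => //; exact: measurable_snd.
by apply: measurableT_comp; [exact: measurable_gauss_fun|exact: measurable_snd].
Qed.

Lemma gauss_half_second_moment :
  (\int[la]_(x in `[0%R, +oo[) (2 * x ^+ 2 * gauss_fun x)%:E =
   \int[la]_(x in `[0%R, +oo[) (gauss_fun x)%:E)%E.
Proof.
have := @fubini_tonelli _ _ _ _ R la la _ mk (fun z => k_ge0 z).
rewrite [X in X = _ -> _](_ : _ =
    (\int[la]_(x in `[0%R, +oo[) (gauss_fun x)%:E)%E); last first.
  rewrite [RHS]integral_mkcond; apply: eq_integral => x _; rewrite patchE.
  case: ifPn => [|].
    rewrite inE/= in_itv/= andbT => x0; rewrite -gauss_tail//.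
    rewrite [RHS]integral_mkcond; apply: eq_integral => y _; rewrite patchE /k/= indicE.
    case: ifPn => [|].
      rewrite inE/= in_itv/= andbT => xy.
      by rewrite mem_set ?mul1r//; split => //=; rewrite subr_ge0.
    rewrite notin_setE/= in_itv/= andbT => xy.
    by rewrite memNset ?mul0r// => -[_ /=]; rewrite subr_ge0.
  rewrite notin_setE/= in_itv/= andbT => x0.
  apply: integral0_eq => y _; rewrite /k/= indicE memNset ?mul0r//.
  by move=> [].
rewrite [X in _ = X -> _](_ : _ =
    (\int[la]_(x in `[0%R, +oo[) (2 * x ^+ 2 * gauss_fun x)%:E)%E) //.
rewrite [RHS]integral_mkcond; apply: eq_integral => y _; rewrite patchE.
case: ifPn => [|].
  rewrite inE/= in_itv/= andbT => y0.
  transitivity (\int[la]_x ((2 * y * gauss_fun y)%:E * (\1_`[0, y] x)%:E))%E.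
    apply: eq_integral => x _; rewrite /k/= mulrC EFinM; congr (_ * _%:E)%E.
    rewrite !indicE; congr (nat_of_bool _)%:R; apply/idP/idP.
      by rewrite !inE/= in_itv/= => -[/= x0]; rewrite subr_ge0 x0.
    by rewrite !inE/= in_itv/= => /andP[x0 xy]; split=> //=; rewrite subr_ge0.
  rewrite integralZl//; last exact: integrable_indic_itv.
  have Ly : la `[0, y]%classic = y%:E.
    rewrite lebesgue_measure_itv/= lte_fin.
    have [->|yn0] := eqVneq y 0; first by rewrite ltxx.
    by rewrite lt_neqAle eq_sym yn0 y0/= oppr0 adde0.
  rewrite integral_indic// setIT -[X in (_ * X)%E]/(la `[0, y]%classic) Ly.
  by rewrite -EFinM; congr EFin; ring.
rewrite notin_setE/= in_itv/= andbT => y0.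
apply: integral0_eq => x _; rewrite /k/= indicE memNset ?mul0r//.
by move=> [/=]; rewrite subr_ge0 => x0 xy; apply: y0; exact: le_trans xy.
Qed.

Lemma gauss_second_moment :
  (\int[la]_x (2 * x ^+ 2 * gauss_fun x)%:E = \int[la]_x (gauss_fun x)%:E)%E.
Proof.
have e : [set x : R | (0 <= x)%R] = `[0, +oo[%classic.
  by apply/seteqP; split=> x /=; rewrite in_itv/= andbT.
rewrite !ge0_symfun_integralT//.
- by rewrite e gauss_half_second_moment.
- by move=> x; rewrite mulr_ge0 ?gauss_fun_ge0// mulr_ge0// sqr_ge0.
- move=> x; apply: cvgM; last exact: continuous_gauss_fun.
  by apply: cvgM; [exact: cvg_cst|exact: sqr_continuous].
- by move=> x /=; rewrite /gauss_fun sqrrN.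
- by move=> x; exact: gauss_fun_ge0.
- exact: continuous_gauss_fun.
- by move=> x /=; rewrite /gauss_fun sqrrN.
Qed.

Lemma normal_second_moment (s : R) : 0 < s ->
  (\int[normal_prob 0 s]_x (x ^+ 2)%:E = (s ^+ 2)%:E)%E.
Proof.
move=> s0; rewrite ge0_integral_normal_prob//; last 2 first.
- by apply/measurable_EFinP; exact: measurable_funX.
- by move=> x; rewrite lee_fin sqr_ge0.
have r2 : Num.sqrt 2 ^+ 2 = 2 :> R by rewrite sqr_sqrtr.
have r0 : 0 < Num.sqrt 2 :> R by rewrite sqrtr_gt0.
have a0 : 0 < Num.sqrt 2 * s by rewrite mulr_gt0.
have E (x : R) : normal_pdf 0 s (affine (Num.sqrt 2 * s) 0 x) =
    (Num.sqrt 2 * s)^-1 * (Num.sqrt pi)^-1 * gauss_fun x.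
  rewrite normal_pdfE ?gt_eqF// /normal_peak /normal_fun /gauss_fun /affine.
  congr (_ * expR _); last first.
    by rewrite addr0 subr0 !exprMn r2; field; rewrite gt_eqF.
  have -> : s ^+ 2 * pi *+ 2 = (Num.sqrt 2 * s) ^+ 2 * pi.
    by rewrite exprMn r2; ring.
  by rewrite sqrtrM ?sqr_ge0// sqrtr_sqr gtr0_norm// invfM.
rewrite (@ge0_integral_affine _ (Num.sqrt 2 * s) 0)//; last 2 first.
- apply/measurable_EFinP/measurable_funM; first exact: measurable_funX.
  exact: measurable_normal_pdf.
- by move=> x; rewrite lee_fin mulr_ge0 ?sqr_ge0 ?normal_pdf_ge0.
transitivity ((Num.sqrt 2 * s)%:E * \int[la]_x
   ((s / Num.sqrt 2 / Num.sqrt pi)%:E * (2 * x ^+ 2 * gauss_fun x)%:E))%E.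
  congr (_ * _)%E; apply: eq_integral => x _; rewrite -!EFinM E; congr EFin.
  rewrite /affine addr0; move: (gauss_fun x) => g.
  have -> : (Num.sqrt 2 * s * x) ^+ 2 = 2 * s ^+ 2 * x ^+ 2.
    by rewrite !exprMn r2.
  have pi0 : Num.sqrt pi != 0 :> R by rewrite gt_eqF// sqrtr_gt0 pi_gt0.
  by field; rewrite pi0 !gt_eqF.
rewrite ge0_integralZl//=; last 3 first.
- apply/measurable_EFinP/measurable_funM; last exact: measurable_gauss_fun.
  by apply: measurable_funM => //; exact: measurable_funX.
- by move=> x _; rewrite lee_fin mulr_ge0 ?gauss_fun_ge0// mulr_ge0// sqr_ge0.
- by rewrite lee_fin !divr_ge0// ltW.
rewrite gauss_second_moment integralT_gauss -!EFinM; congr EFin.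
have pi0 : Num.sqrt pi != 0 :> R by rewrite gt_eqF// sqrtr_gt0 pi_gt0.
by field; rewrite pi0 gt_eqF.
Qed.

(** x^(2j) exp(- x^2 / 2 s^2) is at most a constant times exp(- x^2 / 4 s^2), which
    is the density of a normal law of variance 2 s^2 up to a factor. *)
Lemma normal_even_moment_finite (s : R) (j : nat) : 0 < s ->
  (\int[normal_prob 0 s]_x (x ^+ (2 * j))%:E < +oo)%E.
Proof.
move=> s0; rewrite ge0_integral_normal_prob//; last 2 first.
- by apply/measurable_EFinP; exact: measurable_funX.
- by move=> x; rewrite lee_fin exprM exprn_ge0 ?sqr_ge0.
have r2 : Num.sqrt 2 ^+ 2 = 2 :> R by rewrite sqr_sqrtr.
have r0 : 0 < Num.sqrt 2 :> R by rewrite sqrtr_gt0.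
have t0 : 0 < Num.sqrt 2 * s by rewrite mulr_gt0.
pose C : R := (4 * s ^+ 2) ^+ j * j`!%:R * (normal_peak s / normal_peak (Num.sqrt 2 * s)).
have C0 : 0 <= C.
  rewrite mulr_ge0 ?divr_ge0 ?normal_peak_ge0//.
  by rewrite mulr_ge0// exprn_ge0// mulr_ge0// sqr_ge0.
apply: (@le_lt_trans _ _ (\int[la]_x (C%:E * (normal_pdf 0 (Num.sqrt 2 * s) x)%:E))%E).
  apply: ge0_le_integral => //=.
  - by move=> x _; rewrite lee_fin mulr_ge0 ?normal_pdf_ge0// exprM exprn_ge0 ?sqr_ge0.
  - apply/measurable_EFinP/measurable_funM; first exact: measurable_funX.
    exact: measurable_normal_pdf.
  - apply/measurable_EFinP/measurable_funM => //; exact: measurable_normal_pdf.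
  move=> x _; rewrite lee_fin !normal_pdfE ?gt_eqF// /C.
  have pk : 0 < normal_peak (Num.sqrt 2 * s) by rewrite normal_peak_gt0 ?gt_eqF.
  rewrite [leLHS]mulrCA.
  have regroup (u v w z : R) : w != 0 -> u * (v / w) * (w * z) = v * (u * z).
    by move=> w0; field.
  rewrite regroup ?gt_eqF// ler_wpM2l ?normal_peak_ge0//.
  rewrite /normal_fun !subr0.
  set y := x ^+ 2 / (4 * s ^+ 2).
  have y0 : 0 <= y by apply: divr_ge0; [exact: sqr_ge0|apply: mulr_ge0; rewrite ?sqr_ge0].
  have -> : - x ^+ 2 / (s ^+ 2 *+ 2) = - y + - y by rewrite /y; field; rewrite gt_eqF.
  have -> : - x ^+ 2 / ((Num.sqrt 2 * s) ^+ 2 *+ 2) = - y.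
    by rewrite exprMn r2 /y; field; rewrite gt_eqF.
  rewrite expRD mulrA ler_wpM2r ?expR_ge0//.
  rewrite expRN ler_pdivrMr ?expR_gt0// exprM.
  have -> : x ^+ 2 = 4 * s ^+ 2 * y by rewrite /y; field; rewrite gt_eqF.
  rewrite exprMn -mulrA ler_wpM2l//; first by rewrite exprn_ge0// mulr_ge0// sqr_ge0.
  case: j {C C0} => [|j]; first by rewrite expr0 fact0 mul1r -expR0 ler_expR.
  rewrite mulrC -ler_pdivrMr ?ltr0n ?fact_gt0//.
  by apply: le_trans (expR_ge1Dxn j y0); rewrite lerDr.
rewrite integralZl//; last exact: integrable_normal_pdf.
by rewrite integral_normal_pdf mule1 ltry.
Qed.

End gaussian_moments.

(** * Sums of independent normal variables *)

Section normal_convolution.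
Context {R : realType}.
Notation la := (@lebesgue_measure R).
Variables (s t : R).
Hypotheses (s0 : 0 < s) (t0 : 0 < t).

Let r := Num.sqrt (s ^+ 2 + t ^+ 2).

Let r2 : r ^+ 2 = s ^+ 2 + t ^+ 2.
Proof. by rewrite sqr_sqrtr// addr_ge0 ?sqr_ge0. Qed.

Let r0 : 0 < r.
Proof. by rewrite sqrtr_gt0 addr_gt0// exprn_gt0. Qed.

(** Completing the square in x: the joint density of the two variables is the
    density of their sum times a conditional density, which integrates to 1. *)
Lemma normal_pdf_mul (x z : R) : normal_pdf x t z * normal_pdf 0 s x =
  normal_pdf 0 r z * normal_pdf (z * s ^+ 2 / r ^+ 2) (s * t / r) x.
Proof.
have q0 : 0 < s * t / r by rewrite divr_gt0// mulr_gt0.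
rewrite !normal_pdfE ?gt_eqF//.
have regroup (a b c e : R) : a * b * (c * e) = a * c * (b * e) by ring.
rewrite [LHS]regroup [RHS]regroup; congr (_ * _).
  rewrite /normal_peak -!invfM; congr (_^-1).
  have S (a : R) : 0 < a -> Num.sqrt (a ^+ 2 * pi *+ 2) = a * Num.sqrt (pi *+ 2).
    by move=> a0; rewrite -mulrnAr sqrtrM ?sqr_ge0// sqrtr_sqr gtr0_norm.
  by rewrite !S//; field; rewrite gt_eqF.
rewrite /normal_fun -!expRD; congr expR.
rewrite !subr0 !exprMn exprVn r2; field.
have sn : s != 0 by rewrite gt_eqF.
have tn : t != 0 by rewrite gt_eqF.
by rewrite sn tn -r2 expf_neq0// gt_eqF.
Qed.

Let f (B : set R) (z : R * R) := (\1_B z.2 * normal_pdf z.1 t z.2)%:E.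

Let mf B : measurable B -> measurable_fun setT (f B).
Proof.
move=> mB; have pdfE (z : R * R) : normal_pdf z.1 t z.2 = normal_pdf 0 t (z.2 - z.1).
  by rewrite (@normal_pdf_affine _ z.1 t 1 (- z.1))// !mul1r subrr.
have mpdf : measurable_fun setT (fun z : R * R => normal_pdf z.1 t z.2).
  under eq_fun do rewrite pdfE.
  apply: (measurableT_comp (measurable_normal_pdf 0 t)).
  by apply: measurable_funB; [exact: measurable_snd|exact: measurable_fst].
have mI : measurable_fun setT (fun z : R * R => \1_B z.2 : R).
  by apply: measurableT_comp; [exact: measurable_indic|exact: measurable_snd].
by apply/measurable_EFinP/measurable_funM.
Qed.

Let f0 B z : (0 <= f B z)%E.
Proof. by rewrite lee_fin mulr_ge0// normal_pdf_ge0. Qed.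

Let pE B x : measurable B -> normal_prob x t B = (\int[la]_z f B (x, z))%E.
Proof. by move=> mB; rewrite normal_probE. Qed.

Lemma measurable_normal_prob_mean B : measurable B ->
  measurable_fun setT (fun x => normal_prob x t B).
Proof.
move=> mB; under eq_fun do rewrite pE//.
exact: (@measurable_fun_fubini_tonelli_F _ _ _ _ R la (f B) (mf mB)).
Qed.

Lemma normal_prob_conv (B : set R) : measurable B ->
  (\int[normal_prob 0 s]_x normal_prob x t B = normal_prob 0 r B)%E.
Proof.
move=> mB.
rewrite ge0_integral_normal_prob//; last first.
  exact: measurable_normal_prob_mean.
pose g (z : R * R) := (f B z * (normal_pdf 0 s z.1)%:E)%E.
have ms : measurable_fun setT (fun z : R * R => (normal_pdf 0 s z.1)%:E).
  apply/measurable_EFinP.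
  by apply: measurableT_comp; [exact: measurable_normal_pdf|exact: measurable_fst].
have mg : measurable_fun setT g by apply: emeasurable_funM => //; exact: mf.
have g0 z : (0 <= g z)%E by rewrite mule_ge0// lee_fin normal_pdf_ge0.
transitivity (\int[la]_x \int[la]_z g (x, z))%E.
  apply: eq_integral => x _; rewrite pE// -ge0_integralZr//.
    by apply: (measurableT_comp (mf mB)); exact: measurable_pair1.
  by rewrite lee_fin normal_pdf_ge0.
rewrite (@fubini_tonelli _ _ _ _ R la la g mg g0) normal_probE//.
apply: eq_integral => z _.
transitivity (\int[la]_x ((\1_B z * normal_pdf 0 r z)%:E *
    (normal_pdf (z * s ^+ 2 / r ^+ 2) (s * t / r) x)%:E))%E.
  apply: eq_integral => x _; rewrite /g /f/= -!EFinM; congr EFin.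
  by rewrite -[LHS]mulrA normal_pdf_mul [LHS]mulrA.
rewrite integralZl//; last exact: integrable_normal_pdf.
by rewrite integral_normal_pdf mule1.
Qed.

End normal_convolution.

Section display_change.
Context {R : realType}.

Let toR (x : measurableTypeR R) : R := x.

Let mtoR : measurable_fun setT toR.
Proof. by move=> _ A mA; rewrite setTI. Qed.

HB.instance Definition _ := isMeasurableFun.Build _ _ _ _ toR mtoR.

(** The Borel sets of the real line come with two displays, that of the real type
    and that of the construction of the Lebesgue measure. Distributions of random
    variables use the first, normal laws the second, and this lemma moves
    integrals from one to the other. *)
Lemma ge0_eq_measure_integralR (nu : {measure set R -> \bar R})
    (nu' : {measure set (measurableTypeR R) -> \bar R}) (f : R -> \bar R) :
  measurable_fun setT f -> (forall x, 0 <= f x)%E ->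
  (forall A : set R, measurable A -> nu A = nu' A) ->
  (\int[nu]_x f x = \int[nu']_x f x)%E.
Proof.
move=> mf f0 nuE; rewrite (eq_measure_integral (pushforward nu' toR)).
  by rewrite ge0_integral_pushforward.
by move=> A mA _; rewrite nuE.
Qed.

End display_change.

Section normal_random_variables.
Context {d : measure_display} {T : measurableType d} {R : realType}
  (P : probability T R).
Implicit Types (F G : T -> R).

Definition normal_law F (m s : R) : Prop := measurable_fun setT F /\
  forall A : set R, measurable A -> P (F @^-1` A) = normal_prob m s A.

Lemma normal_law_affine F m s a b : 0 < a -> 0 < s -> normal_law F m s ->
  normal_law (fun w => a * F w + b) (a * m + b) (a * s).
Proof.
move=> a0 s0 [mF FE]; split.
  by apply: measurable_funD => //; exact: measurable_funM.
move=> A mA; rewrite -normal_prob_affine// -FE//.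
by rewrite -[X in measurable X]setTI; exact: measurable_affine.
Qed.

Lemma ge0_integral_normal_law F m s (f : R -> \bar R) : normal_law F m s ->
  measurable_fun setT f -> (forall x, 0 <= f x)%E ->
  (\int[P]_w f (F w) = \int[normal_prob m s]_x f x)%E.
Proof.
move=> [mF FE] mf f0.
pose X : {RV P >-> R} := HB.pack F (isMeasurableFun.Build _ _ _ _ F mF).
rewrite -(ge0_integral_distribution X mf f0).
by apply: ge0_eq_measure_integralR.
Qed.

Lemma normal_law_moments F s : 0 < s -> normal_law F 0 s -> moments P F.
Proof.
move=> s0 nF; split=> [|k]; first by case: nF.
have mF : measurable_fun setT F by case: nF.
have i2 : P.-integrable setT (fun w => (F w ^+ (2 * k))%:E).
  apply/integrableP; split; first exact/measurable_EFinP/measurable_funX.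
  have e0 (x : R) : (0 <= (x ^+ (2 * k))%:E)%E.
    by rewrite lee_fin exprM exprn_ge0// sqr_ge0.
  under eq_integral do rewrite gee0_abs//.
  rewrite (ge0_integral_normal_law (f := fun x => (x ^+ (2 * k))%:E) nF).
  - exact: normal_even_moment_finite.
  - exact/measurable_EFinP/measurable_funX.
  - by move=> x; rewrite lee_fin exprM exprn_ge0// sqr_ge0.
have i1 : P.-integrable setT (fun=> 1%:E).
  exact: (finite_measure_integrable_cst P 1 measurableT).
apply: (@le_integrable _ _ _ P _ measurableT _
  (fun w => (1%:E + (F w ^+ (2 * k))%:E)%E)).
- exact/measurable_EFinP/measurable_funX.
- move=> w _; rewrite -EFinD/= lee_fin mulnC exprM.
  rewrite [leRHS]ger0_norm ?addr_ge0 ?sqr_ge0//.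
  rewrite -(real_normK (num_real (F w ^+ k))).
  by have := sqr_ge0 (`|F w ^+ k| - 1); have := normr_ge0 (F w ^+ k); nra.
- by apply: integrableD.
Qed.

Definition gaussian_moment (s : R) (k : nat) : R :=
  fine (\int[normal_prob 0 s]_x (x ^+ k)%:E)%E.

Lemma normal_law_even_moment F s k : normal_law F 0 s ->
  mean P (fun w => F w ^+ (2 * k)) = gaussian_moment s (2 * k).
Proof.
move=> nF; rewrite /mean /Rintegral; congr fine.
rewrite (ge0_integral_normal_law (f := fun x => (x ^+ (2 * k))%:E) nF)//.
  exact/measurable_EFinP/measurable_funX.
by move=> x; rewrite lee_fin exprM exprn_ge0// sqr_ge0.
Qed.

Lemma normal_law_variance F s : 0 < s -> normal_law F 0 s ->
  mean P (fun w => F w ^+ 2) = s ^+ 2.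
Proof.
move=> s0 nF; rewrite (normal_law_even_moment 1 nF) /gaussian_moment.
by rewrite normal_second_moment.
Qed.

Lemma normal_probN (s : R) (A : set R) : 0 < s -> measurable A ->
  normal_prob 0 s (-%R @^-1` A) = normal_prob 0 s A.
Proof.
move=> s0 mA.
have mN : measurable_fun setT (-%R : R -> R) by exact: oppr_measurable.
have mA' : measurable (-%R @^-1` A).
  by rewrite -[X in measurable X]setTI; exact: mN.
rewrite !normal_probE//.
pose f x := (\1_A x * normal_pdf 0 s x)%:E.
have mf : measurable_fun setT f.
  apply/measurable_EFinP/measurable_funM; first exact: measurable_indic.
  exact: measurable_normal_pdf.
transitivity (\int[lebesgue_measure]_x (f \o -%R) x)%E.
  apply: eq_integral => x _; rewrite /f/=; congr (_ * _)%:E.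
  by rewrite !normal_pdfE ?gt_eqF// /normal_fun !subr0 sqrrN.
rewrite -(@ge0_integral_pushforward _ _ (measurableTypeR R) (measurableTypeR R)
  R -%R _ lebesgue_measure setT f)//.
- by apply: eq_measure_integral => B mB _; exact: lebesgue_measureN.
- by move=> x _; rewrite lee_fin mulr_ge0// normal_pdf_ge0.
Qed.

(** The law is invariant under x -> - x. *)
Lemma normal_law_mean F s : 0 < s -> normal_law F 0 s -> mean P F = 0.
Proof.
move=> s0 nF; have mF := normal_law_moments s0 nF.
have nN : normal_law (fun w => - F w) 0 s.
  case: nF => m nF; split=> [|A mA]; first exact: measurableT_comp.
  rewrite -normal_probN// -nF//.
  have mN : measurable_fun setT (-%R : R -> R) by exact: oppr_measurable.
  by rewrite -[X in measurable X]setTI; exact: mN.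
pose X : {RV P >-> R} := HB.pack F (isMeasurableFun.Build _ _ _ _ F nF.1).
pose Z : {RV P >-> R} := HB.pack (fun w => - F w)
  (isMeasurableFun.Build _ _ _ _ (fun w => - F w) nN.1).
have mZ := normal_law_moments s0 nN.
have : mean P F = mean P (fun w => - F w).
  rewrite /mean /Rintegral; congr fine.
  have iX : P.-integrable setT ((fun x : R => x%:E) \o X) by exact: moments_integrable mF.
  have iZ : P.-integrable setT ((fun x : R => x%:E) \o Z) by exact: moments_integrable mZ.
  rewrite -[LHS](integral_distribution _ iX); last exact: EFin_measurable.
  rewrite -[RHS](integral_distribution _ iZ); last exact: EFin_measurable.
  apply: eq_measure_integral => A mA _.
  exact: etrans (nF.2 A mA) (esym (nN.2 A mA)).
rewrite (@eq_mean _ _ _ _ (fun w => - F w) (fun w => -1 * F w)); last first.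
  by move=> w; rewrite mulN1r.
rewrite meanZ//; lra.
Qed.

Lemma normal_lawD F G s t : 0 < s -> 0 < t -> indep_pair P F G ->
  normal_law F 0 s -> normal_law G 0 t ->
  normal_law (fun w => F w + G w) 0 (Num.sqrt (s ^+ 2 + t ^+ 2)).
Proof.
move=> s0 t0 iFG nF nG; have [mF FE] := nF; have [mG GE] := nG.
split=> [|B mB]; first exact: measurable_funD.
pose X : {RV P >-> R} := HB.pack F (isMeasurableFun.Build _ _ _ _ F mF).
pose Z : {RV P >-> R} := HB.pack G (isMeasurableFun.Build _ _ _ _ G mG).
pose f (z : R * R) := (\1_B (z.1 + z.2) : R)%:E.
have madd : measurable_fun setT (fun z : R * R => z.1 + z.2).
  by apply: measurable_funD; [exact: measurable_fst|exact: measurable_snd].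
have mf : measurable_fun setT f.
  apply/measurable_EFinP; apply: (measurableT_comp _ madd).
  exact: measurable_indic.
have f0 z : (0 <= f z)%E by rewrite lee_fin.
transitivity (\int[P]_w f (X w, Z w))%E.
  rewrite -[X in P X]setIT -integral_indic//.
  by rewrite -[X in measurable X]setTI; exact: measurable_funD.
rewrite (@ge0_integral_joint _ _ _ P X Z iFG f)//.
rewrite (fubini_tonelli1 _ mf f0) -normal_prob_conv//.
transitivity (\int[distribution P X]_x normal_prob x t B)%E; last first.
  by apply: ge0_eq_measure_integralR => //; exact: measurable_normal_prob_mean.
apply: eq_integral => x _; rewrite /fubini_F.
have mBx : measurable (affine 1 x @^-1` B).
  by rewrite -[X in measurable X]setTI; exact: measurable_affine.
have <- : (\int[distribution P Z]_y (\1_(affine 1 x @^-1` B) y)%:E)%E =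
     normal_prob x t B.
  rewrite integral_indic// setIT.
  change (P (G @^-1` (affine 1 x @^-1` B)) = normal_prob x t B).
  rewrite (GE _ mBx) (normal_prob_affine _ _ ltr01 t0 mB).
  by rewrite mulr0 add0r mul1r.
apply: eq_integral => y _; rewrite /f !indicE; congr (_%:R)%:E.
by congr nat_of_bool; apply/idP/idP; rewrite !inE/= /affine mul1r addrC.
Qed.

(** Induction on the sum: the partial sum and the next variable depend on disjoint
    sets of indices. *)
Lemma normal_law_sum (I : finType) (Y : I -> {RV P >-> R}) (s : R) (J : seq I) :
  0 < s -> mutually_independent Y -> (forall i, normal_law (Y i) 0 s) ->
  uniq J -> (0 < size J)%N ->
  normal_law (fun w => \sum_(i <- J) Y i w) 0 (Num.sqrt (size J)%:R * s).
Proof.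
move=> s0 indY nY; elim: J => // i J IH /= /andP[iJ uJ] _.
have -> : (fun w => \sum_(j <- i :: J) Y j w) =
    (fun w => Y i w + \sum_(j <- J) Y j w).
  by apply/funext => w; rewrite big_cons.
case: (posnP (size J)) => [/size0nil J0|J0].
  rewrite J0 sqrtr1 mul1r.
  by rewrite (_ : (fun w => _) = Y i)//; apply/funext => w; rewrite big_nil addr0.
have {}IH := IH uJ J0.
have b i' : block Y [set i']%SET (Y i').
  split; first by apply: depends_on_var; rewrite inE.
  exact: normal_law_moments s0 (nY i').
have bJ : block Y [set j in J]%SET (fun w => \sum_(j <- J) Y j w).
  apply: block_sum => j jJ; apply: block_sub (b j).
  by rewrite finset.sub1set inE.
have dJ : [disjoint [set i]%SET & [set j in J]%SET]%B.
  rewrite disjoint_subset; apply/fintype.subsetP => j; rewrite !inE => /eqP ->.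
  by rewrite iJ.
have ind := depends_on_indep indY dJ (b i).1 bJ.1.
have t0 : 0 < Num.sqrt (size J)%:R * s by rewrite mulr_gt0// sqrtr_gt0 ltr0n.
have <- : Num.sqrt (s ^+ 2 + (Num.sqrt (size J)%:R * s) ^+ 2) =
    Num.sqrt (size J).+1%:R * s.
  rewrite exprMn sqr_sqrtr ?ler0n// -[X in X + _]mul1r -mulrDl.
  by rewrite sqrtrM ?addr_ge0// sqrtr_sqr gtr0_norm// addrC natr1.
exact: normal_lawD s0 t0 ind (nY i) IH.
Qed.

End normal_random_variables.

(** * Moments of the noise *)

Section finite_sums.
Context {d : measure_display} {T : measurableType d} {R : realType}
  (P : probability T R) {I : finType} (Y : I -> {RV P >-> R}).
Hypothesis indY : mutually_independent Y.
Context {J : finType} (A : J -> {set I}) (xi : J -> T -> R).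
Hypothesis disjA : forall j k, j != k -> [disjoint A j & A k]%B.
Hypothesis blk : forall j, block Y (A j) (xi j).

Let sumE (D : {pred J}) w : \sum_(j in D) xi j w = \sum_(j <- enum D) xi j w.
Proof. by rewrite big_enum. Qed.

Section centered.
Hypothesis mean0 : forall j, mean P (xi j) = 0.
Variables v m : R.
Hypothesis v2m : v ^+ 2 <= m.

Lemma mean_sqr_fin_sumE (D : {pred J}) :
  (forall j, mean P (fun w => xi j w ^+ 2) = v) ->
  mean P (fun w => (\sum_(j in D) xi j w) ^+ 2) = #|D|%:R * v.
Proof.
move=> h; rewrite (@eq_mean _ _ _ _ _ (fun w => (\sum_(j <- enum D) xi j w) ^+ 2)).
  rewrite (mean_sqr_sum indY disjA blk mean0) ?enum_uniq// (eq_bigr (fun=> v))//.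
  by rewrite big_const_seq count_predT -cardE iter_addr_0 mulr_natl.
by move=> w; rewrite sumE.
Qed.

Lemma mean_sqr_fin_sum_le (D : {pred J}) :
  (forall j, mean P (fun w => xi j w ^+ 2) <= v) ->
  mean P (fun w => (\sum_(j in D) xi j w) ^+ 2) <= #|D|%:R * v.
Proof.
move=> h; rewrite (@eq_mean _ _ _ _ _ (fun w => (\sum_(j <- enum D) xi j w) ^+ 2)).
  rewrite cardE; apply: (mean_sqr_sum_le indY disjA blk mean0) => //.
  exact: enum_uniq.
by move=> w; rewrite sumE.
Qed.

Lemma mean_pow4_fin_sum_le (D : {pred J}) :
  (forall j, mean P (fun w => xi j w ^+ 2) <= v) ->
  (forall j, mean P (fun w => xi j w ^+ 4) <= m) ->
  mean P (fun w => (\sum_(j in D) xi j w) ^+ 4) <= 3 * m * #|D|%:R ^+ 2.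
Proof.
move=> h2 h4; rewrite (@eq_mean _ _ _ _ _ (fun w => (\sum_(j <- enum D) xi j w) ^+ 4)).
  rewrite cardE; apply: (mean_pow4_sum_le indY disjA blk mean0 v2m) => //.
  exact: enum_uniq.
by move=> w; rewrite sumE.
Qed.

End centered.
End finite_sums.

Section sum_of_squares.
Context {d : measure_display} {T : measurableType d} {R : realType}
  (P : probability T R) {I : finType} (Y : I -> {RV P >-> R}).
Hypothesis indY : mutually_independent Y.
Context {J : finType} (A : J -> {set I}) (S : J -> T -> R) (v m : R).
Hypothesis disjA : forall j k, j != k -> [disjoint A j & A k]%B.
Hypothesis blk : forall j, block Y (A j) (S j).
Hypothesis mean2 : forall j, mean P (fun w => S j w ^+ 2) = v.
Hypothesis mean4 : forall j, mean P (fun w => S j w ^+ 4) <= m.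

(** The centered squares S_j^2 - v are independent. *)
Lemma variance_sum_sqr :
  mean P (fun w => (\sum_j S j w ^+ 2 - #|J|%:R * v) ^+ 2) <= #|J|%:R * m.
Proof.
pose xi j w := S j w ^+ 2 - v.
have bxi j : block Y (A j) (xi j).
  by apply: blockB; [exact: blockX|exact: block_cst].
rewrite (@eq_mean _ _ _ _ _ (fun w => (\sum_(j in J) xi j w) ^+ 2)); last first.
  move=> w; rewrite /xi big_split/= sumrN.
  by rewrite sumr_const mulr_natl.
have mS k j : moments P (fun w => S j w ^+ k).
  exact: block_moments (blockX k (blk j)).
have mc c : moments P (fun=> c : R) by exact: moments_cst.
have z j : mean P (xi j) = 0 by rewrite /xi meanD ?mean_cst ?mean2 ?subrr.
apply: (mean_sqr_fin_sum_le indY disjA bxi z) => j.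
apply: le_trans (mean4 j).
rewrite (@eq_mean _ _ _ _ _ (fun w => S j w ^+ 4 + (- (2 * v) * S j w ^+ 2 + v ^+ 2))).
  rewrite meanD//; last by apply: momentsD => //; exact: momentsZ.
  rewrite meanD//; last exact: momentsZ.
  rewrite meanZ// mean_cst mean2 gerDl.
  by have := sqr_ge0 v; lra.
by move=> w; rewrite /xi; ring.
Qed.

End sum_of_squares.

Definition noise {T I J : Type} {R : Type} (Y : I * J -> T -> R) (w : T) i j : R :=
  Y (i, j) w.

Section noise_moments.
Context {d : measure_display} {T : measurableType d} {R : realType}
  (P : probability T R) {p n : nat} (Y : 'I_p * 'I_n -> {RV P >-> R}).
Variables s2 m4 m8 : R.
Hypothesis indY : mutually_independent Y.
Hypothesis momY : forall x, moments P (Y x).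
Hypothesis Y1 : forall x, mean P (Y x) = 0.
Hypothesis Y2 : forall x, mean P (fun w => Y x w ^+ 2) = s2.
Hypothesis Y4 : forall x, mean P (fun w => Y x w ^+ 4) <= m4.
Hypothesis Y8 : forall x, mean P (fun w => Y x w ^+ 8) <= m8.
Hypothesis s2_ge0 : 0 <= s2.
Hypothesis s2m4 : s2 ^+ 2 <= m4.
Hypotheses (p_gt0 : (0 < p)%N) (n_gt0 : (0 < n)%N).

Local Notation y := (noise (fun x => Y x : T -> R)).

Let pR : 0 < p%:R :> R. Proof. by rewrite ltr0n. Qed.
Let nR : 0 < n%:R :> R. Proof. by rewrite ltr0n. Qed.
Let m4_ge0 : 0 <= m4. Proof. exact: le_trans (sqr_ge0 _) s2m4. Qed.

Let Y2_le x : mean P (fun w => Y x w ^+ 2) <= s2.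
Proof. by rewrite Y2. Qed.

Let blkY x : block Y [set x]%SET (Y x).
Proof. by split; [apply: depends_on_var; rewrite inE|exact: momY]. Qed.

Let blk (B : {set 'I_p * 'I_n}) i j : (i, j) \in B -> block Y B (fun w => y w i j).
Proof. by move=> ijB; apply: block_sub (blkY (i, j)); rewrite finset.sub1set. Qed.

Let rowset (i : 'I_p) : {set 'I_p * 'I_n} := [set x | x.1 == i]%SET.
Let colset (j : 'I_n) : {set 'I_p * 'I_n} := [set x | x.2 == j]%SET.

Let disj1 (x x' : 'I_p * 'I_n) : x != x' -> [disjoint [set x]%SET & [set x']%SET]%B.
Proof.
move=> xx'; rewrite disjoint_subset; apply/fintype.subsetP => z.
by rewrite !inE => /eqP ->.
Qed.

Let disj_row i i' : i != i' -> [disjoint rowset i & rowset i']%B.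
Proof.
move=> ii'; rewrite disjoint_subset; apply/fintype.subsetP => z.
by rewrite !inE => /eqP ->.
Qed.

Let disj_col j j' : j != j' -> [disjoint colset j & colset j']%B.
Proof.
move=> jj'; rewrite disjoint_subset; apply/fintype.subsetP => z.
by rewrite !inE => /eqP ->.
Qed.

Let blk_row i : block Y (rowset i) (fun w => row_tot (y w) i).
Proof. by apply: block_sum => j _; apply: blk; rewrite inE. Qed.

Let blk_col j : block Y (colset j) (fun w => col_tot (y w) j).
Proof. by apply: block_sum => i _; apply: blk; rewrite inE. Qed.

Lemma mean_shift_sqr : mean P (fun w => mean_shift (y w) ^+ 2) = s2 * (p%:R / n%:R).
Proof.
rewrite (@eq_mean _ _ _ _ _ (fun w => n%:R ^- 2 * (\sum_(x in {: 'I_p * 'I_n}) Y x w) ^+ 2)).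
  rewrite meanZ; last by apply: momentsX; apply: moments_sum.
  rewrite (@mean_sqr_fin_sumE _ _ _ P _ Y indY _ (fun x => [set x]%SET) (fun x => Y x)
    disj1 blkY Y1 s2)//.
  by rewrite card_prod !card_ord natrM; field; rewrite gt_eqF.
move=> w; rewrite /mean_shift /grand_tot /noise exprMn exprVn; congr (_ * _ ^+ 2).
by rewrite pair_bigA/=; apply: eq_bigr => -[].
Qed.

Lemma moments_mean_shift : moments P (fun w => mean_shift (y w)).
Proof.
apply: momentsZ; do 2!(apply: moments_sum => ?); exact: momY.
Qed.

Let row_line i : [/\ mean P (fun w => row_tot (y w) i ^+ 2) = n%:R * s2 &
   mean P (fun w => row_tot (y w) i ^+ 4) <= 3 * m4 * n%:R ^+ 2].
Proof.
pose A j : {set 'I_p * 'I_n} := [set (i, j)]%SET.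
have dA j k : j != k -> [disjoint A j & A k]%B.
  by move=> jk; apply: disj1; apply: contra_neq jk => -[].
have bA j : block Y (A j) (fun w => y w i j) by exact: blkY.
split.
  have := mean_sqr_fin_sumE indY dA bA (fun=> Y1 _) predT (fun=> Y2 _).
  by rewrite card_ord.
have := mean_pow4_fin_sum_le indY dA bA (fun=> Y1 _) s2m4 predT
  (fun=> Y2_le _) (fun=> Y4 _).
by rewrite card_ord.
Qed.

Let col_line j : [/\ mean P (fun w => col_tot (y w) j ^+ 2) = p%:R * s2 &
   mean P (fun w => col_tot (y w) j ^+ 4) <= 3 * m4 * p%:R ^+ 2].
Proof.
pose A i : {set 'I_p * 'I_n} := [set (i, j)]%SET.
have dA i k : i != k -> [disjoint A i & A k]%B.
  by move=> jk; apply: disj1; apply: contra_neq jk => -[].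
have bA i : block Y (A i) (fun w => y w i j) by exact: blkY.
split.
  have := mean_sqr_fin_sumE indY dA bA (fun=> Y1 _) predT (fun=> Y2 _).
  by rewrite card_ord.
have := mean_pow4_fin_sum_le indY dA bA (fun=> Y1 _) s2m4 predT
  (fun=> Y2_le _) (fun=> Y4 _).
by rewrite card_ord.
Qed.

Lemma moments_row_energy : moments P (fun w => row_energy (y w)).
Proof.
apply: momentsZ; apply: moments_sum => i; apply: momentsX.
exact: block_moments (blk_row i).
Qed.

Lemma row_energy_variance :
  mean P (fun w => (row_energy (y w) - s2 * (p%:R / n%:R)) ^+ 2) <=
  3 * m4 * (p%:R / n%:R ^+ 2).
Proof.
have vs := variance_sum_sqr indY disj_row blk_row (fun i => (row_line i).1)
   (fun i => (row_line i).2).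
rewrite (@eq_mean _ _ _ _ _ (fun w => n%:R ^- 4 *
   (\sum_i row_tot (y w) i ^+ 2 - #|'I_p|%:R * (n%:R * s2)) ^+ 2)); last first.
  by move=> w; rewrite card_ord /row_energy; field; rewrite gt_eqF.
rewrite meanZ; last first.
  apply: momentsX; apply: momentsB; last exact: moments_cst.
  by apply: moments_sum => i; apply: momentsX; exact: block_moments (blk_row i).
have n4 : 0 <= (n%:R ^- 4 : R) by rewrite invr_ge0 exprn_ge0// ltW.
apply: le_trans (ler_wpM2l n4 vs) _; rewrite card_ord le_eqVlt; apply/orP; left.
by apply/eqP; field; rewrite gt_eqF.
Qed.

Lemma moments_col_energy : moments P (fun w => col_energy (y w)).
Proof.
apply: momentsZ; apply: moments_sum => i; apply: momentsX.
exact: block_moments (blk_col i).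
Qed.

Lemma col_energy_variance :
  mean P (fun w => (col_energy (y w) - s2) ^+ 2) <= 3 * m4 / n%:R.
Proof.
have vs := variance_sum_sqr indY disj_col blk_col (fun i => (col_line i).1)
   (fun i => (col_line i).2).
rewrite (@eq_mean _ _ _ _ _ (fun w => (n%:R * p%:R) ^- 2 *
   (\sum_i col_tot (y w) i ^+ 2 - #|'I_n|%:R * (p%:R * s2)) ^+ 2)); last first.
  by move=> w; rewrite card_ord /col_energy; field; rewrite !gt_eqF.
rewrite meanZ; last first.
  apply: momentsX; apply: momentsB; last exact: moments_cst.
  by apply: moments_sum => i; apply: momentsX; exact: block_moments (blk_col i).
have n4 : 0 <= ((n%:R * p%:R) ^- 2 : R) by rewrite invr_ge0 exprn_ge0// mulr_ge0.
apply: le_trans (ler_wpM2l n4 vs) _; rewrite card_ord le_eqVlt; apply/orP; left.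
by apply/eqP; field; rewrite !gt_eqF.
Qed.

Let sqr_add_le (a b : R) : (a + b) ^+ 2 <= 2 * a ^+ 2 + 2 * b ^+ 2.
Proof. by have := sqr_ge0 (a - b); lra. Qed.

(** Squaring k times and using Cauchy-Schwarz at each step. *)
Let gram_diag i (k : nat) w : gram (y w) i i ^+ (2 ^ k) <=
   n%:R ^+ (2 ^ k - 1) * \sum_j y w i j ^+ (2 * 2 ^ k).
Proof.
have gE : gram (y w) i i = \sum_j y w i j ^+ 2 by apply: eq_bigr => j _; rewrite expr2.
elim: k => [|k IH].
  by rewrite !expn0 expr1 subnn expr0 mul1r gE.
rewrite expnSr exprM; apply: le_trans (_ : (n%:R ^+ (2 ^ k - 1) *
    \sum_j y w i j ^+ (2 * 2 ^ k)) ^+ 2 <= _).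
  rewrite lerXn2r ?nnegrE//.
    by rewrite exprn_ge0// gE sumr_ge0// => j _; exact: sqr_ge0.
  rewrite mulr_ge0 ?exprn_ge0// sumr_ge0// => j _.
  by rewrite exprM exprn_ge0// sqr_ge0.
rewrite exprMn; apply: le_trans (ler_wpM2l _ (sqr_sum_le _)) _.
  by rewrite exprn_ge0// exprn_ge0.
rewrite card_ord mulrA -exprM -exprSr.
have -> : ((2 ^ k - 1) * 2).+1 = (2 ^ k * 2 - 1)%N.
  have : (0 < 2 ^ k)%N by rewrite expn_gt0.
  by case: (2 ^ k)%N => // m _; rewrite !subn1.
by under eq_bigr do rewrite -exprM -mulnA.
Qed.

(** In the i-th entry of Y Y^T 1, the products of y_ij with itself are kept apart:
    they sum to n times a variable bounded in mean square, while the products of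
    y_ij with the other entries of column j are centered and independent over j. *)
Lemma cross_energy_mean :
  mean P (fun w => cross_energy (y w)) <= 2 * m4 + 2 * s2 ^+ 2 * (p%:R / n%:R).
Proof.
have cross_le i : mean P (fun w => cross (y w) i ^+ 2) <=
   2 * (n%:R ^+ 2 * m4) + 2 * (n%:R * (p%:R * s2 ^+ 2)).
  pose rest w j := \sum_(k in [pred k | k != i]) y w k j.
  have crossE w : cross (y w) i = gram (y w) i i + \sum_(j in 'I_n) y w i j * rest w j.
    rewrite /cross /gram -big_split/=; apply: eq_bigr => j _.
    rewrite /col_tot (bigD1 i)//= mulrDr; congr (_ + _ * _).
  pose B (j : 'I_n) : {set 'I_p * 'I_n} := (colset j :\ (i, j))%SET.
  have brest j : block Y (B j) (fun w => rest w j).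
    rewrite /rest; under eq_fun do rewrite -big_enum.
    apply: block_sum => k; rewrite mem_enum inE => ki; apply: blk.
    by rewrite !inE xpair_eqE eqxx !andbT; exact: ki.
  have bij j : block Y [set (i, j)]%SET (fun w => y w i j) by exact: blkY.
  have dj j : [disjoint [set (i, j)]%SET & B j]%B.
    rewrite disjoint_subset; apply/fintype.subsetP => z.
    by rewrite !inE => /eqP ->; rewrite eqxx.
  have bcol j : block Y (colset j) (fun w => y w i j * rest w j).
    apply: blockM; first by apply: blk; rewrite inE.
    by apply: block_sub (brest j); exact: finset.subsetDl.
  have rest2 j : mean P (fun w => rest w j ^+ 2) <= p%:R * s2.
    pose A k : {set 'I_p * 'I_n} := [set (k, j)]%SET.
    have dA k l : k != l -> [disjoint A k & A l]%B.
      by move=> jk; apply: disj1; apply: contra_neq jk => -[].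
    have bA k : block Y (A k) (fun w => y w k j) by exact: blkY.
    have := mean_sqr_fin_sum_le indY dA bA (fun=> Y1 _) [pred k | k != i]
      (fun=> Y2_le _).
    move=> /le_trans; apply; rewrite ler_wpM2r// ler_nat -[leqRHS]card_ord.
    exact: max_card.
  have sum2 : mean P (fun w => (\sum_(j in 'I_n) y w i j * rest w j) ^+ 2) <=
      n%:R * (p%:R * s2 ^+ 2).
    have z j : mean P (fun w => y w i j * rest w j) = 0.
      by rewrite (mean_indep indY (dj j) (bij j) (brest j)) Y1 mul0r.
    have h2 j : mean P (fun w => (y w i j * rest w j) ^+ 2) <= p%:R * s2 ^+ 2.
      rewrite (@eq_mean _ _ _ _ _ (fun w => y w i j ^+ 2 * rest w j ^+ 2)).
        rewrite (mean_indep indY (dj j) (blockX 2 (bij j)) (blockX 2 (brest j))) Y2.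
        by rewrite expr2 mulrCA ler_wpM2l.
      by move=> w; rewrite exprMn.
    have := mean_sqr_fin_sum_le indY disj_col bcol z predT h2.
    by rewrite card_ord.
  have mg : moments P (fun w => gram (y w) i i).
    by apply: moments_sum => j; apply: momentsM; exact: momY.
  have ms : moments P (fun w => \sum_(j in 'I_n) y w i j * rest w j).
    by apply: moments_sum => j; exact: block_moments (bcol j).
  have my k j : moments P (fun w => y w i j ^+ k) by apply: momentsX; exact: momY.
  have g2 : mean P (fun w => gram (y w) i i ^+ 2) <= n%:R ^+ 2 * m4.
    apply: (@le_trans _ _ (mean P (fun w => n%:R * \sum_j y w i j ^+ 4))).
      apply: le_mean; first exact: momentsX.
        by apply: momentsZ; exact: moments_sum.
      by move=> w; exact: (gram_diag i 1 w).
    rewrite meanZ ?mean_sum//; last exact: moments_sum.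
    rewrite expr2 -mulrA ler_wpM2l// -[X in X%:R * _](card_ord n) -sum1_card natr_sum.
    by rewrite mulr_suml ler_sum// => j _; rewrite mul1r; exact: Y4.
  apply: le_trans (_ : 2 * mean P (fun w => gram (y w) i i ^+ 2) +
     2 * mean P (fun w => (\sum_(j in 'I_n) y w i j * rest w j) ^+ 2) <= _); last lra.
  rewrite -!meanZ -?meanD; try by repeat first [apply: momentsD | apply: momentsZ | apply: momentsX].
  apply: le_mean; try by repeat first [apply: momentsD | apply: momentsZ | apply: momentsX].
    under eq_fun do rewrite crossE.
    by repeat first [apply: momentsD | apply: momentsZ | apply: momentsX].
  by move=> w; rewrite crossE; exact: sqr_add_le.
have mcr i : moments P (fun w => cross (y w) i ^+ 2).
  apply: momentsX; apply: moments_sum => j; apply: momentsM; first exact: momY.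
  exact: block_moments (blk_col j).
rewrite /cross_energy meanZ; last by apply: momentsZ; exact: moments_sum.
rewrite meanZ; last exact: moments_sum.
rewrite mean_sum// ler_pdivrMl// ler_pdivrMl ?exprn_gt0//.
apply: le_trans (ler_sum _ (fun i _ => cross_le i)) _.
rewrite sumr_const card_ord -mulr_natl le_eqVlt; apply/orP; left; apply/eqP.
by field; rewrite gt_eqF.
Qed.

Lemma moments_cross_energy : moments P (fun w => cross_energy (y w)).
Proof.
apply: momentsZ; apply: momentsZ; apply: moments_sum => i; apply: momentsX.
apply: moments_sum => j; apply: momentsM; first exact: momY.
exact: block_moments (blk_col j).
Qed.

(** In mean square, G_ik = (gram_ik / n)^2 is of order 1 / n off the diagonal and
    of order 1 on it; N_ik dominates both cases. *)
Let kappa : R := 2 * m4 + m8 + 1.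
Let G (x : 'I_p * 'I_p) w : R := n%:R ^- 2 * gram (y w) x.1 x.2 ^+ 2.
Let N (x : 'I_p * 'I_p) : R := kappa * (n%:R^-1 + (x.1 == x.2)%:R).
Let c : R := kappa * (p%:R / n%:R + 1).

Let m8_ge0 : 0 <= m8.
Proof.
apply: le_trans (Y8 (Ordinal p_gt0, Ordinal n_gt0)).
by apply: mean_ge0 => w; rewrite (exprM _ 2 4) exprn_ge0 ?sqr_ge0.
Qed.

Let kappa_gt0 : 0 < kappa.
Proof. by rewrite ltr_wpDl// addr_ge0// mulr_ge0. Qed.

Let N_gt0 x : 0 < N x.
Proof. by rewrite mulr_gt0// ltr_wpDr// invr_gt0. Qed.

Let blk_gram i k : block Y (rowset i :|: rowset k)%SET (fun w => gram (y w) i k).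
Proof.
by apply: block_sum => j _; apply: blockM; apply: blk; rewrite !inE eqxx ?orbT.
Qed.

Let blk_G x : block Y (rowset x.1 :|: rowset x.2)%SET (G x).
Proof. by apply: blockM; [exact: block_cst|apply: blockX; exact: blk_gram]. Qed.

Let mG x : moments P (G x). Proof. exact: block_moments (blk_G x). Qed.

Let gram_pow4_off i k : i != k ->
  mean P (fun w => gram (y w) i k ^+ 4) <= 3 * m4 ^+ 2 * n%:R ^+ 2.
Proof.
move=> ik.
pose S l j : {set 'I_p * 'I_n} := [set (l, j)]%SET.
have dj j : [disjoint S i j & S k j]%B.
  by apply: disj1; apply: contra_neq ik => -[].
have bj j : block Y (colset j) (fun w => y w i j * y w k j).
  by apply: blockM; apply: blk; rewrite inE.
have b1 j : block Y (S i j) (fun w => y w i j) by exact: blkY.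
have b2 j : block Y (S k j) (fun w => y w k j) by exact: blkY.
have z j : mean P (fun w => y w i j * y w k j) = 0.
  by rewrite (mean_indep indY (dj j) (b1 j) (b2 j)) Y1 mul0r.
have h2 j : mean P (fun w => (y w i j * y w k j) ^+ 2) <= s2 ^+ 2.
  rewrite (@eq_mean _ _ _ _ _ (fun w => y w i j ^+ 2 * y w k j ^+ 2)).
    by rewrite (mean_indep indY (dj j) (blockX 2 (b1 j)) (blockX 2 (b2 j))) !Y2 expr2.
  by move=> w; rewrite exprMn.
have h4 j : mean P (fun w => (y w i j * y w k j) ^+ 4) <= m4 ^+ 2.
  rewrite (@eq_mean _ _ _ _ _ (fun w => y w i j ^+ 4 * y w k j ^+ 4)).
    rewrite (mean_indep indY (dj j) (blockX 4 (b1 j)) (blockX 4 (b2 j))) expr2.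
    by apply: ler_pM; rewrite ?Y4//; apply: mean_ge0 => w;
      rewrite (exprM _ 2 2) sqr_ge0.
  by move=> w; rewrite exprMn.
have vm : (s2 ^+ 2) ^+ 2 <= m4 ^+ 2 by rewrite lerXn2r ?nnegrE// sqr_ge0.
by have := mean_pow4_fin_sum_le indY disj_col bj z vm predT h2 h4; rewrite card_ord.
Qed.

Let gram_pow4_diag i : mean P (fun w => gram (y w) i i ^+ 4) <= n%:R ^+ 4 * m8.
Proof.
have my j : moments P (fun w => y w i j ^+ 8) by apply: momentsX; exact: momY.
apply: (@le_trans _ _ (mean P (fun w => n%:R ^+ 3 * \sum_j y w i j ^+ 8))).
  apply: le_mean; first by apply: momentsX; exact: block_moments (blk_gram i i).
    by apply: momentsZ; exact: moments_sum.
  by move=> w; exact: (gram_diag i 2 w).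
rewrite meanZ ?mean_sum//; last exact: moments_sum.
rewrite (exprSr _ 3) -[leRHS]mulrA ler_wpM2l ?exprn_ge0//.
rewrite -[X in X%:R * _](card_ord n) -sum1_card natr_sum.
by rewrite mulr_suml ler_sum// => j _; rewrite mul1r; exact: Y8.
Qed.

Let mean_G_sqr x : mean P (fun w => G x w ^+ 2) <= N x ^+ 2.
Proof.
case: x => i k; have mg4 : moments P (fun w => gram (y w) i k ^+ 4).
  by apply: momentsX; exact: block_moments (blk_gram i k).
rewrite (@eq_mean _ _ _ _ _ (fun w => n%:R ^- 4 * gram (y w) i k ^+ 4)); last first.
  by move=> w; rewrite /G/=; field; rewrite gt_eqF.
rewrite meanZ// ler_pdivrMl ?exprn_gt0// /N/=.
have [->|ik] := eqVneq i k; last first.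
  apply: le_trans (gram_pow4_off ik) _; rewrite addr0.
  have -> : n%:R ^+ 4 * (kappa / n%:R) ^+ 2 = kappa ^+ 2 * n%:R ^+ 2.
    by field; rewrite gt_eqF.
  rewrite ler_wpM2r ?sqr_ge0// /kappa.
  have := mulr_ge0 m4_ge0 m8_ge0; have := m4_ge0.
  by have := sqr_ge0 m4; have := sqr_ge0 (m8 + 1); lra.
apply: le_trans (gram_pow4_diag k) _; rewrite ler_wpM2l ?exprn_ge0//.
apply: (@le_trans _ _ (kappa ^+ 2)); first last.
  have n0 : 0 <= (n%:R^-1 : R) by rewrite invr_ge0.
  apply: lerXn2r; rewrite ?nnegrE; first exact: ltW.
    by apply: mulr_ge0; [exact: ltW|exact: addr_ge0].
  by apply: ler_peMr; [exact: ltW|rewrite lerDr].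
rewrite /kappa; have := mulr_ge0 m4_ge0 m8_ge0; have := m4_ge0; have := m8_ge0.
by have := sqr_ge0 m4; have := sqr_ge0 m8; lra.
Qed.

Let sumN1 i : \sum_x (i == x.1)%:R * N x = c.
Proof.
rewrite -(pair_bigA _ (fun l k => (i == l)%:R * N (l, k)))/= (bigD1 i)//=.
rewrite [X in _ + X]big1 ?addr0; last first.
  by move=> l li; rewrite big1// => k _; rewrite eq_sym (negPf li) mul0r.
under eq_bigr do rewrite eqxx mul1r.
rewrite /N -mulr_sumr big_split/= sumr_const card_ord -[_ *+ p]mulr_natl; congr (_ * (_ + _)).
by rewrite (bigD1 i)//= eqxx big1 ?addr0// => k ki; rewrite eq_sym (negPf ki).
Qed.

Let sumN2 i : \sum_x (i == x.2)%:R * N x = c.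
Proof.
rewrite -[RHS](sumN1 i) -(pair_bigA _ (fun l k => (i == k)%:R * N (l, k)))/=.
rewrite exchange_big/= -(pair_bigA _ (fun l k => (i == l)%:R * N (l, k)))/=.
by apply: eq_bigr => a _; apply: eq_bigr => b _; rewrite /N/= (eq_sym a b).
Qed.

Let sumN : \sum_x N x = p%:R * c.
Proof.
transitivity (\sum_x \sum_(i < p) (i == x.1)%:R * N x).
  apply: eq_bigr => x _; rewrite -mulr_suml (bigD1 x.1)//= eqxx big1 ?addr0 ?mul1r//.
  by move=> i /negPf ->.
rewrite exchange_big/=; under eq_bigr do rewrite sumN1.
by rewrite sumr_const card_ord mulr_natl.
Qed.

(** G_ik and G_lm are functions of the rows i, k and l, m. They are uncorrelated
    when no row is shared, and otherwise their covariance is at most N_ik N_lm;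
    the indicators count the ways of sharing a row. *)
Let cov_le x z : mean P (fun w => (G x w - mean P (G x)) * (G z w - mean P (G z))) <=
  ((x.1 == z.1)%:R + (x.1 == z.2)%:R + ((x.2 == z.1)%:R + (x.2 == z.2)%:R))
  * (N x * N z).
Proof.
have NN : 0 <= N x * N z by rewrite mulr_ge0 ?ltW.
have mc (a : R) : moments P (fun=> a) by exact: moments_cst.
have G0 v : 0 <= mean P (G v).
  by apply: mean_ge0 => w; rewrite mulr_ge0 ?sqr_ge0 ?invr_ge0 ?exprn_ge0.
have overlap : mean P (fun w => (G x w - mean P (G x)) * (G z w - mean P (G z))) <=
    N x * N z.
  rewrite (@eq_mean _ _ _ _ _ (fun w => G x w * G z w + ((- mean P (G z)) * G x w +
     ((- mean P (G x)) * G z w + mean P (G x) * mean P (G z))))); last first.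
    by move=> w; ring.
  have mxz := momentsM (mG x) (mG z).
  have a1 := momentsZ (- mean P (G z)) (mG x).
  have a2 := momentsZ (- mean P (G x)) (mG z).
  have a3 := momentsD a2 (mc (mean P (G x) * mean P (G z))).
  rewrite meanD//; last exact: momentsD.
  rewrite meanD// meanD// mean_cst (meanZ _ (mG x)) (meanZ _ (mG z)).
  have := mean_mul_le (mG x) (mG z) (N_gt0 x) (N_gt0 z) (mean_G_sqr x) (mean_G_sqr z).
  by have := mulr_ge0 (G0 x) (G0 z); lra.
have [e|/norP[/norP[h1 h2] /norP[h3 h4]]] :=
    boolP (((x.1 == z.1) || (x.1 == z.2)) || ((x.2 == z.1) || (x.2 == z.2))).
  apply: le_trans overlap _; rewrite ler_peMl//.
  have b0 (b : bool) : 0 <= b%:R :> R by exact: ler0n.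
  by move: e => /orP[/orP[]|/orP[]] -> /=;
   [rewrite -addrA lerDl|rewrite addrAC lerDr|rewrite addrCA lerDl|
    rewrite addrA lerDr]; rewrite ?addr_ge0.
have dxz : [disjoint (rowset x.1 :|: rowset x.2)%SET & (rowset z.1 :|: rowset z.2)%SET]%B.
  rewrite disjoint_subset; apply/fintype.subsetP => v.
  rewrite !inE => /orP[/eqP ->|/eqP ->].
    by rewrite (negPf h1) (negPf h2).
  by rewrite (negPf h3) (negPf h4).
have bz v : block Y (rowset v.1 :|: rowset v.2)%SET (fun w => G v w - mean P (G v)).
  by apply: blockB; [exact: blk_G|exact: block_cst].
rewrite (mean_indep indY dxz (bz x) (bz z)).
have -> : mean P (fun w => G x w - mean P (G x)) = 0.
  by rewrite meanD ?mean_cst ?subrr.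
by rewrite mul0r mulr_ge0// !addr_ge0.
Qed.

Let gram_energyE w : gram_energy (y w) = \sum_x G x w.
Proof.
rewrite /gram_energy /G -mulr_sumr; congr (_ * _).
by rewrite (pair_bigA _ (fun i k => gram (y w) i k ^+ 2)).
Qed.

Lemma moments_gram_energy : moments P (fun w => gram_energy (y w)).
Proof. by under eq_fun do rewrite gram_energyE; exact: moments_sum. Qed.

Lemma gram_energy_mean :
  mean P (fun w => gram_energy (y w)) <= p%:R * ((2 * m4 + m8 + 1) * (p%:R / n%:R + 1)).
Proof.
rewrite (eq_mean _ gram_energyE) mean_sum// -/kappa -/c -sumN.
by apply: ler_sum => x _; apply: mean_le_sqrt => //; exact: ltW.
Qed.

(** Summing the covariance bound: each way of sharing a row contributes
    \sum_i (\sum_k N_ik)^2, which is O(p) because \sum_k N_ik = O(1). *)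
Lemma gram_energy_variance :
  mean P (fun w => (gram_energy (y w) - mean P (fun w => gram_energy (y w))) ^+ 2) <=
  4 * p%:R * ((2 * m4 + m8 + 1) * (p%:R / n%:R + 1)) ^+ 2.
Proof.
rewrite (eq_mean _ gram_energyE) mean_sum// -/kappa -/c.
pose D x w := G x w - mean P (G x).
have mD x : moments P (D x) by apply: momentsB => //; exact: moments_cst.
rewrite (@eq_mean _ _ _ _ _ (fun w => \sum_x \sum_z D x w * D z w)); last first.
  move=> w; rewrite gram_energyE -sumrB expr2 mulr_suml.
  by apply: eq_bigr => x _; rewrite mulr_sumr.
rewrite mean_sum; last by move=> x; apply: moments_sum => z; exact: momentsM.
under eq_bigr => x _.
  rewrite mean_sum; last by move=> z; exact: momentsM.
  over.
apply: le_trans (ler_sum _ (fun x _ => ler_sum _ (fun z _ => cov_le x z))) _.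
have half (f g : 'I_p * 'I_p -> 'I_p) :
    (forall i, \sum_z (i == g z)%:R * N z = c) ->
    \sum_x \sum_z (f x == g z)%:R * (N x * N z) = p%:R * c * c.
  move=> gc; transitivity (\sum_x N x * c); last by rewrite -mulr_suml sumN.
  apply: eq_bigr => x _; rewrite -(gc (f x)) mulr_sumr.
  by apply: eq_bigr => z _; rewrite mulrCA.
rewrite le_eqVlt; apply/orP; left; apply/eqP.
under eq_bigr do under eq_bigr do rewrite !mulrDl.
under eq_bigr do rewrite !big_split/=.
rewrite !big_split/= !half//; try exact: sumN1; try exact: sumN2; ring.
Qed.

End noise_moments.

(** * Measurability and expansion of the largest eigenvalue *)

Lemma measurable_lambda_max_cov {d : measure_display} {T : measurableType d}
    {R : realType} (p n : nat) (X : 'I_p -> 'I_n -> T -> R) : (0 < p)%N ->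
  (forall i j, measurable_fun setT (X i j)) ->
  measurable_fun setT (fun w => lambda_max (cov_mx (sample_mx X w))).
Proof.
move=> p0 mX; pose W w := cov_mx (sample_mx X w).
have Ws w : (W w)^T = W w by exact: cov_mx_sym.
have mW i j : measurable_fun setT (fun w => W w i j).
  rewrite /W /cov_mx /sample_mx.
  have -> : (fun w => W w i j) = fun w => n%:R^-1 * \sum_k (X i k w * X j k w).
    apply/funext => w; rewrite mxE mxE; congr (_ * _); apply: eq_bigr => k _.
    by rewrite !mxE.
  apply: measurable_funM => //; apply: measurable_sum => k.
  exact: measurable_funM.
pose E t (q : 'rV[rat]_p) := [set w |
  t * sqn (map_mx ratr q) < bil (W w) (map_mx ratr q) (map_mx ratr q)].
have mE t q : measurable (E t q).
  apply: measurable_gt; under eq_fun do rewrite bilE.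
  apply: measurable_sum => i; apply: measurable_sum => j.
  by apply: measurable_funM => //; exact: measurable_funM.
apply: (measurability (@RGenOInfty.G R)) => [|_ [_ [t ->] <-]].
  exact: RGenOInfty.measurableE.
rewrite setTI.
have -> : (fun w => lambda_max (W w)) @^-1` `]t, +oo[%classic =
    \bigcup_k (if unpickle k is Some q then E t q else set0).
  apply/seteqP; split=> w /=; rewrite in_itv/= andbT.
    rewrite ltNge => /negP lt; apply: contrapT => h; apply: lt.
    apply/(lambda_max_le_rat _ (Ws w) p0) => q; rewrite leNgt; apply/negP => qt.
    by apply: h; exists (pickle q) => //; rewrite pickleK.
  move=> [k _]; case: (unpickle k) => // q; rewrite /E/= ltNge.
  move=> /negP h; rewrite ltNge; apply/negP => le; apply: h.
  by move: q; apply/(lambda_max_le_rat _ (Ws w) p0).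
by apply: bigcupT_measurable => k; case: (unpickle k).
Qed.

Section combination.
Context {R : realType}.
Variables (p n mu s2 c D : R).
Hypotheses (mu0 : 0 < mu) (s2_ge0 : 0 <= s2) (c0 : 0 < c) (D1 : 1 <= D).

Definition row_energy_bound : R := 2 * c * s2 + 1.
Definition residual_const : R := 2 * mu * (row_energy_bound + 1) + 3 + 2 * mu ^+ 2.
Definition sqn_residual_const : R := mu ^+ 2 * row_energy_bound + residual_const.
Definition ratio_const : R := 2 * (residual_const + row_energy_bound * (2 * mu + s2 + 1)) / mu ^+ 2.
Definition expansion_const : R := 8 * sqn_residual_const * D / mu ^+ 4 + ratio_const + 1.

Let row_energy_bound_ge1 : 1 <= row_energy_bound.
Proof. by rewrite /row_energy_bound lerDr mulr_ge0// mulr_ge0// ltW. Qed.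

Let residual_const_ge0 : 0 <= residual_const.
Proof. by have := row_energy_bound_ge1; have := mu0; rewrite /residual_const; nra. Qed.

Let sqn_residual_const_ge0 : 0 <= sqn_residual_const.
Proof. by rewrite addr_ge0// mulr_ge0 ?sqr_ge0//; have := row_energy_bound_ge1; lra. Qed.

Lemma expansion_const_gt0 : 0 < expansion_const.
Proof.
rewrite ltr_wpDl// addr_ge0//.
  apply: divr_ge0; last by rewrite exprn_ge0// ltW.
  by apply: mulr_ge0; [exact: mulr_ge0|exact: le_trans D1].
rewrite /ratio_const divr_ge0 ?sqr_ge0// mulr_ge0// addr_ge0// mulr_ge0//.
  by have := row_energy_bound_ge1; lra.
by have := mu0; have := s2_ge0; lra.
Qed.

(** Deterministic core, with r = sqrt p. The first group of bounds after
    [residual_bound]'s inequality is free of x and makes every quantity have its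
    typical size; the last group is the precision x. Under the first group the
    gap between the two perturbation bounds is O(1 / r); the precision x enters
    through |b|^2 / a - rho and through rho itself. *)
Lemma lambda_max_expansion (r x a l b2 rho q N V g : R) :
  1 <= r -> p = r ^+ 2 -> 4 <= mu * r -> 4 * D <= mu ^+ 2 * r -> 1 <= x ->
  a = p * mu ^+ 2 + 2 * mu * N + V ->
  0 <= b2 -> (0 < a -> a + b2 / a <= l) ->
  (Num.sqrt g < a -> l <= a + b2 / (a - Num.sqrt g)) ->
  `|b2 - p * mu ^+ 2 * rho| <=
    2 * Num.sqrt (p * mu ^+ 2 * rho * q) + 3 * q + 2 * mu ^+ 2 * N ^+ 2 ->
  0 <= V -> V <= s2 + 1 -> g <= D ^+ 2 * p -> 0 <= rho -> rho <= row_energy_bound ->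
  0 <= q -> q <= p -> `|N| <= r ->
  q <= x ^+ 2 -> `|N| <= x -> `|rho - s2 * (p / n)| <= x / r ->
  `|a - l + p * s2 / n| <= expansion_const * x / r.
Proof.
move=> r1 pE mur mu2r x1 aE b0 lo up bb V0 V1 gD rho0 rhoK q0 qp Nr qx Nx rx.
have r0 : 0 < r by lra.
have x0 : 0 < x by lra.
have p0 : 0 < p by rewrite pE exprn_gt0.
have mu2 : 0 < mu ^+ 2 by rewrite exprn_gt0.
have b1 := residual_const_ge0; have b2' := sqn_residual_const_ge0; have k1 := row_energy_bound_ge1.
have mu1 := mu0; have s20 := s2_ge0; have D1' := D1.
have [N1 N2] : - r <= N /\ N <= r by move: Nr; rewrite ler_norml => /andP[].
have [Nx1 Nx2] : - x <= N /\ N <= x by move: Nx; rewrite ler_norml => /andP[].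
have aLo : p * mu ^+ 2 / 2 <= a.
  have : 4 * (mu * r) <= mu * r * (mu * r) by rewrite ler_wpM2r// mulr_ge0// ltW.
  have : - (2 * mu * r) <= 2 * mu * N by nra.
  rewrite aE pE; lra.
have a0 : 0 < a by apply: lt_le_trans aLo; rewrite divr_gt0// mulr_gt0.
have sg : Num.sqrt g <= D * r.
  have Dr : 0 <= D * r by rewrite mulr_ge0 ?(ltW r0)//; exact: le_trans D1.
  by rewrite -[leRHS](ger0_norm Dr) -sqrtr_sqr exprMn -pE ler_wsqrtr.
have sg2 : Num.sqrt g <= p * mu ^+ 2 / 4.
  by apply: le_trans sg _; rewrite pE; nra.
have sg0 : 0 <= Num.sqrt g by exact: sqrtr_ge0.
set h := Num.sqrt g in sg sg2 sg0 up.
have ahLo : p * mu ^+ 2 / 4 <= a - h by lra.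
have pm4 : 0 < p * mu ^+ 2 / 4 by rewrite divr_gt0// mulr_gt0.
have ah0 : 0 < a - h by exact: lt_le_trans ahLo.
have {}lo := lo a0; have {}up : l <= a + b2 / (a - h) by apply: up; lra.
(* used with t = x for the precision, and with t = r for the size of b2 *)
have resid t : 0 <= t -> q <= t ^+ 2 -> `|N| <= t ->
    `|b2 - p * mu ^+ 2 * rho| <= residual_const * (t * r).
  move=> t0 qt Nt; apply: le_trans bb _.
  have sq : Num.sqrt (p * mu ^+ 2 * rho * q) <= mu * (row_energy_bound + 1) * (t * r).
    have e0 : 0 <= mu * (row_energy_bound + 1) * (t * r).
      by rewrite mulr_ge0// mulr_ge0//; lra.
    rewrite -[leRHS]ger0_norm// -sqrtr_sqr ler_wsqrtr//.
    have -> : (mu * (row_energy_bound + 1) * (t * r)) ^+ 2 = p * mu ^+ 2 * ((row_energy_bound + 1) ^+ 2 * t ^+ 2).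
      by rewrite pE; ring.
    rewrite -mulrA ler_pM2l ?mulr_gt0//; apply: ler_pM => //.
    by apply: le_trans rhoK _; nra.
  have qtr : q <= t * r.
    have : q ^+ 2 <= (t * r) ^+ 2.
      by rewrite exprMn -pE expr2; apply: ler_pM.
    by rewrite ler_pXn2r ?nnegrE ?mulr_ge0// ltW.
  have Ntr : N ^+ 2 <= t * r.
    by rewrite -real_normK ?num_real// expr2; apply: ler_pM.
  have := ler_wpM2l (ltW mu2) Ntr; rewrite /residual_const; lra.
have resx := resid x (ltW x0) qx Nx.
have b2p : b2 <= sqn_residual_const * p.
  have : `|b2 - p * mu ^+ 2 * rho| <= residual_const * (r * r).
    by apply: resid => //; rewrite ?(ltW r0)// -pE.
  rewrite ler_norml => /andP[_]; rewrite -expr2 -pE => h1.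
  have : p * mu ^+ 2 * rho <= p * mu ^+ 2 * row_energy_bound by rewrite ler_pM2l// mulr_gt0.
  rewrite /sqn_residual_const; lra.
have d1 : l - a - b2 / a <= 8 * sqn_residual_const * D / mu ^+ 4 * (x / r).
  have e1 : l - a - b2 / a <= b2 * h / (a * (a - h)).
    have -> : b2 * h / (a * (a - h)) = b2 / (a - h) - b2 / a.
      by field; rewrite !gt_eqF.
    lra.
  apply: le_trans e1 _; rewrite ler_pdivrMr ?mulr_gt0//.
  apply: (@le_trans _ _ (sqn_residual_const * p * (D * r))); first exact: ler_pM.
  have aa : p * mu ^+ 2 / 2 * (p * mu ^+ 2 / 4) <= a * (a - h).
    by apply: ler_pM => //; [rewrite divr_ge0// mulr_ge0 ?ltW|exact: ltW].
  have -> : sqn_residual_const * p * (D * r) = 8 * sqn_residual_const * D / mu ^+ 4 * (1 / r) *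
      (p * mu ^+ 2 / 2 * (p * mu ^+ 2 / 4)).
    by rewrite pE; field; rewrite !gt_eqF.
  have B0 : 0 <= 8 * sqn_residual_const * D / mu ^+ 4.
    apply: divr_ge0; last by rewrite exprn_ge0// ltW.
    by apply: mulr_ge0; [exact: mulr_ge0|exact: le_trans D1].
  apply: ler_pM => //.
  - by rewrite mulr_ge0// divr_ge0// ltW.
  - by rewrite mulr_ge0// ltW// divr_gt0// mulr_gt0.
  - by rewrite ler_wpM2l// ler_wpM2r// invr_ge0 ltW.
have d2 : `|b2 / a - rho| <= ratio_const * (x / r).
  have -> : b2 / a - rho = (b2 - p * mu ^+ 2 * rho + rho * (p * mu ^+ 2 - a)) / a.
    by field; rewrite gt_eqF.
  rewrite normrM normfV (gtr0_norm a0) ler_pdivrMr//.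
  apply: (@le_trans _ _ ((residual_const + row_energy_bound * (2 * mu + s2 + 1)) * (x * r))).
    apply: le_trans (ler_normD _ _) _; rewrite [leRHS]mulrDl lerD//.
    rewrite normrM (ger0_norm rho0) -mulrA; apply: ler_pM => //.
    have xr : x <= x * r by rewrite ler_peMr// ltW.
    have -> : p * mu ^+ 2 - a = - (2 * mu * N + V) by rewrite aE; ring.
    have n1 : `|2 * mu * N| <= 2 * mu * (x * r).
      rewrite normrM gtr0_norm ?mulr_gt0// ler_pM2l ?mulr_gt0//.
      exact: le_trans Nx xr.
    have v1 : V <= (s2 + 1) * (x * r).
      apply: le_trans V1 _; rewrite ler_peMr//; first lra.
      by apply: le_trans x1 xr.
    by rewrite normrN; apply: le_trans (ler_normD _ _) _; rewrite (ger0_norm V0); lra.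
  have -> : (residual_const + row_energy_bound * (2 * mu + s2 + 1)) * (x * r) =
      ratio_const * (x / r) * (p * mu ^+ 2 / 2).
    by rewrite /ratio_const pE; field; rewrite !gt_eqF.
  apply: ler_wpM2l => //; apply: mulr_ge0; last by rewrite divr_ge0// ltW.
  have t0 : 0 <= 2 * mu + s2 + 1 by lra.
  rewrite /ratio_const; apply: divr_ge0; last exact: ltW.
  by apply: mulr_ge0 => //; apply: addr_ge0 => //; apply: mulr_ge0 => //; lra.
have -> : p * s2 / n = s2 * (p / n) by ring.
have -> : expansion_const * x / r = 8 * sqn_residual_const * D / mu ^+ 4 * (x / r) + ratio_const * (x / r) + x / r.
  by rewrite /expansion_const; ring.
move: d2 rx; rewrite !ler_norml => /andP[? ?] /andP[? ?].
by apply/andP; split; lra.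
Qed.

End combination.

(** * The tail bound *)

Section peeling.
Context {d : measure_display} {T : measurableType d} {R : realType}
  (P : probability T R).

(** Union bound in a form suited to long lists of exceptional events: they are
    removed one at a time until nothing is left. *)
Lemma probability_peel (A E : set T) (e b : R) : measurable A -> measurable E ->
  (P E <= e%:E)%E -> (P (A `\` E) <= b%:E)%E -> (P A <= (e + b)%:E)%E.
Proof.
move=> mA mE Ee Ab; rewrite EFinD.
apply: le_trans (leeD Ee Ab).
have mAE : measurable (A `\` E) by exact: measurableD.
apply: le_trans (measureU2 P mE mAE).
apply: le_measure; rewrite ?inE//; first exact: measurableU.
by move=> w Aw; have [Ew|nEw] := pselect (E w); [left|right].
Qed.

End peeling.

Section centering.
Context {d : measure_display} {T : measurableType d} {R : realType}
  (P : probability T R) {p n : nat} (mu sigma : R).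

Lemma iid_normal_noise (X : 'I_p -> 'I_n -> {RV P >-> R}) : 0 < sigma ->
  iid_normal X mu sigma ->
  exists Y : 'I_p * 'I_n -> {RV P >-> R},
    [/\ mutually_independent Y, forall x, normal_law P (Y x) 0 sigma &
        forall w, sample_mx X w = \matrix_(i, j) (mu + Y (i, j) w)].
Proof.
move=> s0 [indX lawX].
have mF (x : 'I_p * 'I_n) : measurable_fun setT (fun w => X x.1 x.2 w - mu).
  by apply: measurable_funB.
pose Y x : {RV P >-> R} := HB.pack (fun w => X x.1 x.2 w - mu)
  (isMeasurableFun.Build _ _ _ _ (fun w => X x.1 x.2 w - mu) (mF x)).
exists Y; split.
- move=> J B mB.
  have mB' x : measurable ((fun r : R => r - mu) @^-1` B x).
    have ms : measurable_fun setT (fun r : R => r - mu) by exact: measurable_funB.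
    by rewrite -[X in measurable X]setTI; exact: ms.
  exact: (indX J _ mB').
- move=> [i j]; have nX : normal_law P (X i j) mu sigma.
    by split=> // A mA; exact: lawX.
  have := normal_law_affine (- mu) ltr01 s0 nX; rewrite !mul1r subrr.
  by under eq_fun do rewrite mul1r.
- by move=> w; apply/matrixP => i j; rewrite !mxE addrC subrK.
Qed.

End centering.

Lemma gaussian_moment_ge0 {R : realType} (s : R) k : 0 <= gaussian_moment s (2 * k).
Proof.
apply: fine_ge0; apply: integral_ge0 => x _.
by rewrite lee_fin exprM; apply: exprn_ge0; exact: sqr_ge0.
Qed.

Section tail.
Context {R : realType} (mu sigma c : R).
Hypotheses (mu0 : 0 < mu) (sigma0 : 0 < sigma) (c0 : 0 < c).

Let s2 := sigma ^+ 2.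
Let m4 := gaussian_moment sigma (2 * 2).
Let m8 := gaussian_moment sigma (2 * 4).
Let kc : R := (2 * m4 + m8 + 1) * (2 * c + 1).
Let D : R := kc + 1.
Let Q : R := 2 * m4 + 4 * c * s2 ^+ 2.

Definition tail_C2 : R := expansion_const mu s2 c D * (2 / c).
Definition tail_C3 : R := Q + 2 * c * s2 + 12 * c ^+ 2 * m4 + 1.
Definition tail_K : R :=
  6 * c * m4 + 4 * kc ^+ 2 + 12 * c ^+ 2 * m4 + Q + 2 * c * s2 + 1.
Definition tail_p0 : R := (1 + 4 / mu + 4 * D / mu ^+ 2) ^+ 2.

Let m4_ge0 : 0 <= m4. Proof. exact: gaussian_moment_ge0. Qed.
Let m8_ge0 : 0 <= m8. Proof. exact: gaussian_moment_ge0. Qed.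
Let s2_ge0 : 0 <= s2. Proof. exact: sqr_ge0. Qed.
Let kc_ge0 : 0 <= kc.
Proof. by rewrite mulr_ge0// !addr_ge0// mulr_ge0// ltW. Qed.
Let D_ge1 : 1 <= D. Proof. by rewrite lerDr. Qed.
Let Q_ge0 : 0 <= Q.
Proof. by rewrite addr_ge0 ?mulr_ge0 ?sqr_ge0// ltW. Qed.

Lemma tail_C2_gt0 : 0 < tail_C2.
Proof. by rewrite mulr_gt0 ?divr_gt0//; exact: expansion_const_gt0. Qed.

Let c2 : 0 <= 2 * c. Proof. by rewrite mulr_ge0// ltW. Qed.
Let cs2 : 0 <= 2 * c * s2. Proof. exact: mulr_ge0. Qed.
Let c2m4 : 0 <= 12 * c ^+ 2 * m4.
Proof. by apply: mulr_ge0 => //; exact: (mulr_ge0 (ler0n _ 12) (sqr_ge0 c)). Qed.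

Lemma tail_C3_ge1 : 1 <= tail_C3.
Proof. by rewrite /tail_C3 lerDr; do 2!apply: addr_ge0 => //. Qed.

Lemma tail_K_gt0 : 0 < tail_K.
Proof.
have cm4 : 0 <= 6 * c * m4 by apply: mulr_ge0 => //; rewrite mulr_ge0// ltW.
have kc2 : 0 <= 4 * kc ^+ 2 by rewrite mulr_ge0// sqr_ge0.
by apply: ltr_wpDl => //; do 4!apply: addr_ge0 => //.
Qed.

Context {d : measure_display} {T : measurableType d} (P : probability T R).
Context {p n : nat} (X : 'I_p -> 'I_n -> {RV P >-> R}).
Hypotheses (p0 : (0 < p)%N) (n0 : (0 < n)%N).
Hypotheses (pn_ge : c / 2 <= p%:R / n%:R) (pn_le : p%:R / n%:R <= 2 * c).
Hypothesis p_large : tail_p0 <= p%:R.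
Hypothesis iidX : iid_normal X mu sigma.

Local Notation W w := (cov_mx (sample_mx (fun i j => X i j) w)).

Let mX i j : measurable_fun setT (X i j). Proof. by []. Qed.

Lemma measurable_lambda11 : measurable_fun setT (fun w => lambda11 (W w)).
Proof.
apply: measurable_funM => //; do 2!(apply: measurable_sum => ?).
rewrite /cov_mx /sample_mx.
under eq_fun do rewrite mxE mxE; apply: measurable_funM => //.
apply: measurable_sum => k; under eq_fun do rewrite !mxE.
exact: measurable_funM.
Qed.

Lemma measurable_deviation : measurable_fun setT
  (fun w => `|lambda11 (W w) - lambda_max (W w) + p%:R * sigma ^+ 2 / n%:R|).
Proof.
apply: measurableT_comp => //; apply: measurable_funD => //.
apply: measurable_funB; first exact: measurable_lambda11.
exact: measurable_lambda_max_cov.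
Qed.

(** For x < 1 the bound exceeds 1. Otherwise remove the eight exceptional events,
    five of them independent of x, and apply [lambda_max_expansion] outside. *)
Lemma lambda_max_tail (x : R) : 0 < x ->
  (P [set w | (tail_C2 * Num.sqrt p%:R * x / n%:R <
     `|lambda11 (W w) - lambda_max (W w) + p%:R * sigma ^+ 2 / n%:R|)%R] <
   (tail_C3 / x ^+ 2 + tail_K / p%:R)%:E)%E.
Proof.
move=> x0; set A := [set w | _]; have C31 := tail_C3_ge1; have K0 := tail_K_gt0.
have pR : 0 < p%:R :> R by rewrite ltr0n.
have nR : 0 < n%:R :> R by rewrite ltr0n.
have mA : measurable A by apply: measurable_gt; exact: measurable_deviation.
have [x1|x1] := ltP x 1.
  apply: le_lt_trans (probability_le1 P mA) _; rewrite lte_fin.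
  apply: (@le_lt_trans _ _ (tail_C3 / x ^+ 2)); last by rewrite ltrDl divr_gt0.
  rewrite ler_pdivlMr ?exprn_gt0// mul1r; apply: le_trans C31.
  by rewrite expr_le1// ltW.
have [Y [indY nY XE]] := iid_normal_noise sigma0 iidX.
pose y := noise (fun z => Y z : T -> R).
have momY z : moments P (Y z) by exact: normal_law_moments sigma0 (nY z).
have Y1 z : mean P (Y z) = 0 by exact: normal_law_mean sigma0 (nY z).
have Y2 z : mean P (fun w => Y z w ^+ 2) = s2 by exact: normal_law_variance.
have Y4 z : mean P (fun w => Y z w ^+ 4) <= m4.
  by rewrite (normal_law_even_moment 2 (nY z)).
have Y8 z : mean P (fun w => Y z w ^+ 8) <= m8.
  by rewrite (normal_law_even_moment 4 (nY z)).
have s2m4 : s2 ^+ 2 <= m4.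
  have z : 'I_p * 'I_n by exact: (Ordinal p0, Ordinal n0).
  rewrite -(Y2 z); apply: le_trans (sqr_mean_le (momentsX 2 (momY z))) _.
  by rewrite (@eq_mean _ _ _ _ _ (fun w => Y z w ^+ 4))// => w; rewrite -exprM.
pose r : R := Num.sqrt p%:R.
have r2 : r ^+ 2 = p%:R by rewrite sqr_sqrtr// ltW.
have r0 : 0 < r by rewrite sqrtr_gt0.
pose V w := col_energy (y w); pose rho w := row_energy (y w).
pose q w := cross_energy (y w); pose N w := mean_shift (y w).
pose g w := gram_energy (y w).
have mV : moments P V by exact: moments_col_energy.
have mrho : moments P rho by exact: moments_row_energy.
have mq : moments P q by exact: moments_cross_energy.
have mN : moments P N by exact: moments_mean_shift.
have mg : moments P g by exact: moments_gram_energy.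
have mc (e : R) : moments P (fun=> e) by exact: moments_cst.
have mV' := momentsB mV (mc s2).
have mg' := momentsB mg (mc (mean P g)).
have mrho' := momentsB mrho (mc (s2 * (p%:R / n%:R))).
have q_ge0 w : 0 <= q w.
  rewrite mulr_ge0 ?invr_ge0// mulr_ge0 ?invr_ge0 ?exprn_ge0//.
  by apply: sumr_ge0 => i _; exact: sqr_ge0.
have V_ge0 w : 0 <= V w.
  by rewrite mulr_ge0 ?invr_ge0 ?mulr_ge0// sumr_ge0// => i _; exact: sqr_ge0.
have rho_ge0 w : 0 <= rho w.
  by rewrite mulr_ge0 ?invr_ge0 ?exprn_ge0// sumr_ge0// => i _; exact: sqr_ge0.
have meanq : mean P q <= Q.
  have v := cross_energy_mean indY momY Y1 Y2 Y4 s2_ge0 p0 n0.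
  apply: (le_trans v).
  by have := ler_wpM2l (sqr_ge0 s2) pn_le; rewrite /Q; lra.
have meanN : mean P (fun w => N w ^+ 2) <= 2 * c * s2.
  rewrite (mean_shift_sqr indY momY Y1 Y2 n0).
  by have := ler_wpM2l s2_ge0 pn_le; lra.
have pn0 : 0 <= p%:R / n%:R :> R by rewrite divr_ge0.
have pn2 : p%:R / n%:R ^+ 2 <= 4 * c ^+ 2 / p%:R.
  have -> : p%:R / n%:R ^+ 2 = (p%:R / n%:R) ^+ 2 / p%:R :> R.
    by field; rewrite !gt_eqF.
  by rewrite ler_pM2r ?invr_gt0//; have := pn_le; nra.
have varrho : mean P (fun w => (rho w - s2 * (p%:R / n%:R)) ^+ 2) <=
    12 * c ^+ 2 * m4 / p%:R.
  have v := row_energy_variance indY momY Y1 Y2 Y4 s2m4 n0.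
  apply: (le_trans v).
  by have := ler_wpM2l m4_ge0 pn2; lra.
have varV : mean P (fun w => (V w - s2) ^+ 2) <= 6 * c * m4 / p%:R.
  have v := col_energy_variance indY momY Y1 Y2 Y4 s2m4 p0 n0.
  apply: (le_trans v).
  have n1 : n%:R^-1 <= 2 * c / p%:R by rewrite ler_pdivlMr// mulrC.
  by have := ler_wpM2l m4_ge0 n1; lra.
have kcE : (2 * m4 + m8 + 1) * (p%:R / n%:R + 1) <= kc.
  by rewrite ler_wpM2l ?lerD2r// !addr_ge0// mulr_ge0.
have meang : mean P g <= p%:R * kc.
  have v := gram_energy_mean indY momY Y1 Y2 Y4 Y8 s2m4 p0 n0.
  apply: (le_trans v).
  by rewrite ler_pM2l.
have varg : mean P (fun w => (g w - mean P g) ^+ 2) <= 4 * p%:R * kc ^+ 2.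
  have v := gram_energy_variance indY momY Y1 Y2 Y4 Y8 s2m4 p0 n0.
  apply: (le_trans v).
  rewrite ler_wpM2l ?mulr_ge0// lerXn2r ?nnegrE//.
  by rewrite mulr_ge0// addr_ge0// ?addr_ge0// mulr_ge0.
have gt t F : moments P F -> measurable [set w | t < `|F w|].
  move=> mF; apply: measurable_gt; apply: measurableT_comp => //.
  exact: moments_measurable mF.
have cheb F t b : moments P F -> 0 < t -> mean P (fun w => F w ^+ 2) <= b ->
    (P [set w | (t < `|F w|)%R] <= (b / t ^+ 2)%:E)%E.
  move=> mF t0 Fb; apply: le_trans (chebyshev_mean mF t0) _.
  by rewrite lee_fin ler_pM2r// invr_gt0 exprn_gt0.
have mark t : 0 < t -> (P [set w | (t < q w)%R] <= (Q / t)%:E)%E.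
  move=> t0; apply: le_trans (markov_mean mq q_ge0 t0) _.
  by rewrite lee_fin ler_pM2r// invr_gt0.
have mqt t : measurable [set w | t < q w].
  by apply: measurable_gt; exact: moments_measurable mq.
have xr0 : 0 < x / r by rewrite divr_gt0.
(* the terms follow the order in which the events are removed *)
have : (P A <= (6 * c * m4 / p%:R / 1 ^+ 2 + (4 * p%:R * kc ^+ 2 / p%:R ^+ 2 +
   (12 * c ^+ 2 * m4 / p%:R / 1 ^+ 2 + (Q / p%:R + (2 * c * s2 / r ^+ 2 +
   (Q / x ^+ 2 + (2 * c * s2 / x ^+ 2 + (12 * c ^+ 2 * m4 / p%:R / (x / r) ^+ 2 +
    0))))))))%:E)%E.
  apply: (probability_peel mA (gt _ _ mV') (cheb _ _ _ mV' ltr01 varV)).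
  set A1 := A `\` _; have mA1 : measurable A1 by apply: measurableD => //; exact: gt.
  apply: (probability_peel mA1 (gt _ _ mg') (cheb _ _ _ mg' pR varg)).
  set A2 := A1 `\` _; have mA2 : measurable A2 by apply: measurableD => //; exact: gt.
  apply: (probability_peel mA2 (gt _ _ mrho') (cheb _ _ _ mrho' ltr01 varrho)).
  set A3 := A2 `\` _; have mA3 : measurable A3 by apply: measurableD => //; exact: gt.
  apply: (probability_peel mA3 (mqt _) (mark _ pR)).
  set A4 := A3 `\` _; have mA4 : measurable A4 by exact: measurableD.
  apply: (probability_peel mA4 (gt _ _ mN) (cheb _ _ _ mN r0 meanN)).
  set A5 := A4 `\` _; have mA5 : measurable A5 by apply: measurableD => //; exact: gt.
  apply: (probability_peel mA5 (mqt _) (mark _ (exprn_gt0 2 x0))).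
  set A6 := A5 `\` _; have mA6 : measurable A6 by exact: measurableD.
  apply: (probability_peel mA6 (gt _ _ mN) (cheb _ _ _ mN x0 meanN)).
  set A7 := A6 `\` _; have mA7 : measurable A7 by apply: measurableD => //; exact: gt.
  apply: (probability_peel mA7 (gt _ _ mrho') (cheb _ _ _ mrho' xr0 varrho)).
  rewrite (_ : _ `\` _ = set0) ?measure0//.
  apply/seteqP; split=> // w [[[[[[[[Aw E1] E2] E3] E4] E5] E6] E7] E8].
  have {}E1 : `|V w - s2| <= 1 by rewrite leNgt; apply/negP.
  have {}E2 : `|g w - mean P g| <= p%:R by rewrite leNgt; apply/negP.
  have {}E3 : `|rho w - s2 * (p%:R / n%:R)| <= 1 by rewrite leNgt; apply/negP.
  have {}E4 : q w <= p%:R by rewrite leNgt; apply/negP.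
  have {}E5 : `|N w| <= r by rewrite leNgt; apply/negP.
  have {}E6 : q w <= x ^+ 2 by rewrite leNgt; apply/negP.
  have {}E7 : `|N w| <= x by rewrite leNgt; apply/negP.
  have {}E8 : `|rho w - s2 * (p%:R / n%:R)| <= x / r by rewrite leNgt; apply/negP.
  have t_le : 1 + 4 / mu + 4 * D / mu ^+ 2 <= r.
    rewrite -(ler_pXn2r (n := 2)) ?nnegrE ?(ltW r0) ?r2//.
    have h4 : 0 <= 4 * D by rewrite mulr_ge0//; exact: le_trans D_ge1.
    have h1 : 0 <= 4 / mu by rewrite divr_ge0// ltW.
    have h2 : 0 <= 4 * D / mu ^+ 2 by rewrite divr_ge0// sqr_ge0.
    by rewrite addr_ge0// addr_ge0.
  have [t1 [t2 t3]] : 1 <= r /\ 4 <= mu * r /\ 4 * D <= mu ^+ 2 * r.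
    have h4 : 0 <= 4 * D by rewrite mulr_ge0//; exact: le_trans D_ge1.
    have h1 : 0 <= 4 / mu by rewrite divr_ge0// ltW.
    have h2 : 0 <= 4 * D / mu ^+ 2 by rewrite divr_ge0// sqr_ge0.
    split; first lra.
    split; first by rewrite [leRHS]mulrC -ler_pdivrMr//; lra.
    by rewrite [leRHS]mulrC -ler_pdivrMr ?exprn_gt0//; lra.
  have WE : W w = cov_mx (\matrix_(i, j) (mu + y w i j)) by rewrite XE.
  move: Aw; rewrite /A/= WE ltNge => /negP; apply.
  have dec := lambda11_decomp mu (y w) p0 n0.
  have lo := lambda_max_cov_lower (mu := mu) (y := y w) p0.
  have up := lambda_max_cov_upper (mu := mu) (y := y w) p0 n0.
  have res := residual_bound mu (y w) p0 n0.
  have rhoK : rho w <= row_energy_bound s2 c.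
    move: E3; rewrite ler_norml => /andP[_ h]; rewrite /row_energy_bound.
    by have := ler_wpM2l s2_ge0 pn_le; lra.
  have gD : g w <= D ^+ 2 * p%:R.
    move: E2; rewrite ler_norml => /andP[_ h].
    apply: (@le_trans _ _ (D * p%:R)); first by rewrite /D; lra.
    rewrite ler_pM2r// expr2 ler_peMl//; exact: le_trans D_ge1.
  have V1 : V w <= s2 + 1 by move: E1; rewrite ler_norml => /andP[_ h]; lra.
  have := lambda_max_expansion mu0 s2_ge0 c0 D_ge1 t1 (esym r2) t2 t3 x1 dec
    (sqn_ge0 _) lo up res (V_ge0 w) V1 gD (rho_ge0 w) rhoK (q_ge0 w) E4 E5 E6 E7 E8.
  move=> /le_trans; apply.
  have -> : tail_C2 * Num.sqrt p%:R * x / n%:R =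
      expansion_const mu s2 c D * x / r * (2 / c * (p%:R / n%:R)).
    by rewrite /tail_C2 -/r -r2; field; rewrite !gt_eqF.
  rewrite ler_peMr//.
    apply: divr_ge0; last exact: ltW.
    by apply: mulr_ge0; [apply: ltW; exact: expansion_const_gt0|exact: ltW].
  by rewrite mulrAC ler_pdivlMr// mul1r; have := pn_ge; lra.
move=> /le_lt_trans; apply; rewrite lte_fin.
have -> : tail_C3 / x ^+ 2 + tail_K / p%:R = (6 * c * m4 / p%:R / 1 ^+ 2 + (4 * p%:R * kc ^+ 2 / p%:R ^+ 2 +
   (12 * c ^+ 2 * m4 / p%:R / 1 ^+ 2 + (Q / p%:R + (2 * c * s2 / r ^+ 2 +
   (Q / x ^+ 2 + (2 * c * s2 / x ^+ 2 + (12 * c ^+ 2 * m4 / p%:R / (x / r) ^+ 2 +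
    0)))))))) + (1 / x ^+ 2 + 1 / p%:R).
  rewrite /tail_C3 /tail_K (expr_div_n x r) r2; field.
  by rewrite !gt_eqF.
by rewrite ltrDl addr_gt0// divr_gt0// exprn_gt0.
Qed.

End tail.

(** * The normal term and the remainder *)

Section main_term.
Context {R : realType} (mu sigma c : R).
Hypotheses (mu0 : 0 < mu) (sigma0 : 0 < sigma) (c0 : 0 < c).
Context {d : measure_display} {T : measurableType d} (P : probability T R).
Context {p n : nat} (X : 'I_p -> 'I_n -> {RV P >-> R}).
Hypotheses (p0 : (0 < p)%N) (n0 : (0 < n)%N).
Hypothesis iidX : iid_normal X mu sigma.

Let pR : 0 < p%:R :> R. Proof. by rewrite ltr0n. Qed.
Let nR : 0 < n%:R :> R. Proof. by rewrite ltr0n. Qed.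

Definition main_term (w : T) : R :=
  2 * mu * mean_shift (fun i j => X i j w - mu).

Lemma measurable_main_term : measurable_fun setT main_term.
Proof.
apply: measurable_funM => //; apply: measurable_funM => //.
by do 2!(apply: measurable_sum => ?); apply: measurable_funB.
Qed.

Lemma main_term_law : normal_law P main_term 0 (2 * mu * sigma * Num.sqrt (p%:R / n%:R)).
Proof.
have [Y [indY nY XE]] := iid_normal_noise sigma0 iidX.
have sz : (0 < size (enum {: 'I_p * 'I_n}))%N.
  by rewrite -cardE card_prod !card_ord muln_gt0 p0.
have a0 : 0 < 2 * mu / n%:R by rewrite divr_gt0// mulr_gt0.
have := normal_law_affine 0 a0 _ (normal_law_sum sigma0 indY nY (enum_uniq _) sz).
rewrite -cardE card_prod !card_ord mulr0 addr0.
have -> : 2 * mu / n%:R * (Num.sqrt (p * n)%:R * sigma) =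
    2 * mu * sigma * Num.sqrt (p%:R / n%:R).
  rewrite natrM sqrtrM ?ler0n// sqrtrM ?ler0n// sqrtrV ?ler0n//.
  have sn : Num.sqrt n%:R != 0 :> R by rewrite gt_eqF// sqrtr_gt0.
  have nE : n%:R = Num.sqrt n%:R ^+ 2 :> R by rewrite sqr_sqrtr ?ler0n.
  by rewrite [X in _ / X]nE; field.
rewrite mulr_gt0// ?sqrtr_gt0 ?ltr0n ?muln_gt0 ?p0// => /(_ isT).
congr (normal_law P _ _ _); apply/funext => w.
rewrite addr0 big_enum/= /main_term /mean_shift /grand_tot -[LHS]mulrA; congr (_ * (_ * _)).
rewrite pair_bigA/=; apply: eq_bigr => -[i j] _ /=.
by have /matrixP/(_ i j) := XE w; rewrite !mxE => ->; rewrite addrAC subrr add0r.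
Qed.

Lemma lambda11_main_term w : lambda11 (cov_mx (sample_mx X w)) =
  p%:R * mu ^+ 2 + main_term w + col_energy (fun i j => X i j w - mu).
Proof.
rewrite -(lambda11_decomp _ _ p0 n0); congr (lambda11 (cov_mx _)).
by apply/matrixP => i j; rewrite !mxE addrC subrK.
Qed.

Let m4 := gaussian_moment sigma (2 * 2).
Let C2 := tail_C2 mu sigma c.
Let C3 := tail_C3 sigma c.
Let K := tail_K sigma c.

Definition remainder_const (e : R) : R :=
  (36 * C3 * C2 ^+ 2 * c ^+ 2 + 54 * c * m4) / e ^+ 2 + K.

Hypotheses (pn_ge : c / 2 <= p%:R / n%:R) (pn_le : p%:R / n%:R <= 2 * c).
Hypothesis p_large : tail_p0 mu sigma c <= p%:R.

(** The remainder is the sum of the error of the expansion, of V - sigma^2 and of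
    the deterministic (p / n - c) sigma^2; each is allowed e / 3. *)
Lemma remainder_tail (e : R) : 0 < e ->
  `|p%:R / n%:R - c| * sigma ^+ 2 <= e / 3 ->
  (P [set w | (e < `|lambda_max (cov_mx (sample_mx X w)) - p%:R * mu ^+ 2
      - (1 + c) * sigma ^+ 2 - main_term w|)%R] <= (remainder_const e / p%:R)%:E)%E.
Proof.
move=> e0 pnc; set A := [set w | _].
have e3 : 0 < e / 3 by rewrite divr_gt0.
have mX i j : measurable_fun setT (X i j) by [].
have ml := measurable_lambda_max_cov p0 mX.
have mA : measurable A.
  apply: measurable_gt; apply: measurableT_comp => //.
  apply: measurable_funB; last exact: measurable_main_term.
  by apply: measurable_funB => //; apply: measurable_funB.
have [Y [indY nY XE]] := iid_normal_noise sigma0 iidX.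
have momY z : moments P (Y z) by exact: normal_law_moments sigma0 (nY z).
have Y1 z : mean P (Y z) = 0 by exact: normal_law_mean sigma0 (nY z).
have Y2 z : mean P (fun w => Y z w ^+ 2) = sigma ^+ 2 by exact: normal_law_variance.
have Y4 z : mean P (fun w => Y z w ^+ 4) <= m4.
  by rewrite (normal_law_even_moment 2 (nY z)).
have s2m4 : (sigma ^+ 2) ^+ 2 <= m4.
  have z : 'I_p * 'I_n by exact: (Ordinal p0, Ordinal n0).
  rewrite -(Y2 z); apply: le_trans (sqr_mean_le (momentsX 2 (momY z))) _.
  by rewrite (@eq_mean _ _ _ _ _ (fun w => Y z w ^+ 4))// => w; rewrite -exprM.
have yE : (fun w i j => X i j w - mu) = noise (fun x => Y x : T -> R).
  apply/funext => w; apply/funext => i; apply/funext => j.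
  by have /matrixP/(_ i j) := XE w; rewrite !mxE => ->; rewrite addrAC subrr add0r.
have mV := moments_col_energy momY.
have varV := col_energy_variance indY momY Y1 Y2 Y4 s2m4 p0 n0.
have mV' := momentsB mV (moments_cst P (sigma ^+ 2)).
(* the value of x for which the threshold of the tail bound is e / 3 *)
pose x := e / 3 * n%:R / (C2 * Num.sqrt p%:R).
have sp : 0 < Num.sqrt p%:R :> R by rewrite sqrtr_gt0.
have C20 : 0 < C2 by exact: tail_C2_gt0.
have C30 : 0 < C3 by exact: (lt_le_trans ltr01 (tail_C3_ge1 sigma0 c0)).
have x0 : 0 < x by rewrite divr_gt0// mulr_gt0.
have tail := lambda_max_tail mu0 sigma0 c0 p0 n0 pn_ge pn_le p_large iidX x0.
have xE : tail_C2 mu sigma c * Num.sqrt p%:R * x / n%:R = e / 3.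
  by rewrite /x -/C2; field; rewrite !gt_eqF.
rewrite xE in tail.
have mdev : measurable [set w | e / 3 <
    `|lambda11 (cov_mx (sample_mx X w)) - lambda_max (cov_mx (sample_mx X w))
      + p%:R * sigma ^+ 2 / n%:R|].
  by apply: measurable_gt; exact: measurable_deviation.
have mVt : measurable [set w | e / 3 <
    `|col_energy (noise (fun x => Y x : T -> R) w) - sigma ^+ 2|].
  apply: measurable_gt; apply: measurableT_comp => //.
  exact: moments_measurable mV'.
have cheb := le_trans (chebyshev_mean mV' e3) (_ : _ <= (54 * c * m4 / e ^+ 2 / p%:R)%:E)%E.
apply: (@le_trans _ _ (C3 / x ^+ 2 + K / p%:R + (54 * c * m4 / e ^+ 2 / p%:R + 0))%:E)%E.
  apply: (probability_peel mA mdev (ltW tail)).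
  apply: (probability_peel _ mVt (cheb _)).
  - exact: measurableD.
  - rewrite lee_fin.
    have n1 : n%:R^-1 <= 2 * c / p%:R by rewrite ler_pdivlMr// mulrC.
    have m40 : 0 <= m4 by exact: gaussian_moment_ge0.
    rewrite ler_pdivrMr ?exprn_gt0//; apply: le_trans varV _.
    have -> : 54 * c * m4 / e ^+ 2 / p%:R * (e / 3) ^+ 2 = 3 * (m4 * (2 * c / p%:R)).
      by field; rewrite !gt_eqF.
    by have := ler_wpM2l m40 n1; lra.
  rewrite (_ : _ `\` _ = set0) ?measure0//.
  apply/seteqP; split=> // w [[Aw E1] E2].
  have {}E1 : `|lambda11 (cov_mx (sample_mx X w)) - lambda_max (cov_mx (sample_mx X w))
      + p%:R * sigma ^+ 2 / n%:R| <= e / 3 by rewrite leNgt; apply/negP.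
  have {}E2 : `|col_energy (noise (fun x => Y x : T -> R) w) - sigma ^+ 2| <= e / 3.
    by rewrite leNgt; apply/negP.
  move: Aw; rewrite /A/= ltNge => /negP; apply.
  rewrite lambda11_main_term in E1; rewrite -yE in E2.
  move: E1 E2 pnc; set l := lambda_max _; set V := col_energy _.
  have -> : p%:R * sigma ^+ 2 / n%:R = p%:R / n%:R * sigma ^+ 2 by ring.
  rewrite -[X in _ * X <= _](ger0_norm (sqr_ge0 sigma)) -normrM.
  rewrite !ler_norml => /andP[? ?] /andP[? ?] /andP[? ?].
  by apply/andP; split; lra.
have xE2 : C3 / x ^+ 2 = 9 * C3 * C2 ^+ 2 / e ^+ 2 * ((p%:R / n%:R) ^+ 2 / p%:R).
  have spE : Num.sqrt p%:R ^+ 2 = p%:R :> R by rewrite sqr_sqrtr ?ler0n.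
  have gen (a b : R) : a != 0 -> b / (e / 3 * n%:R / (a * Num.sqrt p%:R)) ^+ 2 =
      9 * b * a ^+ 2 / e ^+ 2 * ((p%:R / n%:R) ^+ 2 / p%:R).
    move=> a0; rewrite expr_div_n !exprMn spE; field.
    by rewrite a0 !gt_eqF.
  exact: gen (lt0r_neq0 C20).
have pn2 : (p%:R / n%:R) ^+ 2 <= 4 * c ^+ 2.
  have pn1 : 0 <= p%:R / n%:R :> R by rewrite divr_ge0.
  by have := pn_le; nra.
have pn3 : (p%:R / n%:R) ^+ 2 / p%:R <= 4 * c ^+ 2 / p%:R.
  by rewrite ler_pM2r// invr_gt0.
have w0 : 0 <= 9 * C3 * C2 ^+ 2 / e ^+ 2.
  by rewrite divr_ge0 ?sqr_ge0// mulr_ge0 ?sqr_ge0// mulr_ge0// ltW.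
have := ler_wpM2l w0 pn3.
rewrite lee_fin xE2 /remainder_const -/K.
have -> : ((36 * C3 * C2 ^+ 2 * c ^+ 2 + 54 * c * m4) / e ^+ 2 + K) / p%:R =
    9 * C3 * C2 ^+ 2 / e ^+ 2 * (4 * c ^+ 2 / p%:R) +
    54 * c * m4 / e ^+ 2 / p%:R + K / p%:R by field; rewrite !gt_eqF.
lra.
Qed.

End main_term.

Lemma probability_shift {d : measure_display} {T : measurableType d} {R : realType}
    (P : probability T R) (U V : T -> R) (a e : R) :
  measurable_fun setT U -> measurable_fun setT V ->
  (P [set w | (U w <= a)%R] <=
   P [set w | (V w <= a + e)%R] + P [set w | (e < `|U w - V w|)%R])%E.
Proof.
move=> mU mV.
have mle (F : T -> R) b : measurable_fun setT F -> measurable [set w | F w <= b].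
  move=> mF; rewrite -[X in measurable X]setTI.
  have -> : [set w | F w <= b] = F @^-1` `]-oo, b]%classic.
    by apply/seteqP; split=> w /=; rewrite in_itv.
  exact: mF.
have mUV : measurable [set w | e < `|U w - V w|].
  by apply: measurable_gt; apply: measurableT_comp => //; exact: measurable_funB.
have m1 := mle _ a mU; have m2 := mle _ (a + e) mV.
apply: le_trans (measureU2 P m2 mUV).
apply: le_measure; rewrite ?inE//; first exact: measurableU.
move=> w /= Ua; have [h|h] := ltP e `|U w - V w|; [by right|left => /=].
by move: h; rewrite ler_norml => /andP[]; lra.
Qed.

Lemma normal_prob_ray {R : realType} (s a t : R) : 0 < s -> 0 < a ->
  normal_prob 0 (a * s) [set` `]-oo, t]] = normal_prob 0 s [set` `]-oo, t / a]].
Proof.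
move=> s0 a0; have := @normal_prob_affine _ 0 s a 0 `]-oo, t]%classic a0 s0.
rewrite mulr0 addr0 => <-//; congr (normal_prob 0 s _).
apply/seteqP; split=> x /=; rewrite !in_itv/= /affine addr0 ler_pdivlMr// mulrC//.
Qed.

(** * Asymptotics *)

Section asymptotics.
Context {R : realType} (mu sigma c : R).
Hypotheses (mu0 : 0 < mu) (sigma0 : 0 < sigma) (c0 : 0 < c).
Variables (p : nat -> nat).
Hypothesis p_infty : p n @[n --> \oo] --> \oo.
Hypothesis p_over_n : (p n)%:R / n%:R @[n --> \oo] --> c.

Let near_p (M : R) : \forall n \near \oo, M <= (p n)%:R.
Proof.
have /cvgnyPge/(_ (Num.trunc M).+1) := p_infty.
apply: filterS => n h; apply: le_trans (ltW (truncnS_gt M)) _.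
by rewrite ler_nat.
Qed.

Let near_regime : \forall n \near \oo, [/\ (0 < n)%N, c / 2 <= (p n)%:R / n%:R,
  (p n)%:R / n%:R <= 2 * c & tail_p0 mu sigma c <= (p n)%:R].
Proof.
have h1 : c / 2 < c by rewrite ltr_pdivrMr// ltr_pMr// ltr1n.
have h2 : c < 2 * c by rewrite ltr_pMl// ltr1n.
near=> n; split.
- by near: n; exact: nbhs_infty_gt.
- by apply: ltW; near: n; exact: (cvgr_gt _ p_over_n _ h1).
- by apply: ltW; near: n; exact: (cvgr_lt _ p_over_n _ h2).
- by near: n; exact: near_p.
Unshelve. all: by end_near. Qed.

Variables (d : nat -> measure_display) (T : forall n, measurableType (d n))
  (P : forall n, probability (T n) R)
  (X : forall n, 'I_(p n) -> 'I_n -> {RV (P n) >-> R}).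
Arguments X : clear implicits.
Hypothesis p_gt0 : forall n, (0 < p n)%N.
Hypothesis iidX : forall n, iid_normal (X n) mu sigma.

Lemma lambda_max_tail_near : \forall n \near \oo, forall x : R, 0 < x ->
  (P n [set w | (tail_C2 mu sigma c * Num.sqrt (p n)%:R * x / n%:R <
     `| lambda11 (cov_mx (sample_mx (X n) w)) - lambda_max (cov_mx (sample_mx (X n) w))
        + (p n)%:R * sigma ^+ 2 / n%:R |)%R]
   < (tail_C3 sigma c / x ^+ 2 + tail_K sigma c / (p n)%:R)%:E)%E.
Proof.
near=> n; have [n0 pn1 pn2 pl] : [/\ (0 < n)%N, c / 2 <= (p n)%:R / n%:R,
  (p n)%:R / n%:R <= 2 * c & tail_p0 mu sigma c <= (p n)%:R].
  by near: n; exact: near_regime.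
by move=> x x0; exact: lambda_max_tail.
Unshelve. all: by end_near. Qed.

Let s := Num.sqrt (4 * c * mu ^+ 2 * sigma ^+ 2).

Let sE : s = 2 * mu * sigma * Num.sqrt c.
Proof.
rewrite /s; have -> : 4 * c * mu ^+ 2 * sigma ^+ 2 = (2 * mu * sigma) ^+ 2 * c by ring.
by rewrite sqrtrM ?sqr_ge0// sqrtr_sqr gtr0_norm// !mulr_gt0.
Qed.

Let s0 : 0 < s.
Proof. by rewrite sE mulr_gt0 ?sqrtr_gt0// !mulr_gt0. Qed.

Let ratio n : R := Num.sqrt ((p n)%:R / n%:R / c).

Let ratio_cvg : (ratio n)^-1 @[n --> \oo] --> (1 : R).
Proof.
rewrite -[X in _ --> X]invr1; apply: cvgV; first exact: oner_neq0.
rewrite -[X in _ --> X]sqrtr1; apply: continuous_cvg; first exact: sqrt_continuous.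
rewrite -[X in _ --> X](mulfV (lt0r_neq0 c0)).
by apply: cvgM => //; exact: cvg_cst.
Qed.

Let Y n w := lambda_max (cov_mx (sample_mx (X n) w)) - (p n)%:R * mu ^+ 2
  - (1 + c) * sigma ^+ 2.
Arguments Y : clear implicits.

Let mY n : measurable_fun setT (Y n).
Proof.
apply: measurable_funB => //; apply: measurable_funB => //.
by apply: measurable_lambda_max_cov.
Qed.

Let main_term_ray n t : (0 < n)%N ->
  P n [set w | main_term mu (X n) w <= t] =
  normal_prob 0 s [set` `]-oo, t / ratio n]].
Proof.
move=> n0; have [_ law] := main_term_law mu0 sigma0 (p_gt0 n) n0 (iidX n).
have -> : [set w | main_term mu (X n) w <= t] =
    main_term mu (X n) @^-1` `]-oo, t]%classic.
  by apply/seteqP; split=> w /=; rewrite in_itv.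
have r0 : 0 < ratio n by rewrite sqrtr_gt0 !divr_gt0// ltr0n.
have E : 2 * mu * sigma * Num.sqrt ((p n)%:R / n%:R) = ratio n * s.
  rewrite sE mulrCA; congr (_ * _); rewrite -sqrtrM ?divr_ge0 ?(ltW c0)//.
  by rewrite divfK// gt_eqF.
have {}law := law _ (measurable_itv `]-oo, t]); rewrite law E.
exact: normal_prob_ray.
Qed.

(** The normal term has standard deviation s * ratio n, where ratio n -> 1, so its
    distribution function at t is that of the limit at t / ratio n; the continuity
    of the limit at x absorbs both this rescaling and the remainder. *)
Lemma lambda_max_asymptotically_normal : cvg_in_distribution P Y (normal_prob 0 s).
Proof.
split; first exact: mY.
move=> x cx; set nu := normal_prob 0 s in cx *.
pose F t : R := fine (nu [set` `]-oo, t]]).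
have nuE t : nu [set` `]-oo, t]] = (F t)%:E.
  by rewrite /F fineK//; exact: fin_num_measure.
have cF : F t @[t --> x] --> F x.
  have : nu [set` `]-oo, t]] @[t --> x] --> (F x)%:E by rewrite -nuE; exact: cx.
  by move=> /fine_cvgP[].
have mYx n : measurable [set w | Y n w <= x].
  rewrite -[X in measurable X]setTI.
  have -> : [set w | Y n w <= x] = Y n @^-1` `]-oo, x]%classic.
    by apply/seteqP; split=> w /=; rewrite in_itv.
  exact: mY.
have fY n : P n [set w | Y n w <= x] \is a fin_num by exact: fin_num_measure.
rewrite [X in _ --> X]nuE; apply/fine_cvgP; split; first by near=> n; exact: fY.
apply/cvgrPdist_le => e e0 /=.
have e2 : 0 < e / 2 by rewrite divr_gt0.
have /nbhs_ballP[dl /= dl0 xdl] : nbhs x [set t | `|F x - F t| <= e / 2].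
  by have /cvgrPdist_le/(_ _ e2) := cF.
pose h := dl / 2.
have h0 : 0 < h by rewrite divr_gt0.
have scaled (t : R) : t / ratio n @[n --> \oo] --> t.
  rewrite -[X in _ --> X]mulr1; apply: cvgM; first exact: cvg_cst.
  exact: ratio_cvg.
have near_ray (t : R) : `|x - t| <= h ->
    \forall n \near \oo, `|F x - F (t / ratio n)| <= e / 2.
  move=> xt; have /cvgrPdist_lt/(_ _ h0) := scaled t; apply: filterS => n tn.
  apply: xdl; rewrite /ball/=.
  have -> : x - t / ratio n = (x - t) + (t - t / ratio n) by ring.
  by apply: le_lt_trans (ler_normD _ _) _; rewrite /h in xt tn; lra.
have sg0 : 0 < sigma ^+ 2 by rewrite exprn_gt0.
have e3 : 0 < h / 3 / sigma ^+ 2 by rewrite !divr_gt0.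
near=> n.
have [n0 pn1 pn2 pl] : [/\ (0 < n)%N, c / 2 <= (p n)%:R / n%:R,
  (p n)%:R / n%:R <= 2 * c & tail_p0 mu sigma c <= (p n)%:R].
  by near: n; exact: near_regime.
have up : `|F x - F ((x + h) / ratio n)| <= e / 2.
  near: n; apply: near_ray.
  by rewrite opprD addrA subrr sub0r normrN gtr0_norm.
have lo : `|F x - F ((x - h) / ratio n)| <= e / 2.
  by near: n; apply: near_ray; rewrite opprB addrCA subrr addr0 gtr0_norm.
have pnc : `|(p n)%:R / n%:R - c| * sigma ^+ 2 <= h / 3.
  rewrite -ler_pdivlMr// distrC; near: n.
  by have /cvgrPdist_le/(_ _ e3) := p_over_n.
have rem := remainder_tail mu0 sigma0 c0 (p_gt0 n) n0 (iidX n) pn1 pn2 pl h0 pnc.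
have remE : remainder_const mu sigma c h / (p n)%:R <= e / 2.
  rewrite ler_pdivrMr ?ltr0n// -ler_pdivrMl//; near: n; exact: near_p.
have mZ := measurable_main_term mu (X n).
have u1 := probability_shift (P n) x h (@mY n) mZ.
have u2 := probability_shift (P n) (x - h) h mZ (@mY n).
rewrite subrK in u2.
rewrite main_term_ray// (nuE : forall t, normal_prob 0 s _ = (F t)%:E) in u1.
rewrite main_term_ray// (nuE : forall t, normal_prob 0 s _ = (F t)%:E) in u2.
have b1 : (P n [set w | (h < `|Y n w - main_term mu (X n) w|)%R] <= (e / 2)%:E)%E.
  by apply: le_trans rem _; rewrite lee_fin.
have b2 : (P n [set w | (h < `|main_term mu (X n) w - Y n w|)%R] <= (e / 2)%:E)%E.
  by under eq_set do rewrite distrC.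
have {}u1 := le_trans u1 (leeD (le_refl _) b1).
have {}u2 := le_trans u2 (leeD (le_refl _) b2).
rewrite -(fineK (fY n)) -?EFinD !lee_fin in u1 u2.
move: up lo; rewrite !ler_norml => /andP[? ?] /andP[? ?].
by apply/andP; split; lra.
Unshelve. all: by end_near. Qed.

End asymptotics.

Theorem theorem1p1 (R : realType) (mu sigma c : R)
    (mu_gt0 : 0 < mu) (sigma_gt0 : 0 < sigma) (c_gt0 : 0 < c) :
  exists C2 C3 K : R, [/\ 0 < C2, 0 < C3, 0 < K &
    forall (p : nat -> nat) (d : nat -> measure_display)
      (T : forall n, measurableType (d n)) (P : forall n, probability (T n) R)
      (X : forall n, 'I_(p n) -> 'I_n -> {RV (P n) >-> R}),
    (forall n, (0 < p n)%N) ->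
    p n @[n --> \oo] --> \oo ->
    (p n)%:R / n%:R @[n --> \oo] --> c ->
    (forall n, iid_normal (X n) mu sigma) ->
    let W n w := cov_mx (sample_mx (X n) w) in
    cvg_in_distribution P
      (fun n w => lambda_max (W n w)
                  - (p n)%:R * mu ^+ 2 - (1 + c) * sigma ^+ 2)
      (normal_prob 0 (Num.sqrt (4 * c * mu ^+ 2 * sigma ^+ 2)))
    /\
    (\forall n \near \oo, forall x : R, 0 < x ->
      (P n [set w | (C2 * Num.sqrt (p n)%:R * x / n%:R <
                     `| lambda11 (W n w) - lambda_max (W n w)
                        + (p n)%:R * sigma ^+ 2 / n%:R |)%R]
       < (C3 / x ^+ 2 + K / (p n)%:R)%:E)%E)].
Proof.
exists (tail_C2 mu sigma c), (tail_C3 sigma c), (tail_K sigma c); split.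
- exact: tail_C2_gt0.
- exact: lt_le_trans ltr01 (tail_C3_ge1 sigma_gt0 c_gt0).
- exact: tail_K_gt0.
move=> p d T P X p_gt0 p_infty p_over_n iidX W; split.
  exact: lambda_max_asymptotically_normal.
exact: lambda_max_tail_near.
Qed.
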